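(* Let the Markov chain expectation problem $(S,P,K,s,\beta)$, the value function $\mu$, the model $\mu(\cdot\,;\alpha)$, the finite set $D=\{x_1,\dots,x_d\}\subset A$ of starting points and the estimation map $\alpha:\mathbb{R}^d\to\mathbb{R}^p$ be as in the context, and suppose that Assumptions 1, 2, 3 and 4 listed in the context hold. Then there exist an integer $R_0$ and a number $\theta>1$ such that for every $R\ge R_0$ the sequence of iterates $\mu^{(n)}$, $n\ge 0$, of the adaptive importance sampling algorithm with $R$ replications per starting point (described in the context) satisfies $$\theta^n\,\|\mu^{(n)}-\mu\|\to 0\quad\text{almost surely as } n\to\infty .$$
   Context: **Setting.** $S$ is a Polish space with its Borel $\sigma$-algebra, $P(x,dy)$ a transition kernel on $S$, and $X=(X_0,X_1,\dots)$ the associated Markov chain; $\mathbb{P}_x,\mathbb{E}_x$ denote probability and expectation given $X_0=x$, and $\mathbb{E}_x[Z;C]=\mathbb{E}_x[Z\mathbf 1_C]$. $K\subset S$ is measurable and $\tau=\inf\{n\ge 0: X_n\in K\}$. $s,\beta$ are real measurable functions on $S\times S$ with $s(x,y)\ge 0$, $\beta(x,y)>0$, and $s(x,y)=0$ for $x\in K$. Put $$Y=\sum_{i=1}^{\tau}s(X_{i-1},X_i)B_i,\qquad B_i=\prod_{j=1}^i\beta(X_{j-1},X_j),\qquad \mu(x)=\mathbb{E}_x[Y],$$ so $\mu=0$ on $K$. It is assumed throughout that every $x$ with $\mathbb{P}_x(Y>0)=0$ belongs to $K$, so that $A:=\{x:\mu(x)>0\}=K^c$. $\mathcal{B}$ is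 the set of bounded measurable functions on $S$ that vanish on $K$, with the sup-norm $\|\cdot\|$, and $\mathcal{B}_+$ is its subset of nonnegative functions. Write $P_\beta(x,dy)=\beta(x,y)P(x,dy)$, $(P_\beta f)(x)=\int_S f(y)P_\beta(x,dy)$ and $h(x)=\mathbb{E}_x[\beta(x,X_1)s(x,X_1)]$. **Assumption 1.** $\sup_{x\in A,y\in S}s(x,y)<\infty$; $\sup_{x\in A,y\in S}\beta(x,y)<\infty$; $\inf_{x\in A,y\in S}\beta(x,y)>0$; $\sup_{x\in A}\mu(x)<\infty$. **Assumption 2.** There is a finite $m$ with $\inf_{x\in A}\mathbb{E}_x[s(X_{\tau-1},X_\tau);\tau\le m]>0$. **Importance sampling measures.** For $\nu\in\mathcal{B}_+$ with $\nu(x)>0$ for all $x\in A$ ( **Assumption 3**, imposed on every $\nu$ used for importance sampling; in particular on the initial estimate below), let $g(x)=h(x)+(P_\beta\nu)(x)$, which is positive on $A$, and $$Q_\nu(x,dy)=\frac{[s(x,y)+\nu(y)]\beta(x,y)}{g(x)}P(x,dy)\ (x\in A),\qquad Q_\nu(x,dy)=P(x,dy)\ (x\notin A),$$ $$l_\nu(x,y)=\frac{g(x)}{[s(x,y)+\nu(y)]\beta(x,y)}\ (x\in A),\qquad l_\nu(x,y)=1\ (x\notin A),$$ with $l_\nu=\infty$ when the denominator is $0$ (such transitions have $Q_\nu$-probability $0$). $\mathbb{Q}_{\nu,x}$ is the law of the Markov chain with kernel $Q_\nu$ and $X_0=x$. Put $L_n^\nu=\prod_{i=1}^n l_\nu(X_{i-1},X_i)$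 and $Y_\nu=\sum_{i=1}^\tau s(X_{i-1},X_i)B_iL_i^\nu$ (with $0\cdot\infty=0$). **Model and estimation.** $D=\{x_1,\dots,x_d\}\subset A$ is a finite set of starting points. A finite-dimensional model $\mu(\cdot\,;\alpha)$, $\alpha\in\mathbb{R}^p$, for $\mu$ is given (for example $\mu(x;\alpha)=b_0(x)+\sum_{k=1}^p\alpha_kb_k(x)$ with linearly independent basis functions $b_k$), with $\mu(\cdot\,;\alpha_{\rm true})=\mu$ for some $\alpha_{\rm true}$. The parameter estimate is $\hat\alpha=\alpha(\mathbf y)$ for a function $\alpha:\mathbb{R}^d\to\mathbb{R}^p$, where $\mathbf y=(\bar Y_1,\dots,\bar Y_d)$ and $\bar Y_i$ is the average of the $R$ simulated values started from $x_i$. **Assumption 4.** (a) $\mathbf y\mapsto\mu(\cdot\,;\alpha(\mathbf y))$ is Lipschitz continuous from $\mathbb{R}^d_+$ to $\mathcal{B}_+$; (b) $\mu(\cdot\,;\alpha(\mathbf y))=\mu$ for $\mathbf y=(\mu(x_1),\dots,\mu(x_d))$; (c) there is $\epsilon>0$ such that $\mu(x;\alpha(\mathbf y))\ge\epsilon$ for all $x\in A$ and all $\mathbf y\in\mathbb{R}^d_+$. **Algorithm.** Choose an initial estimate $\mu^{(0)}\in\mathcal{B}_+$ with $\mu^{(0)}>0$ on $A$. Given $\mu^{(n)}$, for each $x_i\in D$ simulate (freshly, given $\mu^{(n)}$) $R$ independent replications of $Y_{\mu^{(n)}}$ under $\mathbb{Q}_{\mu^{(n)},x_i}$, let $\bar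 Y_i$ be their average, set $\hat\alpha=\alpha(\bar Y_1,\dots,\bar Y_d)$ and $\mu^{(n+1)}=\mu(\cdot\,;\hat\alpha)$; repeat indefinitely. *)

(* Defs.v *)
From HB Require Import structures.
From mathcomp Require Import all_boot all_order all_algebra.
From mathcomp Require Import all_classical all_reals all_analysis.

Set Implicit Arguments.
Unset Strict Implicit.
Unset Printing Implicit Defensive.
Import Order.TTheory GRing.Theory Num.Theory.
Import numFieldNormedType.Exports.
Local Open Scope classical_set_scope.
Local Open Scope ring_scope.

Definition polish_space (R : realType) (S : topologicalType) : Prop :=
  (exists2 D : set S, countable D & dense D) /\
  exists dist : S -> S -> R,
  [/\ forall x y, 0 <= dist x y /\ (dist x y = 0 <-> x = y),
      forall x y, dist x y = dist y x,
      forall x y z, dist x z <= dist x y + dist y z,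
      forall x (U : set S),
        nbhs x U <-> exists2 e : R, 0 < e & [set y | dist x y < e] `<=` U
    & forall u : nat -> S,
        (forall e : R, 0 < e -> exists N : nat, forall m n : nat,
           (N <= m)%N -> (N <= n)%N -> dist (u m) (u n) < e) ->
        exists l : S, u @ \oo --> l].

Notation borel S := (g_sigma_algebraType (@open S)).

Definition cylinders {d : measure_display} (S : measurableType d) :
    set (set (nat -> S)) :=
  [set C | exists n (B : set S), measurable B /\ C = [set w | B (w n)]].
Arguments cylinders {d} S.

(* The space S^nat with its product sigma-algebra; [w n] is X_n. *)
Notation trajectory S := (g_sigma_algebraType (cylinders S)).

Section chain.
Context {R : realType} {d : measure_display} {S : measurableType d}.
Implicit Types (x y : S) (w : trajectory S) (nu : S -> R).

(* [L] is the law of the Markov chain with transition kernel [k] and X_0 = x: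
   E[1(X_(n+1) in B) | X_0, ..., X_n] = k(X_n, B), tested on the rectangles
   [X_0 in C 0, ..., X_n in C n], which form a pi-system generating the past;
   at most one [L] satisfies this. *)
Definition markov_law (k : S -> set S -> \bar R) x
    (L : probability (trajectory S) R) : Prop :=
  (forall B : set S, measurable B -> L [set w | B (w 0%N)] = (\d_x B)%E) /\
  forall (n : nat) (C : nat -> set S) (B : set S),
    (forall i, measurable (C i)) -> measurable B ->
    L ([set w | forall i, (i <= n)%N -> C i (w i)] `&` [set w | B (w n.+1)]) =
    (\int[L]_(w in [set w | forall i, (i <= n)%N -> C i (w i)]) k (w n) B)%E.

(* The supremum norm, with value +oo on unbounded functions. *)
Definition supnorm (f : S -> \bar R) : \bar R :=
  ereal_sup [set `|f x|%E | x in [set: S]].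

Variables (P : R.-pker S ~> S) (K : set S) (s beta : S -> S -> R).
(* [PP x] plays the role of the law P_x of the chain started from x. *)
Variable PP : S -> probability (trajectory S) R.

(* inf {n >= 0 : X_n in K}, where [None] stands for infinity. *)
Definition tau w : option nat :=
  match pselect (exists n, w n \in K) with
  | left h => Some (ex_minn h)
  | right _ => None
  end.

Definition le_tau (i : nat) w : bool :=
  if tau w is Some t then (i <= t)%N else true.

Definition Bprod w (i : nat) : R :=
  \prod_(1 <= j < i.+1) beta (w j.-1) (w j).

Definition Y w : \bar R :=
  (\sum_(1 <= i <oo | le_tau i w) (s (w i.-1) (w i) * Bprod w i)%:E)%E.

Definition mu x : \bar R := (\int[PP x]_w Y w)%E.

Definition A : set S := [set x | (0 < mu x)%E].

Definition bounded_nonneg nu : Prop :=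
  [/\ measurable_fun setT nu,
      (supnorm (EFin \o nu) < +oo)%E,
      forall x, K x -> nu x = 0
    & forall x, 0 <= nu x].

Definition assumption1 : Prop :=
  [/\ (ereal_sup [set z | exists x y, A x /\ z = (s x y)%:E] < +oo)%E,
      (ereal_sup [set z | exists x y, A x /\ z = (beta x y)%:E] < +oo)%E,
      (0 < ereal_inf [set z | exists x y, A x /\ z = (beta x y)%:E])%E
    & (ereal_sup [set mu x | x in A] < +oo)%E].

(* s(X_(tau-1), X_tau); when tau = 0 the index tau - 1 is read as 0, which only
   concerns chains started in K. *)
Definition last_score w : R :=
  if tau w is Some t then s (w t.-1) (w t) else 0.

Definition assumption2 : Prop :=
  exists m : nat,
    (0 < ereal_inf
       [set (\int[PP x]_(w in [set w | exists2 t, tau w = Some t & (t <= m)%N])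
               (last_score w)%:E) | x in A])%E.

Definition h x : \bar R :=
  (\int[PP x]_w (beta x (w 1%N) * s x (w 1%N))%:E)%E.

Definition Pbeta nu x : \bar R := (\int[P x]_y (nu y * beta x y)%:E)%E.

Definition g nu x : \bar R := (h x + Pbeta nu x)%E.

Definition Q nu x (B : set S) : \bar R :=
  if x \in A
  then (\int[P x]_(y in B) (((s x y + nu y) * beta x y)%:E / g nu x))%E
  else P x B.

(* In [\bar R] the inverse of 0 is +oo, so that [l nu x y = +oo] when its
   denominator vanishes (and g > 0). *)
Definition l nu x y : \bar R :=
  if x \in A then (g nu x / ((s x y + nu y) * beta x y)%:E)%E else 1%E.

Definition Lprod nu w (n : nat) : \bar R :=
  (\prod_(1 <= i < n.+1) l nu (w i.-1) (w i))%E.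

(* [0 * +oo = 0] in [\bar R]. *)
Definition Ynu nu w : \bar R :=
  (\sum_(1 <= i <oo | le_tau i w)
     ((s (w i.-1) (w i) * Bprod w i)%:E * Lprod nu w i))%E.

(* The nu to which importance sampling applies. *)
Definition admissible nu : Prop :=
  bounded_nonneg nu /\ forall x, A x -> 0 < nu x.

Variables (dim p : nat) (D : 'I_dim -> S).
Variables (model : 'rV[R]_p -> S -> R) (alpha : 'rV[R]_dim -> 'rV[R]_p).

Definition orthant (v : 'rV[R]_dim) : Prop := forall i, 0 <= v ord0 i.

Definition assumption4 : Prop :=
  [/\ (forall v, orthant v -> bounded_nonneg (model (alpha v))) /\
      (exists C : R, forall v v', orthant v -> orthant v' ->
         (supnorm (fun x => (model (alpha v) x - model (alpha v') x)%:E)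
          <= (C * `|v - v'|)%:E)%E),
      forall x, (model (alpha (\row_i fine (mu (D i)))) x)%:E = mu x
    & exists2 eps : R, 0 < eps &
        forall x v, A x -> orthant v -> eps <= model (alpha v) x].

Section algorithm.
Variables (rep : nat) (mu0 : S -> R).

(* A sample mean equal to +oo, which has probability 0, is read as 0. *)
Definition sample_mean nu (ws : 'I_rep -> trajectory S) : R :=
  fine ((rep%:R^-1)%:E * \sum_(k < rep) Ynu nu (ws k))%E.

(* [sim n i k] is the k-th trajectory simulated from D i with the n-th
   estimate. *)
Fixpoint iterates (sim : nat -> 'I_dim -> 'I_rep -> trajectory S) (n : nat) :
    S -> R :=
  if n is n'.+1
  then model (alpha (\row_i sample_mean (iterates sim n') (sim n' i)))
  else mu0.

(* [QQ nu x] plays the role of the law of the chain with kernel Q_nu started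
   from x. *)
Variable QQ : (S -> R) -> S -> probability (trajectory S) R.
Variables (d' : measure_display) (Omega : measurableType d').
Variable Pr : probability Omega R.
Variable sim : nat -> 'I_dim -> 'I_rep -> Omega -> trajectory S.

Definition past (n : nat) : set (set Omega) :=
  <<s [set E | exists (m : nat) i k (C : set (trajectory S)),
         [/\ (m < n)%N, measurable C & E = sim m i k @^-1` C]] >>.

Definition estimate (n : nat) (omega : Omega) : S -> R :=
  iterates (fun m i k => sim m i k omega) n.

(* Given the past, the trajectories of stage n are independent, the one indexed
   by (i, k) having law [QQ nu (D i)] with nu the current estimate. *)
Definition adaptive_simulation : Prop :=
  (forall n i k, measurable_fun setT (sim n i k)) /\
  forall (n : nat) (E : set Omega) (C : 'I_dim -> 'I_rep -> set (trajectory S)),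
    past n E -> (forall i k, measurable (C i k)) ->
    Pr (E `&` [set omega | forall i k, C i k (sim n i k omega)]) =
    (\int[Pr]_(omega in E)
       \prod_(i < dim) \prod_(k < rep) QQ (estimate n omega) (D i) (C i k))%E.

End algorithm.
End chain.

(* Main.v *)
(** Whatever the admissible estimate [nu], the scores are unbiased: [Y_nu] has mean
    [mu(x)] under [Q_nu]. By Lipschitz continuity it suffices that the squared error
    [E_n] of the sample means of stage [n] decays geometrically.

    Let [V] be the distance from [nu] to [mu]. If [V] is small, the partial scores plus
    [nu] times the current weight telescope along a path, so that [|Y_nu - mu(x)|] is
    at most a constant times [V * \sum_(k < tau) rho ^ k] with [rho] close to 1;
    since [nu >= eps], Assumption 2 gives [tau] geometric tails under [Q_nu], and the
    second moment is [O(V^2)]. At a bounded distance one truncates the series of the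
    scores: the truncations are bounded and the remainders have small mean, so the error
    is small with high probability for many replications. Further away only the first
    moment, hence Markov's inequality, is available.

    Accordingly [W(E) = min(E, b)] for [E <= B] and [16 b] beyond satisfies
    [E W(E_(n+1)) <= E W(E_n) / 8] for many replications; thus [4^n W(E_n)] is almost
    surely bounded, and [W(E_n) < b] forces [W(E_n) = E_n]. *)
Require Import Defs.
From HB Require Import structures.
From mathcomp Require Import all_boot all_order all_algebra.
From mathcomp Require Import all_classical all_reals all_analysis.
From mathcomp Require Import measurable_realfun ring lra.
Import Order.TTheory GRing.Theory Num.Theory.
Import numFieldNormedType.Exports.
Local Open Scope classical_set_scope.
Local Open Scope ring_scope.

Set Implicit Arguments.
Unset Strict Implicit.
Unset Printing Implicit Defensive.

(** * Monotone functionals *)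

(** No variance bound uniform over the possible estimates is available, so the squared error itself
    cannot be contracted in mean; the function [W] of the overview absorbs this, and its constants
    are tied together. From beyond [B], Markov's inequality only yields an expected weight of [2 b],
    since even a return below [B] may cost [b]; the weight there is [16 b] so that [2 b] is one
    eighth of it. A failure from the middle range may then cost [16 b], so its probability must be
    at most 1/256, which leaves [b/16] for success.

    The initial estimate has neither the lower bound [eps] nor a controlled distance to the target.
    It enters only through [W <= 16 b] after its stage, which is why the number of replications and
    the rate can be fixed before it.

    Laws of chains are given by their values on rectangles, and nothing is assumed on how the
    sampling law depends on the estimate. Identities between path integrals are therefore extended
    from pi-systems, and measurability in the random estimate is derived from the formula on
    rectangles. *)

Lemma addIe_fin (R : realType) (x y z : \bar R) :
  x \is a fin_num -> (x + y = x + z)%E -> y = z.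
Proof.
move=> fx h; rewrite -(addeK y fx) -(addeK z fx).
by rewrite [(y + x)%E]addeC [(z + x)%E]addeC h.
Qed.

Definition nneg_measurable (R : realType) d (T : measurableType d)
  (F : T -> \bar R) := measurable_fun setT F /\ forall x, (0 <= F x)%E.

(** Abstracts integration against a measure. Iterated kernel integrals with weights satisfy the same
    axioms, so one uniqueness statement serves both the Markov property and the simulation of a
    stage. *)
Record monotone_functional (R : realType) d (T : measurableType d)
    (Phi : (T -> \bar R) -> \bar R) : Prop := MonotoneFunctional {
  mf_ge0 : forall F, nneg_measurable F -> (0 <= Phi F)%E;
  mf_le : forall F G, nneg_measurable F -> nneg_measurable G ->
    (forall x, F x <= G x)%E -> (Phi F <= Phi G)%E;
  mf_add : forall F G, nneg_measurable F -> nneg_measurable G ->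
    Phi (F \+ G)%E = (Phi F + Phi G)%E;
  mf_scale : forall (r : R) F, 0 <= r -> nneg_measurable F ->
    Phi (fun x => r%:E * F x)%E = (r%:E * Phi F)%E;
  mf_cvg : forall (F_ : nat -> T -> \bar R) F, (forall n, nneg_measurable (F_ n)) ->
    (forall x, nondecreasing_seq (F_ ^~ x)) ->
    (forall x, F_ n x @[n --> \oo] --> F x) ->
    Phi (F_ n) @[n --> \oo] --> Phi F }.

Section monotone_functional_theory.
Import HBNNSimple.
Context (R : realType).
Implicit Types (d : measure_display).

Lemma mf_eval d (T : measurableType d) (x : T) :
  @monotone_functional R _ T (fun F => F x).
Proof. by split=> // F [_]. Qed.

Lemma mf_mul d (T : measurableType d) (v : T -> R)
    (Phi : (T -> \bar R) -> \bar R) :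
  measurable_fun setT v -> (forall x, 0 <= v x) -> monotone_functional Phi ->
  monotone_functional (fun F : T -> \bar R => Phi (fun x => (v x)%:E * F x)%E).
Proof.
move=> mv v0 hPhi.
have H F : nneg_measurable F -> nneg_measurable (fun x => (v x)%:E * F x)%E.
  move=> [mF F0]; split=> [|x]; last by rewrite mule_ge0// lee_fin.
  by apply: emeasurable_funM => //; exact/measurable_EFinP.
split.
- by move=> F /H; exact: mf_ge0.
- move=> F G /H hF /H hG FG; apply: (mf_le hPhi) => // x.
  by apply: lee_wpmul2l; [rewrite lee_fin|exact: FG].
- move=> F G hF hG; rewrite -(mf_add hPhi (H _ hF) (H _ hG)).
  congr Phi; apply/funext => x /=; rewrite ge0_muleDr//; first by case: hF.
  by case: hG.
- move=> r F r0 hF; rewrite -(mf_scale hPhi)//; last exact: H.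
  by congr Phi; apply/funext => x /=; rewrite muleCA.
- move=> F_ F hF nF cF.
  apply: (mf_cvg hPhi (F_ := fun n x => (v x)%:E * F_ n x)%E).
  + by move=> n; exact: H.
  + by move=> x m n mn; apply: lee_wpmul2l; [rewrite lee_fin|exact: nF].
  + by move=> x; apply: cvgeZl => //; exact: cF.
Qed.

(** Mixtures stay in the class, the last axiom by monotone convergence; this is what brings in
    iterated kernel integrals. *)
Lemma mf_integral d d' (T : measurableType d) (W : measurableType d')
    (m : {measure set W -> \bar R}) (Phi : W -> (T -> \bar R) -> \bar R) :
  (forall F, nneg_measurable F -> measurable_fun setT (Phi ^~ F)) ->
  (forall w, monotone_functional (Phi w)) ->
  monotone_functional (fun F => \int[m]_w Phi w F)%E.
Proof.
move=> mPhi hPhi; split.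
- by move=> F hF; apply: integral_ge0 => w _; exact: (mf_ge0 (hPhi w)).
- move=> F G hF hG FG; apply: ge0_le_integral => //.
  + by move=> w _; exact: (mf_ge0 (hPhi w)).
  + exact: mPhi.
  + exact: mPhi.
  + by move=> w _; exact: (mf_le (hPhi w)).
- move=> F G hF hG; rewrite -ge0_integralD//.
  + by apply: eq_integral => w _; rewrite (mf_add (hPhi w)).
  + by move=> w _; exact: (mf_ge0 (hPhi w)).
  + exact: mPhi.
  + by move=> w _; exact: (mf_ge0 (hPhi w)).
  + exact: mPhi.
- move=> r F r0 hF; rewrite -ge0_integralZl_EFin//.
  + by apply: eq_integral => w _; rewrite (mf_scale (hPhi w)).
  + by move=> w _; exact: (mf_ge0 (hPhi w)).
  + exact: mPhi.
- move=> F_ F hF nF cF.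
  have c w := mf_cvg (hPhi w) hF nF cF.
  rewrite (_ : (\int[m]_w Phi w F = \int[m]_w limn (fun n => Phi w (F_ n)))%E); last first.
    by apply: eq_integral => w _; apply/esym/cvg_lim.
  apply: cvg_monotone_convergence => //.
  + by move=> n; exact: mPhi.
  + by move=> n w _; exact: (mf_ge0 (hPhi w)).
  + move=> w _ a b ab.
    by apply: (mf_le (hPhi w)) => // x; exact: nF.
Qed.

Lemma nneg_measurable_indic d (T : measurableType d) (E : set T) :
  measurable E -> @nneg_measurable R _ T (EFin \o \1_E).
Proof.
by move=> mE; split=> [|x]; [exact/measurable_EFinP|rewrite lee_fin indicE].
Qed.

Lemma mf_sum d (T : measurableType d) (Phi : (T -> \bar R) -> \bar R)
    (I : Type) (r : seq I) (F : I -> T -> \bar R) :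
  monotone_functional Phi -> (forall i, nneg_measurable (F i)) ->
  Phi (fun x => \sum_(i <- r) F i x)%E = (\sum_(i <- r) Phi (F i))%E.
Proof.
move=> hPhi hF; elim: r => [|i r ih].
  rewrite big_nil; under eq_fun do rewrite big_nil.
  have h0 : @nneg_measurable R _ T (cst 0%E) by [].
  have := mf_scale hPhi (lexx 0) h0.
  by rewrite mul0e; under eq_fun do rewrite mul0e.
rewrite big_cons -ih -(mf_add hPhi) //.
  by congr Phi; apply/funext => x; rewrite big_cons.
split; last by move=> x; apply: sume_ge0 => j _; case: (hF j).
by apply: emeasurable_sum => j; case: (hF j).
Qed.

(* A nonnegative measurable function is the increasing limit of finite
   combinations of indicators, so two functionals that agree on a pi-system
   agree everywhere. *)
Lemma mf_unique d (T : measurableType d) (G : set (set T))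
    (Phi Psi : (T -> \bar R) -> \bar R) :
  monotone_functional Phi -> monotone_functional Psi ->
  @measurable _ T = <<s G >> -> setI_closed G ->
  (Phi (cst 1%E) < +oo)%E -> Phi (cst 1%E) = Psi (cst 1%E) ->
  (forall E, G E -> Phi (EFin \o \1_E) = Psi (EFin \o \1_E)) ->
  forall F, nneg_measurable F -> Phi F = Psi F.
Proof.
move=> hPhi hPsi mG GI Phioo H1 HG.
have h1 : @nneg_measurable R _ T (cst 1%E)%E by split=> // x; rewrite lee_fin.
have Hset E : measurable E -> Phi (EFin \o \1_E) = Psi (EFin \o \1_E).
  move=> mE; move: (mE); rewrite mG; move: E {mE}.
  apply: (dynkin_induction (P := fun E => Phi (EFin \o \1_E) = Psi (EFin \o \1_E)) mG GI).
  - by rewrite (_ : EFin \o _ = cst 1%E)//; apply/funext => x; rewrite /= indicT.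
  - exact: HG.
  - move=> E mE PE.
    have hE := nneg_measurable_indic mE.
    have hEC := nneg_measurable_indic (measurableC mE).
    have e1 : cst 1%E = ((EFin \o \1_E) \+ (EFin \o \1_(~` E)))%E :> (T -> \bar R).
      apply/funext => x /=; rewrite -EFinD indicC !indicE; congr EFin.
      by case: (x \in E) => /=; rewrite ?addr0 ?add0r ?subrr ?subr0 ?addr0 ?add0r.
    have := H1; rewrite e1 (mf_add hPhi)// (mf_add hPsi)// PE => H2.
    (* Finite total mass allows the contribution of [E] to be cancelled. *)
    have fE : Psi (EFin \o \1_E) \is a fin_num.
      rewrite ge0_fin_numE; last exact: (mf_ge0 hPsi).
      rewrite -PE; apply: le_lt_trans Phioo; apply: (mf_le hPhi) => // x.
      by rewrite /= lee_fin indicE; case: (x \in E).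
    exact: (addIe_fin fE H2).
  - move=> F mF tF PF.
    (* A disjoint union is the increasing limit of its finite unions, on which additivity gives
       agreement. *)
    pose U n := \big[setU/set0]_(i < n) F i.
    have mU n : measurable (U n) by apply: bigsetU_measurable.
    have inU n x : U n x <-> exists2 i, (i < n)%N & F i x.
      rewrite /U -(bigcup_mkord n F); split => [[i /= ? ?]|[i ? ?]]; by exists i.
    have iU n x : (\1_(U n.+1) x = \1_(U n) x + \1_(F n) x :> R).
      have [Fx|Fx] := pselect (F n x).
        rewrite !indicE (mem_set Fx) mem_set; last by apply/inU; exists n.
        rewrite memNset ?add0r// => /inU[i i_n Fix].
        have /trivIsetP/(_ i n I I) := tF.
        by rewrite (ltn_eqF i_n) => /(_ isT)/seteqP[+ _] => /(_ x); exact.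
      rewrite [X in _ + X]indicE (memNset Fx) addr0 !indicE; congr ((_ : bool)%:R).
      apply/idP/idP => /set_mem/inU[i i_n Fix]; apply/mem_set/inU; exists i => //.
        move: i_n; rewrite ltnS leq_eqVlt => /predU1P[E|//].
        by move: Fix; rewrite E.
      exact: ltnW.
    have cU x : (EFin \o \1_(U n)) x @[n --> \oo] --> ((EFin \o \1_(\bigcup_k F k)) x : \bar R).
      apply: cvg_near_cst.
      have [[k _ Fkx]|nx] := pselect ((\bigcup_k F k) x).
        exists k.+1 => // n /= kn; rewrite /= !indicE !mem_set//; first by exists k.
        by apply/inU; exists k.
      near=> n; rewrite /= !indicE !memNset// => /inU[i _ Fix].
      by apply: nx; exists i.
    have nU x : nondecreasing_seq ((fun n => EFin \o \1_(U n)) ^~ x : nat -> \bar R).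
      apply/nondecreasing_seqP => n.
      by rewrite /= lee_fin iU lerDl indicE.
    have hU n := nneg_measurable_indic (mU n).
    have eU n : Phi (EFin \o \1_(U n)) = Psi (EFin \o \1_(U n)).
      elim: n => [|n ih].
        rewrite /U big_ord0 indic0.
        have h0 : @nneg_measurable R _ T (cst 1%E) by split=> // x; rewrite lee_fin.
        have e0 : EFin \o cst 0 = (fun x => (0 : R)%:E * (cst 1 : T -> \bar R) x)%E.
          by apply/funext => x /=; rewrite mul0e.
        by rewrite e0 (mf_scale hPhi)// (mf_scale hPsi)// !mul0e.
      have e : EFin \o \1_(U n.+1) =
          ((EFin \o \1_(U n)) \+ (EFin \o \1_(F n)))%E :> (T -> \bar R).
        by apply/funext => x; rewrite /= iU.
      have hF := nneg_measurable_indic (mF n).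
      by rewrite e (mf_add hPhi)// (mf_add hPsi)// ih PF.
    have c1 := mf_cvg hPhi hU nU cU.
    have c2 := mf_cvg hPsi hU nU cU.
    rewrite (_ : (fun n => Phi (EFin \o \1_(U n))) = (fun n => Psi (EFin \o \1_(U n)))) in c1; last exact/funext.
    exact: (cvg_unique (@ereal_hausdorff R) c1 c2).
move=> F hF; have [mF F0] := hF.
pose AA n := nnsfun_approx measurableT mF n.
pose A n : T -> R := AA n.
have hA n : nneg_measurable (EFin \o A n).
  split; first exact/measurable_EFinP.
  by move=> x; rewrite /= lee_fin.
have nA x : nondecreasing_seq ((fun n => EFin \o A n) ^~ x : nat -> \bar R).
  by move=> a b ab; rewrite /= lee_fin; exact/lefP/nd_nnsfun_approx.
have cA x : (EFin \o A n) x @[n --> \oo] --> F x.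
  by apply: cvg_nnsfun_approx.
have c1 := mf_cvg hPhi hA nA cA.
have c2 := mf_cvg hPsi hA nA cA.
suff eA n : Phi (EFin \o A n) = Psi (EFin \o A n).
  rewrite (_ : (fun n => Phi (EFin \o A n)) = (fun n => Psi (EFin \o A n))) in c1; last exact/funext.
  exact: (cvg_unique (@ereal_hausdorff R) c1 c2).
have e : EFin \o A n = fun x => (\sum_(r <- finmap.enum_fset (fset_set (range (A n))))
    (r%:E * (EFin \o \1_(A n @^-1` [set r])) x))%E.
  apply/funext => x /=; have := fimfunE (AA n) x; rewrite /A => ->.
  by rewrite fsbig_finite//= -sumEFin.
(* Homogeneity concerns nonnegative scalars only; negative values are not attained and their terms
   vanish. *)
have hr r : 0 <= r \/ A n @^-1` [set r] = set0.
  have [r0|r0] := leP 0 r; [by left|right].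
  by rewrite /A preimage_nnfun0.
have hI r : @nneg_measurable R _ T (fun x => r%:E * (EFin \o \1_(A n @^-1` [set r])) x)%E.
  have [r0|->] := hr r.
    split; last by move=> x; rewrite mule_ge0// lee_fin ?indicE.
    by apply: emeasurable_funM => //; exact/measurable_EFinP.
  by rewrite indic0; split=> [|x]; rewrite /= -?EFinM ?mulr0//; under eq_fun do rewrite mule0.
rewrite e (mf_sum _ hPhi)// (mf_sum _ hPsi)//; apply: eq_bigr => r _.
have [r0|r0] := hr r.
  have hE := nneg_measurable_indic (measurable_funPTI (AA n) (measurable_set1 r)).
  by rewrite (mf_scale hPhi)// (mf_scale hPsi)// Hset.
have e0 : (fun x => r%:E * (EFin \o \1_(A n @^-1` [set r])) x)%E =
    (fun x => (0 : R)%:E * (cst 1 : T -> \bar R) x)%E.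
  by apply/funext => x; rewrite /= r0 indic0 /= mule0 mul0e.
rewrite e0.
by rewrite (mf_scale hPhi)// (mf_scale hPsi)// !mul0e.
Unshelve. all: by end_near. Qed.

End monotone_functional_theory.

(** * Path expectations of Markov chains *)

Section disintegration.
Context (R : realType).
Implicit Types (d : measure_display).

Lemma nneg_measurable_comp d d' (T : measurableType d) (T' : measurableType d')
    (j : T' -> T) (F : T -> \bar R) :
  measurable_fun setT j -> nneg_measurable F -> nneg_measurable (F \o j).
Proof.
by move=> mj [mF F0]; split=> [|x]; [exact: measurableT_comp|exact: F0].
Qed.

Lemma nneg_measurable_mul d (T : measurableType d) (v : T -> R) (F : T -> \bar R) :
  measurable_fun setT v -> (forall x, 0 <= v x) -> nneg_measurable F ->
  nneg_measurable (fun x => (v x)%:E * F x)%E.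
Proof.
move=> mv v0 [mF F0]; split=> [|x]; last by rewrite mule_ge0// lee_fin.
by apply: emeasurable_funM => //; exact/measurable_EFinP.
Qed.

Lemma nneg_measurable_kernel d d' (X : measurableType d) (Y : measurableType d')
    (k : R.-pker X ~> Y) (F : X * Y -> \bar R) :
  nneg_measurable F -> nneg_measurable (fun x => \int[k x]_y F (x, y))%E.
Proof.
move=> [mF F0]; split; first exact: measurable_fun_integral_finite_kernel.
by move=> x; apply: integral_ge0 => y _; exact: F0.
Qed.

Lemma integral_indicM d (T : measurableType d) (m : {measure set T -> \bar R})
  (E : set T) (f : T -> \bar R) :
  (\int[m]_(x in E) f x = \int[m]_x ((\1_E x)%:E * f x))%E.
Proof.
rewrite integral_mkcond; apply: eq_integral => x _.
by rewrite patchE indicE; case: ifPn; rewrite ?mul1e ?mul0e.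
Qed.

(** Only the first factor is reduced to a generating pi-system: for the past of a chain rectangles
    suffice, while the new coordinate ranges over all measurable sets. *)
Lemma measurable_prod_pi_system d1 d2 (X : measurableType d1)
    (Y : measurableType d2) (G : set (set X)) :
  @measurable _ X = <<s G >> -> G setT ->
  @measurable _ (X * Y)%type = <<s [set A `*` B | A in G & B in @measurable _ Y] >>.
Proof.
move=> mG GT; rewrite measurable_prod_measurableType; apply/seteqP; split.
  apply: smallest_sub; first exact: smallest_sigma_algebra.
  move=> _ [A mA [B mB <-]].
  rewrite -[A `*` B](_ : (A `*` setT) `&` (setT `*` B) = _); last first.
    by apply/seteqP; split=> -[x y] /=; tauto.
  pose N := g_sigma_algebraType [set A `*` B | A in G & B in @measurable _ Y].
  apply: (@measurableI _ N).
    have : measurable_fun setT (fst : N -> X).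
      apply: (measurability G) => //.
      move=> _ [C GC <-]; apply: sub_sigma_algebra; exists C => //; exists setT => //.
      by apply/seteqP; split => -[x y] /=; tauto.
    move=> /(_ measurableT _ mA); rewrite setTI (_ : _ @^-1` _ = A `*` setT)//.
    by apply/seteqP; split => -[x y]//= [].
  by apply: sub_sigma_algebra; exists setT => //; exists B.
apply: smallest_sub; first exact: smallest_sigma_algebra.
move=> _ [A GA [B mB <-]]; apply: sub_sigma_algebra; exists A; last by exists B.
by rewrite mG; exact: sub_sigma_algebra.
Qed.

Context d0 d1 d2 (W : measurableType d0) (X : measurableType d1)
  (Y : measurableType d2) (Pr : probability W R) (a : W -> X) (b : W -> Y)
  (ma : measurable_fun setT a) (mb : measurable_fun setT b)
  (G : set (set X)) (mG : @measurable _ X = <<s G >>) (GI : setI_closed G)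
  (GT : G setT) (k : R.-pker X ~> Y).

(** Here [a] is the past, [b] the next observation and [q] the density of its conditional law with
    respect to [k]. With the density of the chain this is the Markov property, with [q = 1] the law
    of a simulated trajectory given the estimate. *)
Lemma disintegration (q : X * Y -> R) :
  measurable_fun setT q -> (forall z, 0 <= q z) ->
  (forall E C, G E -> measurable C -> Pr (a @^-1` E `&` b @^-1` C) =
     \int[Pr]_(w in a @^-1` E) \int[k (a w)]_(y in C) (q (a w, y))%:E)%E ->
  forall F : X * Y -> \bar R, nneg_measurable F ->
  (\int[Pr]_w F (a w, b w) =
   \int[Pr]_w \int[k (a w)]_y ((q (a w, y))%:E * F (a w, y)))%E.
Proof.
move=> mq q0 H.
have mab : measurable_fun setT (fun w => (a w, b w)) by exact: measurable_fun_pair.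
pose Phi F := (\int[Pr]_w F (a w, b w))%E.
pose Psi F := (\int[Pr]_w \int[k (a w)]_y ((q (a w, y))%:E * F (a w, y)))%E.
have hPhi : monotone_functional (Phi : (X * Y -> \bar R) -> _).
  apply: (@mf_integral R _ _ _ _ Pr (fun w F => F (a w, b w))).
    by move=> F [mF _]; exact: measurableT_comp.
  by move=> w; exact: mf_eval.
have hPsi : monotone_functional (Psi : (X * Y -> \bar R) -> _).
  apply: (@mf_integral R _ _ _ _ Pr (fun w F => \int[k (a w)]_y ((q (a w, y))%:E * F (a w, y)))%E).
    move=> F hF.
    by have [h _] := nneg_measurable_comp ma (nneg_measurable_kernel k (nneg_measurable_mul mq q0 hF)).
  move=> w; apply: (@mf_integral R _ _ _ _ (k (a w)) (fun y F => (q (a w, y))%:E * F (a w, y))%E).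
    move=> F hF.
    have [h _] := nneg_measurable_mul mq q0 hF.
    exact: (measurableT_comp h).
  by move=> y; exact: (mf_mul mq q0 (mf_eval R (a w, y))).
have HR E C : G E -> measurable C -> Phi (EFin \o \1_(E `*` C)) = Psi (EFin \o \1_(E `*` C)).
  move=> GE mC.
  have mE : measurable E by rewrite mG; exact: sub_sigma_algebra.
  transitivity (Pr (a @^-1` E `&` b @^-1` C)).
    have mI : measurable (a @^-1` E `&` b @^-1` C).
      by apply: measurableI; rewrite -[X in measurable X]setTI; [exact: ma|exact: mb].
    transitivity (\int[Pr]_w (\1_(a @^-1` E `&` b @^-1` C) w)%:E)%E; last by rewrite integral_indic// setIT.
    apply: eq_integral => w _ /=; rewrite !indicE; congr (((_ : bool)%:R)%:E).
  rewrite H// integral_indicM; apply: eq_integral => w _.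
  have qC : nneg_measurable (fun y => (\1_C y)%:E * (q (a w, y))%:E)%E.
    apply: nneg_measurable_mul; first exact/measurable_indic.
      by move=> y; rewrite indicE.
    split; last by move=> y; rewrite lee_fin.
    by apply/measurable_EFinP; exact: measurableT_comp.
  rewrite integral_indicM -ge0_integralZl_EFin//; [|by move=> y _; exact: qC.2|exact: qC.1].
  apply: eq_integral => y _ /=.
  have -> : \1_(E `*` C) (a w, y) = \1_(a @^-1` E) w * \1_C y :> R.
    rewrite !indicE -natrM mulnb; congr ((_ : bool)%:R).
    apply/idP/andP => [/set_mem[/= h1 h2]|[/set_mem h1 /set_mem h2]]; last exact/mem_set.
    by split; apply/mem_set.
  by rewrite EFinM [RHS]muleC muleA.
move=> F hF; change (Phi F = Psi F).
apply: (mf_unique hPhi hPsi (measurable_prod_pi_system Y mG GT)) => //.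
- move=> _ _ [A1 GA1 [B1 mB1 <-]] [A2 GA2 [B2 mB2 <-]].
  exists (A1 `&` A2); first exact: GI.
  by exists (B1 `&` B2); [exact: measurableI|rewrite setXI].
- by rewrite /Phi /= integral_cst//= mul1e; exact: fin_num_fun_lty.
- have := HR _ _ GT measurableT; rewrite setXTT.
  by rewrite (_ : EFin \o _ = cst 1%E)//; apply/funext => z; rewrite /= indicT.
- by move=> _ [E GE [C mC <-]]; exact: HR.
Qed.

End disintegration.

Section kernel_pullback.
Context (R : realType) d1 d2 d3 (Z : measurableType d1) (X : measurableType d2)
  (Y : measurableType d3) (k : R.-pker X ~> Y) (f : Z -> X)
  (mf : measurable_fun setT f).

(** For instance, the transition kernel on states becomes a kernel on paths that looks only at the
    current coordinate, the form required by [disintegration]. *)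
Definition kpull of measurable_fun setT f :
  Z -> {measure set Y -> \bar R} := fun z => k (f z).

Let kpull_measurable U : measurable U -> measurable_fun setT (kpull mf ^~ U).
Proof. by move=> mU; exact: (measurableT_comp (measurable_kernel k U mU) mf). Qed.

HB.instance Definition _ := isKernel.Build _ _ _ _ _ (kpull mf) kpull_measurable.

Let kpull_prob z : kpull mf z setT = 1%E.
Proof. exact: prob_kernel. Qed.

HB.instance Definition _ :=
  Kernel_isProbability.Build _ _ _ _ _ (kpull mf) kpull_prob.

End kernel_pullback.

Section rectangles.
Context d (S : measurableType d).

(** The sets on which the Markov property is postulated. Equipping the path space with the
    sigma-algebra they generate encodes the past up to time [n] without changing the underlying
    set. *)
Definition rectangles n : set (set (nat -> S)) :=
  [set E | exists C : nat -> set S, (forall i, measurable (C i)) /\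
     E = [set w | forall i, (i <= n)%N -> C i (w i)]].

Lemma rectanglesI n : setI_closed (rectangles n).
Proof.
move=> _ _ [C [mC ->]] [C' [mC' ->]]; exists (fun i => C i `&` C' i).
split=> [i|]; first exact: measurableI.
apply/seteqP; split => w /=; first by move=> [h h'] i i_n; split; [exact: h|exact: h'].
by move=> h; split => i /h[].
Qed.

Lemma rectanglesT n : rectangles n setT.
Proof. by exists (fun=> setT); split=> //; apply/seteqP; split. Qed.

Lemma measurable_coord_rectangles n j : (j <= n)%N ->
  measurable_fun setT (fun w : g_sigma_algebraType (rectangles n) => w j).
Proof.
move=> jn _ B mB; rewrite setTI; apply: sub_sigma_algebra.
exists (fun i => if i == j then B else setT); split.
  by move=> i; case: ifP.
apply/seteqP; split=> w /= h; first by move=> i _; case: eqP => // ->.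
by have := h j jn; rewrite eqxx.
Qed.

Lemma measurable_coord j : measurable_fun setT (fun w : trajectory S => w j).
Proof.
by move=> _ B mB; rewrite setTI; apply: sub_sigma_algebra; exists j, B.
Qed.

Lemma measurable_rectangle n (E : set (trajectory S)) :
  rectangles n E -> measurable E.
Proof.
move=> [C [mC ->]].
rewrite (_ : [set w | _] = \bigcap_(i in `I_n.+1) ((fun w : trajectory S => w i) @^-1` C i)).
  by apply: bigcap_measurableType => i _; rewrite -[X in measurable X]setTI; exact: measurable_coord.
by apply/seteqP; split => w /= h i; have := h i; rewrite /= ltnS.
Qed.

Lemma measurable_id_rectangles n :
  measurable_fun setT (id : trajectory S -> g_sigma_algebraType (rectangles n)).
Proof.
apply: (@measurability _ _ (trajectory S) (g_sigma_algebraType (rectangles n)) setT id (rectangles n) erefl) => _ [E GE <-].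
by rewrite setTI; exact: measurable_rectangle GE.
Qed.

End rectangles.

Section path_expectation.
Context (R : realType) d (S : measurableType d) (P : R.-pker S ~> S).

Definition kop (v : S * S -> R) (f : S -> \bar R) (x : S) : \bar R :=
  (\int[P x]_y ((v (x, y))%:E * f y))%E.

(** The last weight acts first, so that the recursion follows the elimination of the last coordinate
    of a path. *)
Fixpoint kops (v : nat -> S * S -> R) n (f : S -> \bar R) : S -> \bar R :=
  if n is n'.+1 then kops v n' (kop (v n') f) else f.

Lemma nneg_measurable_kop (v : S * S -> R) f : measurable_fun setT v -> (forall z, 0 <= v z) ->
  nneg_measurable f -> nneg_measurable (kop v f).
Proof.
move=> mv v0 hf; apply: (nneg_measurable_kernel P (F := fun z => ((v z)%:E * f z.2)%E)).
apply: nneg_measurable_mul => //.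
exact: (nneg_measurable_comp measurable_snd hf).
Qed.

Variables (q : S * S -> R) (mq : measurable_fun setT q) (q0 : forall z, 0 <= q z).
Variables (x : S) (L : probability (trajectory S) R)
  (hL : markov_law (fun z B => \int[P z]_(y in B) (q (z, y))%:E)%E x L).

Lemma markov_init (f : S -> \bar R) : nneg_measurable f ->
  (\int[L]_w f (w 0%N) = f x)%E.
Proof.
move=> hf.
have h1 := @mf_integral R _ _ S _ L (fun w F => F (w 0%N)).
apply: (mf_unique (G := @measurable _ S) (h1 _ _) (mf_eval R x) _ _ _ _ _ hf).
- by move=> F [mF _]; apply: measurableT_comp => //; exact: measurable_coord.
- by move=> w; exact: mf_eval.
- by apply/esym/(@sigma_algebra_id _ setT); exact: sigma_algebra_measurable.
- by move=> ? ?; exact: measurableI.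
- by rewrite /= integral_cst//= mul1e; exact: fin_num_fun_lty.
- by rewrite /= integral_cst//= mul1e; exact: probability_setT.
- move=> E mE; have [+ _] := hL => /(_ _ mE) h.
  rewrite /= -[RHS](h) -[X in L X]setIT -integral_indic//.
  rewrite -[X in measurable X]setTI; exact: measurable_coord.
Qed.

(** The restricted sigma-algebra in the type of [F] makes it depend on the past up to time [n] only,
    apart from the new coordinate. *)
Lemma markov_step n (F : g_sigma_algebraType (@rectangles _ S n) * S -> \bar R) :
  nneg_measurable F ->
  (\int[L]_w F (w, w n.+1) =
   \int[L]_w \int[P (w n)]_y ((q (w n, y))%:E * F (w, y)))%E.
Proof.
move=> hF.
have mn := @measurable_coord_rectangles _ S n n (leqnn n).
pose a (w : trajectory S) : g_sigma_algebraType (rectangles n) := w.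
apply: (@disintegration R _ _ _ _ _ _ L a (fun w => w n.+1)
   (@measurable_id_rectangles _ S n) (@measurable_coord _ S n.+1)
   (@rectangles _ S n) erefl (@rectanglesI _ S n) (@rectanglesT _ S n)
   (kpull P mn) (fun z => q (z.1 n, z.2)) _ _ _ F hF) => //.
- apply: measurableT_comp => //; apply: measurable_fun_pair => //.
  exact: (measurableT_comp mn).
- by move=> _ B [C [mC ->]] mB; have [_ ->] := hL.
Qed.

(** Integrating out the last coordinate replaces [f] by its image under one weighted kernel and
    shortens the path by one step. *)
Lemma path_expectation (u : nat -> S * S -> R) n f :
  (forall j, measurable_fun setT (u j)) -> (forall j z, 0 <= u j z) ->
  nneg_measurable f ->
  (\int[L]_w ((\prod_(j < n) u j (w j, w j.+1))%:E * f (w n)) =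
   kops (fun j z => q z * u j z)%R n f x)%E.
Proof.
move=> mu u0; elim: n f => [|n ih] f hf /=.
  under eq_integral do rewrite big_ord0 mul1e.
  exact: markov_init.
have hk : nneg_measurable (kop (fun z => q z * u n z) f).
  apply: nneg_measurable_kop => //; first exact: measurable_funM.
  by move=> z; rewrite mulr_ge0.
rewrite -ih//.
have mprod : measurable_fun setT (fun w : g_sigma_algebraType (@rectangles _ S n) =>
    \prod_(j < n) u j (w j, w j.+1)).
  apply: measurable_prod => j _; apply: measurableT_comp => //.
  by apply: measurable_fun_pair; apply: measurable_coord_rectangles => //; exact: ltnW.
pose F (z : g_sigma_algebraType (@rectangles _ S n) * S) : \bar R :=
  ((\prod_(j < n) u j (z.1 j, z.1 j.+1))%:E * ((u n (z.1 n, z.2))%:E * f z.2))%E.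
have hF : nneg_measurable F.
  apply: nneg_measurable_mul; first exact: (measurableT_comp mprod measurable_fst).
    by move=> z; apply: prodr_ge0.
  apply: nneg_measurable_mul; last exact: (nneg_measurable_comp measurable_snd hf).
    apply: (measurableT_comp (mu n)); apply: measurable_fun_pair => //.
    exact: (measurableT_comp (@measurable_coord_rectangles _ S n n (leqnn n))).
  by move=> z.
transitivity (\int[L]_w F (w, w n.+1))%E.
  apply: eq_integral => w _; rewrite /F /= big_ord_recr /= EFinM muleA//.
rewrite markov_step//; apply: eq_integral => w _.
rewrite /kop -ge0_integralZl_EFin//.
- by apply: eq_integral => y _; rewrite /F /= EFinM !muleA; congr (_ * _)%E; rewrite -!EFinM; congr EFin; ring.
- by move=> y _; rewrite !mule_ge0// ?lee_fin// ?mulr_ge0//; case: hf.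
- apply: emeasurable_funM; last by case: hf.
  apply/measurable_EFinP; apply: (measurableT_comp (f := fun z => q z * u n z)%R).
    exact: measurable_funM.
  exact: pair1_measurable.
- by apply: prodr_ge0.
Qed.

End path_expectation.

(** * Scores along a path *)

Lemma nneseries_addn1 (R : realType) (f : nat -> \bar R) (Q : pred nat) :
  (forall i, (0 <= f i)%E) ->
  (\sum_(1 <= i <oo | Q i) f i =
   \sum_(0 <= i <oo) (if Q i.+1 then f i.+1 else 0))%E.
Proof.
move=> f0; rewrite eseries_mkcond.
have f'0 i : (0 <= if Q i then f i else 0)%E by case: ifP.
rewrite -(nneseries_addn (f := fun i => if Q i then f i else 0%E) 1)//.
by apply: eq_eseriesr => i _; rewrite addn1.
Qed.

Section path_terms.
Context (R : realType) d (S : measurableType d) (K : set S) (s : S -> S -> R).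
Implicit Types (v : S -> S -> R) (w : nat -> S).

Definition alive (x : S) : R := \1_(~` K) x.

(** Both ends must lie outside [K] for the chain to go on, whereas [reward] constrains only the
    start: the transition that enters [K] still scores. *)
Definition step v (z : S * S) : R := alive z.1 * alive z.2 * v z.1 z.2.

Definition reward v (z : S * S) : R := alive z.1 * (s z.1 z.2 * v z.1 z.2).

(** The stopping time is encoded in the factors [alive]: terms beyond [tau] vanish, so the scores
    form a series over all indices instead of a sum up to a random time. *)
Definition term v i w : R :=
  (\prod_(j < i) step v (w j, w j.+1)) * reward v (w i, w i.+1).

Lemma alive1 x : ~ K x -> alive x = 1.
Proof. by move=> nK; rewrite /alive indicE mem_set. Qed.

Lemma alive0 x : K x -> alive x = 0.
Proof. by move=> nK; rewrite /alive indicE memNset. Qed.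

Lemma alive_ge0 x : 0 <= alive x. Proof. by rewrite /alive indicE. Qed.

Lemma alive_le1 x : alive x <= 1.
Proof. by rewrite /alive indicE; case: (_ \in _). Qed.

Lemma le_tauP i w : le_tau K i w <-> forall j, (j < i)%N -> ~ K (w j).
Proof.
rewrite /le_tau /tau; case: pselect => [h|h]; last first.
  by split=> // _ j _ Kj; apply: h; exists j; exact/mem_set.
case: ex_minnP => t /set_mem Kt mint; split => [it j ji Kj|h'].
  by have := mint j (mem_set Kj); rewrite leqNgt (leq_trans ji it).
by rewrite leqNgt; apply/negP => /h'; exact.
Qed.

Lemma term_alive v i w : le_tau K i.+1 w ->
  term v i w = (\prod_(j < i) v (w j) (w j.+1)) * (s (w i) (w i.+1) * v (w i) (w i.+1)).
Proof.
move=> /le_tauP h; rewrite /term /reward /= alive1 ?mul1r; last exact: h.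
congr (_ * _); apply: eq_bigr => j _; rewrite /step /= !alive1 ?mul1r//; apply: h.
  by rewrite ltnS.
by rewrite ltnS ltnW.
Qed.

Lemma term_dead v i w : ~~ le_tau K i.+1 w -> term v i w = 0.
Proof.
move=> /negP h.
have [j ji Kj] : exists2 j, (j <= i)%N & K (w j).
  apply: contrapT => h'; apply: h; apply/le_tauP => j ji Kj.
  by apply: h'; exists j.
rewrite /term; move: ji; rewrite leq_eqVlt => /predU1P[<-|ji].
  by rewrite /reward /= alive0 // mul0r mulr0.
by rewrite (bigD1 (Ordinal ji))//= /step /= alive0// !mul0r.
Qed.

Variables (beta : S -> S -> R) (s_ge0 : forall x y, 0 <= s x y)
  (beta_gt0 : forall x y, 0 < beta x y).

Lemma YE w : Y K s beta w = (\sum_(0 <= i <oo) (term beta i w)%:E)%E.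
Proof.
rewrite /Y nneseries_addn1; last first.
  move=> i; rewrite lee_fin mulr_ge0//; apply: prodr_ge0 => j _; exact: ltW.
apply: eq_eseriesr => i _; case: ifPn => h; last by rewrite term_dead.
rewrite term_alive// /Bprod big_add1 /= big_mkord big_ord_recr /=.
by congr EFin; ring.
Qed.

Context (P : R.-pker S ~> S) (PP : S -> probability (trajectory S) R).
Variables (nu gr : S -> R).
Hypotheses (nu_ge0 : forall x, 0 <= nu x) (nu_gt0 : forall x, ~ K x -> 0 < nu x)
  (gE : forall x, ~ K x -> g P s beta PP nu x = (gr x)%:E)
  (gr_ge0 : forall x, ~ K x -> 0 <= gr x)
  (AE : A K s beta PP = ~` K).

(** The factor [beta] of the score cancels against the one in the likelihood ratio, which leaves the
    weight [g / (s + nu)] per step. *)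
Lemma YnuE w : Ynu P K s beta PP nu w =
  (\sum_(0 <= i <oo) (term (fun x y => gr x / (s x y + nu y)) i w)%:E)%E.
Proof.
rewrite /Ynu nneseries_addn1; last first.
  move=> i; rewrite mule_ge0//.
    by rewrite lee_fin mulr_ge0//; apply: prodr_ge0 => j _; exact: ltW.
  apply: prode_ge0 => j _; rewrite /l AE; case: ifPn => // /set_mem nK.
  rewrite mule_ge0//; first by rewrite gE// lee_fin gr_ge0.
  by rewrite inve_ge0 lee_fin mulr_ge0// ?addr_ge0// ltW.
apply: eq_eseriesr => i _; case: ifPn => h; last by rewrite term_dead.
have /le_tauP h' := h.
rewrite term_alive//=.
(* On the last transition [s + nu] may vanish and [l] be infinite; the score is then 0 and the term
   is 0 on both sides. *)
have [->|sn0] := eqVneq (s (w i) (w i.+1)) 0; first by rewrite !mul0r mulr0 mul0e.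
have si : 0 < s (w i) (w i.+1) by rewrite lt_def sn0 s_ge0.
(* Every earlier transition ends outside [K], where [nu] is positive; the last one now has a
   positive score. *)
have den j : (j <= i)%N -> 0 < s (w j) (w j.+1) + nu (w j.+1).
  rewrite leq_eqVlt => /predU1P[->|ji]; first by rewrite ltr_wpDr.
  by rewrite ltr_wpDl// nu_gt0//; apply: h'; rewrite ltnS.
have lE j : (j <= i)%N -> l P K s beta PP nu (w j) (w j.+1) =
    (gr (w j) / ((s (w j) (w j.+1) + nu (w j.+1)) * beta (w j) (w j.+1)))%:E.
  move=> ji; have nKj : ~ K (w j) by apply: h'; rewrite ltnS.
  rewrite /l AE ifT; last exact/mem_set.
  rewrite gE// inver gt_eqF// mulr_gt0//; exact: den.
rewrite /Lprod /Bprod !big_add1 /= !big_mkord.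
rewrite (eq_bigr (fun j : 'I_i.+1 => (gr (w j) / ((s (w j) (w j.+1) + nu (w j.+1)) * beta (w j) (w j.+1)))%:E)); last first.
  by move=> j _; rewrite lE// -ltnS.
rewrite prodEFin -EFinM; congr EFin.
rewrite -mulrA -big_split/= (eq_bigr (fun j : 'I_i.+1 => gr (w j) / (s (w j) (w j.+1) + nu (w j.+1)))); last first.
  move=> j _; have := den j; rewrite -ltnS => /(_ (ltn_ord j)) dj.
  have bj := beta_gt0 (w j) (w j.+1).
  field; rewrite !gt_eqF//.
by rewrite big_ord_recr /=; ring.
Qed.

End path_terms.

(** * Weighted transition operators *)

Section kop_theory.
Context (R : realType) d (S : measurableType d) (P : R.-pker S ~> S).
Implicit Types (v : S * S -> R) (f g : S -> \bar R).

Definition weight v := measurable_fun setT v /\ forall z, 0 <= v z.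

Lemma nneg_measurable_wM v f x : weight v -> nneg_measurable f ->
  nneg_measurable (fun y => (v (x, y))%:E * f y)%E.
Proof.
move=> [mv v0] hf; apply: nneg_measurable_mul => //.
exact: (measurableT_comp mv (@pair1_measurable _ _ _ _ x)).
Qed.

Lemma nneg_kop v f : weight v -> nneg_measurable f -> nneg_measurable (kop P v f).
Proof. by move=> [mv v0]; exact: nneg_measurable_kop. Qed.

Lemma le_kop v v' f g x : weight v -> weight v' ->
  nneg_measurable f -> nneg_measurable g ->
  (forall y, ((v (x, y))%:E * f y <= (v' (x, y))%:E * g y)%E) ->
  (kop P v f x <= kop P v' g x)%E.
Proof.
move=> wv wv' hf hg le; have [mf f0] := nneg_measurable_wM x wv hf.
have [mg g0] := nneg_measurable_wM x wv' hg.
by apply: ge0_le_integral.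
Qed.

Lemma kopD v f g x : weight v -> nneg_measurable f -> nneg_measurable g ->
  kop P v (f \+ g)%E x = (kop P v f x + kop P v g x)%E.
Proof.
move=> wv hf hg; have [mf f0] := nneg_measurable_wM x wv hf.
have [mg g0] := nneg_measurable_wM x wv hg.
rewrite /kop -ge0_integralD//; apply: eq_integral => y _ /=.
by rewrite ge0_muleDr//; [case: hf|case: hg].
Qed.

Lemma kopDl v v' f x : weight v -> weight v' -> nneg_measurable f ->
  kop P (fun z => v z + v' z) f x = (kop P v f x + kop P v' f x)%E.
Proof.
move=> wv wv' hf; have [mf f0] := nneg_measurable_wM x wv hf.
have [mg g0] := nneg_measurable_wM x wv' hf.
rewrite /kop -ge0_integralD//; apply: eq_integral => y _ /=.
by rewrite EFinD ge0_muleDl// lee_fin; [case: wv|case: wv'].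
Qed.

Lemma kopZ v f x r : 0 <= r -> weight v -> nneg_measurable f ->
  kop P v (fun y => r%:E * f y)%E x = (r%:E * kop P v f x)%E.
Proof.
move=> r0 wv hf; have [mf f0] := nneg_measurable_wM x wv hf.
rewrite /kop -ge0_integralZl_EFin//.
by apply: eq_integral => y _; rewrite muleCA.
Qed.

Lemma kop_series v (f : nat -> S -> \bar R) x : weight v ->
  (forall n, nneg_measurable (f n)) ->
  kop P v (fun y => \sum_(0 <= n <oo) f n y)%E x =
  (\sum_(0 <= n <oo) kop P v (f n) x)%E.
Proof.
move=> wv hf; rewrite /kop -integral_nneseries//; first last.
- by move=> n y _; case: (nneg_measurable_wM x wv (hf n)).
- by move=> n; case: (nneg_measurable_wM x wv (hf n)).
apply: eq_integral => y _; rewrite nneseriesZl// => i _.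
by case: (hf i).
Qed.

Lemma eq_kop v v' f g x :
  (forall y, ((v (x, y))%:E * f y = (v' (x, y))%:E * g y)%E) ->
  kop P v f x = kop P v' g x.
Proof. by move=> e; apply: eq_integral => y _; exact: e. Qed.

Lemma eq_kops (v v' : nat -> S * S -> R) n f :
  (forall j, (j < n)%N -> v j = v' j) -> kops P v n f = kops P v' n f.
Proof.
elim: n f => //= n ih f e; rewrite e// ih// => j jn; apply: e; exact: ltnW.
Qed.

Lemma kops_iter v n f : kops P (fun=> v) n f = iter n (kop P v) f.
Proof. by elim: n f => // n ih f; rewrite iterSr -ih. Qed.

Lemma nneg_iter_kop v n f : weight v -> nneg_measurable f ->
  nneg_measurable (iter n (kop P v) f).
Proof. by move=> wv hf; elim: n => //= n ih; exact: nneg_kop. Qed.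

Lemma nneg_cst (r : R) : 0 <= r -> nneg_measurable (fun _ : S => r%:E).
Proof. by move=> r0; split => // x; rewrite lee_fin. Qed.

End kop_theory.

(** * Means of the scores under a change of measure *)

Section term_expectation.
Context (R : realType) d (S : measurableType d) (P : R.-pker S ~> S)
  (K : set S) (mK : measurable K) (s beta : S -> S -> R).
Hypotheses (ms : measurable_fun setT (fun z : S * S => s z.1 z.2))
  (mbeta : measurable_fun setT (fun z : S * S => beta z.1 z.2))
  (s_ge0 : forall x y, 0 <= s x y) (beta_gt0 : forall x y, 0 < beta x y).

Lemma measurable_alive : measurable_fun setT (alive R K).
Proof. exact/measurable_indic/measurableC. Qed.

Definition pweight (v : S -> S -> R) := weight (fun z => v z.1 z.2).

Lemma measurable_term d' (T : measurableType d') i (j : T -> trajectory S)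
    (vv : T -> S -> S -> R) : measurable_fun setT j ->
  measurable_fun setT (fun z : T * (S * S) => vv z.1 z.2.1 z.2.2) ->
  measurable_fun setT (fun t => term K s (vv t) i (j t)).
Proof.
move=> mj mvv.
have mjn n : measurable_fun setT (fun t => j t n).
  exact: (measurableT_comp (@measurable_coord _ S n)).
have mjj n : measurable_fun setT (fun t => (j t n, j t n.+1)).
  exact: measurable_fun_pair.
have mv n : measurable_fun setT (fun t => vv t (j t n) (j t n.+1)).
  exact: (measurableT_comp mvv (measurable_fun_pair (@measurable_id _ _ _) (mjj n))).
have mal n : measurable_fun setT (fun t => alive R K (j t n)).
  exact: (measurableT_comp measurable_alive).
apply: measurable_funM.
  apply: measurable_prod => n _.
  exact: (measurable_funM (measurable_funM (mal n) (mal n.+1)) (mv n)).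
apply: (measurable_funM (mal i) (measurable_funM (g := fun t => vv t (j t i) (j t i.+1)) _ _)) => //.
exact: (measurableT_comp ms (mjj i)).
Qed.

Lemma weightM (v v' : S * S -> R) : weight v -> weight v' ->
  weight (fun z => v z * v' z).
Proof.
by move=> [mv v0] [mv' v0']; split=> [|z]; [exact: measurable_funM|exact: mulr_ge0].
Qed.

Lemma weight_alive1 : weight (fun z : S * S => alive R K z.1).
Proof.
by split=> [|z]; [exact: (measurableT_comp measurable_alive)|exact: alive_ge0].
Qed.

Lemma weight_alive2 : weight (fun z : S * S => alive R K z.2).
Proof.
by split=> [|z]; [exact: (measurableT_comp measurable_alive)|exact: alive_ge0].
Qed.

Lemma pweight_s : pweight s. Proof. by split=> // z; exact: s_ge0. Qed.

Lemma pweight_beta : pweight beta. Proof. by split=> // z; exact/ltW. Qed.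

Lemma weight_step v : pweight v -> weight (step K v).
Proof.
by move=> wv; apply: weightM => //; exact: (weightM weight_alive1 weight_alive2).
Qed.

Lemma weight_reward v : pweight v -> weight (reward K s v).
Proof.
move=> wv; apply: (weightM weight_alive1); exact: (weightM pweight_s wv).
Qed.

(* [cost i x] is E_x[s(X_i, X_(i+1)) B_(i+1); tau > i]. *)
Definition cost0 : S -> \bar R := kop P (reward K s beta) (fun=> 1%E).
Definition cost i : S -> \bar R := iter i (kop P (step K beta)) cost0.

Lemma nneg_cost0 : nneg_measurable cost0.
Proof. exact: nneg_kop (weight_reward pweight_beta) (nneg_cst _ ler01). Qed.

Lemma nneg_cost i : nneg_measurable (cost i).
Proof. exact: nneg_iter_kop (weight_step pweight_beta) nneg_cost0. Qed.

Variables (q : S * S -> R) (wq : weight q) (v : S -> S -> R) (wv : pweight v).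
Hypotheses (qstep : forall z, q z * step K v z = step K beta z)
  (qreward : forall z, q z * reward K s v z = reward K s beta z).
Variables (x : S) (L : probability (trajectory S) R)
  (hL : markov_law (fun z B => \int[P z]_(y in B) (q (z, y))%:E)%E x L).

Lemma term_ge0 i w : 0 <= term K s v i w.
Proof.
apply: mulr_ge0; last by case: (weight_reward wv).
by apply: prodr_ge0 => j _; case: (weight_step wv).
Qed.

Lemma nneg_term i : nneg_measurable (fun w : trajectory S => (term K s v i w)%:E).
Proof.
split; last by move=> w; rewrite lee_fin term_ge0.
apply/measurable_EFinP.
apply: (@measurable_term _ _ i id (fun=> v)) => //.
exact: (measurableT_comp wv.1 measurable_snd).
Qed.

(** The density of each step is absorbed into the weight of that step, which restores the weights of
    the original problem. Hence every single term, not merely the series, has the same mean under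
    all sampling laws; the truncation argument relies on this. *)
Lemma term_expectation i : (\int[L]_w (term K s v i w)%:E = cost i x)%E.
Proof.
pose u j := if (j < i)%N then step K v else reward K s v.
have wu j : weight (u j).
  by rewrite /u; case: ifP => _; [exact: weight_step|exact: weight_reward].
have := path_expectation wq.1 wq.2 hL i.+1 (fun j => (wu j).1) (fun j => (wu j).2)
  (nneg_cst S ler01).
rewrite /= /u ltnn.
rewrite (_ : (fun z => q z * reward K s v z) = reward K s beta); last first.
  by apply/funext => z; exact: qreward.
rewrite (@eq_kops _ _ _ _ _ (fun=> step K beta)); last first.
  by move=> j ji; apply/funext => z; rewrite ji qstep.
rewrite kops_iter -/cost0 -/(cost i x) => <-; apply: eq_integral => w _.
rewrite mule1 big_ord_recr /= ltnn /term; congr (_ * _)%:E.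
by apply: eq_bigr => j _; rewrite ltn_ord.
Qed.

Lemma series_expectation :
  (\int[L]_w \sum_(0 <= i <oo) (term K s v i w)%:E = \sum_(0 <= i <oo) cost i x)%E.
Proof.
rewrite integral_nneseries//.
- by apply: eq_eseriesr => i _; exact: term_expectation.
- by move=> i; case: (nneg_term i).
- by move=> i w _; case: (nneg_term i).
Qed.

Lemma partial_expectation N :
  (\int[L]_w (\sum_(i < N) term K s v i w)%:E = \sum_(i < N) cost i x)%E.
Proof.
under eq_integral do rewrite -sumEFin.
rewrite ge0_integral_sum//.
- by apply: eq_bigr => i _; exact: term_expectation.
- by move=> i; case: (nneg_term i).
- by move=> i w _; case: (nneg_term i).
Qed.

End term_expectation.

(** * The value function as a series and as a fixed point *)

Section value_function.
Context (R : realType) d (S : measurableType d) (P : R.-pker S ~> S)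
  (K : set S) (mK : measurable K) (s beta : S -> S -> R).
Hypotheses (ms : measurable_fun setT (fun z : S * S => s z.1 z.2))
  (mbeta : measurable_fun setT (fun z : S * S => beta z.1 z.2))
  (s_ge0 : forall x y, 0 <= s x y) (beta_gt0 : forall x y, 0 < beta x y).
Variables (PP : S -> probability (trajectory S) R)
  (PP_law : forall x, markov_law (fun x B => P x B) x (PP x)).

Notation mu := (mu K s beta PP).
Notation cost := (cost P K s beta).
Notation cost0 := (cost0 P K s beta).
Notation T := (kop P (step K beta)).

Lemma weight_one : @weight R _ S (fun=> 1).
Proof. by []. Qed.

Lemma PP_density x :
  markov_law (fun z B => \int[P z]_(y in B) ((fun=> 1 : R) (z, y))%:E)%E x (PP x).
Proof.
have [h0 h1] := PP_law x; split=> // n C B mC mB.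
rewrite h1//; apply: eq_integral => w _.
by rewrite /= integral_cst// mul1e.
Qed.

Lemma mu_series x : (mu x = \sum_(0 <= i <oo) cost i x)%E.
Proof.
rewrite /mu; under eq_integral do rewrite (YE _ s_ge0 beta_gt0).
exact: (series_expectation mK ms s_ge0 weight_one
  (pweight_beta mbeta beta_gt0) (fun z => mul1r _) (fun z => mul1r _) (@PP_density x)).
Qed.

Lemma nneg_mu : nneg_measurable mu.
Proof.
have h i := nneg_cost P mK ms mbeta s_ge0 beta_gt0 i.
rewrite (_ : mu = fun x => \sum_(0 <= i <oo) cost i x)%E; last first.
  by apply/funext => x; exact: mu_series.
split=> [|x]; last by apply: nneseries_ge0 => i _ _; case: (h i).
by apply: ge0_emeasurable_sum => i; case: (h i).
Qed.

Lemma kop_dead (v : S * S -> R) f x : (forall y, v (x, y) = 0) -> kop P v f x = 0%E.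
Proof. by move=> v0; apply: integral0_eq => y _; rewrite v0 mul0e. Qed.

Lemma cost_dead i x : K x -> cost i x = 0%E.
Proof.
move=> Kx; case: i => [|i]; apply: kop_dead => y.
  by rewrite /reward /= alive0// mul0r.
by rewrite /step /= alive0// !mul0r.
Qed.

Lemma mu_dead x : K x -> mu x = 0%E.
Proof. by move=> Kx; rewrite mu_series eseries0// => i _ _; exact: cost_dead. Qed.

(** Without its first term, the series is the image of the whole series under one killed step. *)
Lemma mu_eq x : (mu x = cost0 x + T mu x)%E.
Proof.
have h i := nneg_cost P mK ms mbeta s_ge0 beta_gt0 i.
have wT := weight_step mK (pweight_beta mbeta beta_gt0).
rewrite [in LHS]mu_series nneseries_recl//; last by move=> i; case: (h i).
congr (_ + _)%E.
rewrite (_ : mu = fun x => \sum_(0 <= i <oo) cost i x)%E; last first.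
  by apply/funext => y; exact: mu_series.
rewrite kop_series// -(nneseries_addn (f := fun i => cost i x) 1); last first.
  by move=> i; case: (h i).
by apply: eq_eseriesr => i _; rewrite addn1.
Qed.

Hypothesis Y_nontrivial : forall x,
    PP x [set w | (0 < Y K s beta w)%E] = 0%E -> K x.

(** A nonnegative [Y] with zero mean vanishes almost surely, and then the standing hypothesis puts
    the starting point in [K]. *)
Lemma A_alive : A K s beta PP = ~` K.
Proof.
apply/seteqP; split=> x /=; first by rewrite /A /= => mux /mu_dead mu0; rewrite mu0 ltxx in mux.
move=> nK; rewrite /A /= lt0e; apply/andP; split; last by case: nneg_mu.
apply/eqP => mu0; apply: nK; apply: Y_nontrivial.
have wb := pweight_beta mbeta beta_gt0.
have nY : nneg_measurable (Y K s beta : trajectory S -> \bar R).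
  rewrite (_ : Y K s beta = fun w => \sum_(0 <= i <oo) (term K s beta i w)%:E)%E; last first.
    by apply/funext => w; exact: YE.
  have ht i := nneg_term mK ms s_ge0 wb i.
  split=> [|w]; last by apply: nneseries_ge0 => i _ _; case: (ht i).
  by apply: ge0_emeasurable_sum => i; case: (ht i).
have : (\int[PP x]_w `|Y K s beta w| = 0)%E.
  rewrite -[RHS]mu0; apply: eq_integral => w _; rewrite gee0_abs//.
  by case: nY.
move/(ae_eq_integral_abs _ measurableT nY.1).1 => ae0.
have mY : measurable [set w | (0 < Y K s beta (w : trajectory S))%E].
  by have := emeasurable_fun_o_infty measurableT nY.1 0%E; rewrite setTI.
apply: measure_negligible => //; apply: negligibleS ae0 => w /= Yw Y0.
by move: Yw; rewrite Y0// ltxx.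
Qed.

Variable nu : S -> R.
Hypothesis nu_dead : forall x, K x -> nu x = 0.

Lemma hE x : ~ K x -> h s beta PP x = cost0 x.
Proof.
move=> nK; pose u (j : nat) (z : S * S) := beta x z.2 * s x z.2.
have mu_ j : measurable_fun setT (u j).
  apply: measurable_funM.
    exact: (measurableT_comp (measurableT_comp mbeta (@pair1_measurable _ _ _ _ x)) measurable_snd).
  exact: (measurableT_comp (measurableT_comp ms (@pair1_measurable _ _ _ _ x)) measurable_snd).
have u0 j z : 0 <= u j z by rewrite mulr_ge0// ltW.
have := path_expectation weight_one.1 weight_one.2 (@PP_density x) 1 mu_ u0 (nneg_cst S ler01).
rewrite /= => H.
rewrite /h -[RHS](_ : kop P (fun z => 1 * u 0%N z) (fun=> 1%E) x = _).
  rewrite -H; apply: eq_integral => w _.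
  by rewrite mule1 big_ord_recr big_ord0 /= mul1r.
apply: eq_kop => y; rewrite !mule1 /reward /= alive1// !mul1r; congr EFin.
by rewrite /u mulrC.
Qed.

(** [step] kills transitions into [K] while [Pbeta] keeps them; this makes no difference because
    [nu] is zero there. *)
Lemma PbetaE x : ~ K x -> Pbeta P beta nu x = T (EFin \o nu) x.
Proof.
move=> nK; apply: eq_integral => y _; rewrite -EFinM; congr EFin.
rewrite /step /= alive1// mul1r; have [Ky|nKy] := pselect (K y).
  by rewrite nu_dead// mul0r mulr0.
by rewrite alive1// mul1r mulrC.
Qed.

Lemma gE x : ~ K x -> (g P s beta PP nu x = cost0 x + T (EFin \o nu) x)%E.
Proof. by move=> nK; rewrite /g hE// PbetaE. Qed.

End value_function.

(** * Importance sampling *)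

Section importance_density.
Context (R : realType) d (S : measurableType d) (P : R.-pker S ~> S)
  (K : set S) (mK : measurable K) (s beta : S -> S -> R).
Hypotheses (ms : measurable_fun setT (fun z : S * S => s z.1 z.2))
  (mbeta : measurable_fun setT (fun z : S * S => beta z.1 z.2))
  (s_ge0 : forall x y, 0 <= s x y) (beta_gt0 : forall x y, 0 < beta x y).

Notation cost := (cost P K s beta).
Notation cost0 := (cost0 P K s beta).
Notation T := (kop P (step K beta)).

Definition gR (nu : S -> R) x : R := fine (cost0 x) + fine (T (EFin \o nu) x).

(** The product of [beta] and the likelihood ratio. *)
Definition isw nu x y : R := gR nu x / (s x y + nu y).

(** The density of [Q_nu] with respect to [P], extended by 1 on [K], where the two kernels
    coincide. *)
Definition dens nu (z : S * S) : R :=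
  (1 - alive R K z.1) +
  alive R K z.1 * ((s z.1 z.2 + nu z.2) * beta z.1 z.2 / gR nu z.1).

Variables (sM bM : R) (sM0 : 0 <= sM) (bM0 : 0 <= bM).
Hypotheses (s_le : forall x y, ~ K x -> s x y <= sM)
  (beta_le : forall x y, ~ K x -> beta x y <= bM).

Let wstep := weight_step mK (pweight_beta mbeta beta_gt0).
Let wrew := weight_reward mK ms s_ge0 (pweight_beta mbeta beta_gt0).

Lemma step_le x y : step K beta (x, y) <= bM.
Proof.
rewrite /step /=; have [Kx|nK] := pselect (K x); first by rewrite alive0// !mul0r.
rewrite alive1// mul1r; apply: le_trans (beta_le y nK).
by rewrite ger_pMl// alive_le1.
Qed.

Lemma reward_le x y : reward K s beta (x, y) <= sM * bM.
Proof.
rewrite /reward /=; have [Kx|nK] := pselect (K x).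
  by rewrite alive0// !mul0r mulr_ge0.
rewrite alive1// mul1r; apply: ler_pM => //; [exact: ltW|exact: s_le|exact: beta_le].
Qed.

Lemma kop_le_cst (v : S * S -> R) f x (r : R) : weight v -> nneg_measurable f ->
  (forall y, (v (x, y))%:E * f y <= r%:E)%E -> (kop P v f x <= r%:E)%E.
Proof.
move=> wv hf h; have [mf f0] := nneg_measurable_wM x wv hf.
rewrite -[leRHS]mule1 -[X in (_ * X)%E](@prob_kernel _ _ _ _ _ P x) -integral_cst//.
apply: ge0_le_integral => //.
Qed.

Lemma cost0_fin x : cost0 x = (fine (cost0 x))%:E.
Proof.
rewrite fineK// ge0_fin_numE; last by case: (nneg_cost0 P mK ms mbeta s_ge0 beta_gt0).
apply: (le_lt_trans _ (ltry (sM * bM))); apply: kop_le_cst => //.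
by move=> y; rewrite mule1 lee_fin reward_le.
Qed.

Lemma fine_cost0_ge0 x : 0 <= fine (cost0 x).
Proof. by apply: fine_ge0; case: (nneg_cost0 P mK ms mbeta s_ge0 beta_gt0). Qed.

Lemma fine_cost0_le x : fine (cost0 x) <= sM * bM.
Proof.
rewrite -lee_fin -cost0_fin; apply: kop_le_cst => //.
by move=> y; rewrite mule1 lee_fin reward_le.
Qed.

Definition bounded_weight (nu : S -> R) N :=
  [/\ measurable_fun setT nu, forall x, 0 <= nu x, forall x, K x -> nu x = 0 &
      forall x, nu x <= N].

Lemma nneg_bounded nu N : bounded_weight nu N -> nneg_measurable (EFin \o nu).
Proof.
by move=> [mnu n0 _ _]; split=> [|x]; [exact/measurable_EFinP|rewrite lee_fin].
Qed.

Lemma T_le nu N x : bounded_weight nu N -> (T (EFin \o nu) x <= (bM * N)%:E)%E.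
Proof.
move=> bnu; have hnu := nneg_bounded bnu.
apply: kop_le_cst => // y; rewrite -EFinM lee_fin.
case: bnu => _ n0 _ nN.
by apply: ler_pM => //; [exact: wstep.2|exact: step_le].
Qed.

Lemma T_fin nu N x : bounded_weight nu N -> T (EFin \o nu) x = (fine (T (EFin \o nu) x))%:E.
Proof.
move=> bnu; rewrite fineK// ge0_fin_numE.
  exact: le_lt_trans (T_le x bnu) (ltry _).
by case: (nneg_kop P wstep (nneg_bounded bnu)).
Qed.

Lemma gR_ge0 nu N x : bounded_weight nu N -> 0 <= gR nu x.
Proof.
move=> bnu; apply: addr_ge0; first exact: fine_cost0_ge0.
by apply: fine_ge0; case: (nneg_kop P wstep (nneg_bounded bnu)).
Qed.

Lemma gR_le nu N x : bounded_weight nu N -> gR nu x <= bM * (sM + N).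
Proof.
move=> bnu; rewrite mulrDr lerD//; first by rewrite mulrC fine_cost0_le.
by rewrite -lee_fin -(T_fin x bnu) T_le.
Qed.

Lemma gREFin nu N x : bounded_weight nu N ->
  (gR nu x)%:E = (cost0 x + T (EFin \o nu) x)%E.
Proof. by move=> bnu; rewrite /gR EFinD -cost0_fin -(T_fin x bnu). Qed.

(** The killed kernel is monotone and has mass at most [bM]. As the target satisfies [m = gR m],
    this later compares [gR nu] with [m]. *)
Lemma gR_lip nu nu' N V x : bounded_weight nu N -> bounded_weight nu' N ->
  0 <= V -> (forall y, nu y <= nu' y + V) -> gR nu x <= gR nu' x + bM * V.
Proof.
move=> bnu bnu' V0 le; rewrite /gR -addrA lerD2l -lee_fin EFinD.
rewrite -(T_fin x bnu) -(T_fin x bnu').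
have hV := nneg_cst S V0.
have hnu := nneg_bounded bnu; have hnu' := nneg_bounded bnu'.
apply: (@le_trans _ _ (kop P (step K beta) ((EFin \o nu') \+ (fun=> V%:E))%E x)).
  apply: le_kop => //.
    split; first by apply: emeasurable_funD => //; case: hnu'.
    by move=> y; apply: adde_ge0; [exact: hnu'.2|exact: hV.2].
  by move=> y; rewrite -!EFinM lee_fin ler_wpM2l//=; exact: wstep.2.
rewrite kopD// leeD2l//; apply: kop_le_cst => // y.
by rewrite -EFinM lee_fin ler_wpM2r// step_le.
Qed.

(* if g vanished at x, no transition from x could produce a positive score *)
Lemma gR_gt0 nu N (m : S -> R) M x : bounded_weight nu N ->
  (forall y, ~ K y -> 0 < nu y) ->
  bounded_weight m M -> 0 < m x -> m x = gR m x -> 0 < gR nu x.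
Proof.
move=> bnu nu_gt0 bm mx0 mE; rewrite lt_def (gR_ge0 x bnu) andbT.
apply/eqP => g0.
have c0 : fine (cost0 x) = 0 /\ fine (T (EFin \o nu) x) = 0.
  have T0 : 0 <= fine (T (EFin \o nu) x).
    by apply: fine_ge0; case: (nneg_kop P wstep (nneg_bounded bnu)).
  move/eqP: g0; rewrite /gR paddr_eq0 ?fine_cost0_ge0//.
  by move=> /andP[/eqP ? /eqP].
have Tnu0 : T (EFin \o nu) x = 0%E by rewrite (T_fin x bnu) c0.2.
have wnu := nneg_measurable_wM x wstep (nneg_bounded bnu).
have wm := nneg_measurable_wM x wstep (nneg_bounded bm).
suff Tm0 : T (EFin \o m) x = 0%E.
  by move: mx0; rewrite mE /gR c0.1 Tm0 addr0 ltxx.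
(* Since [nu] is positive off [K], the vanishing of [T nu] means that the weight of a transition
   that stays off [K] is almost surely 0; hence [T m] vanishes too. *)
have ae0 : ae_eq (P x) setT
    (fun y => (step K beta (x, y))%:E * (EFin \o nu) y)%E (cst 0%E).
  apply: (ae_eq_integral_abs _ measurableT wnu.1).1; rewrite -[RHS]Tnu0.
  by apply: eq_integral => y _; rewrite gee0_abs// wnu.2.
rewrite /kop -[RHS](@integral0 _ _ _ (P x) setT).
apply: ge0_ae_eq_integral => //; [exact: wm.1|by move=> y _; exact: wm.2|].
case: ae0 => B [mB B0 hB]; exists B; split=> //; apply: subset_trans hB => y /=.
apply: contra_not => h _; have := h I; rewrite /= -!EFinM => -[].
have [Ky|nK] := pselect (K y); first by case: bm => _ _ bm0 _ _; rewrite bm0// mulr0.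
move/eqP; rewrite mulf_eq0 (gt_eqF (nu_gt0 _ nK)) orbF => /eqP ->.
by rewrite mul0r.
Qed.

Lemma measurable_inv_nneg d' (X : measurableType d') (f : X -> R) :
  measurable_fun setT f -> (forall x, 0 <= f x) ->
  measurable_fun setT (fun x => (f x)^-1).
Proof.
move=> mf f0; rewrite (_ : (fun x => _) = (fun x => f x `^ (-1))).
  exact: (measurableT_comp (@measurable_powR R (-1)) mf).
by apply/funext => x; rewrite powR_inv1.
Qed.

(** The estimate is random, so measurability is needed jointly in the parameter that indexes it and
    in the state. *)
Lemma measurable_gR d' (X : measurableType d') (nu : X -> S -> R) :
  measurable_fun setT (fun z : X * S => nu z.1 z.2) -> (forall t x, 0 <= nu t x) ->
  measurable_fun setT (fun z : X * S => gR (nu z.1) z.2).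
Proof.
move=> mnu nu0; apply: measurable_funD.
  apply: measurableT_comp => //.
  have [h _] := nneg_cost0 P mK ms mbeta s_ge0 beta_gt0.
  exact: (measurableT_comp h measurable_snd).
apply: measurableT_comp => //.
pose F (z : (X * S) * S) := ((step K beta (z.1.2, z.2))%:E * (nu z.1.1 z.2)%:E)%E.
have hF : nneg_measurable F.
  have m12 : measurable_fun setT (fun z : (X * S) * S => (z.1.2, z.2)).
    apply: measurable_fun_pair => //.
    exact: (measurableT_comp measurable_snd).
  apply: nneg_measurable_mul; first exact: (measurableT_comp wstep.1 m12).
    by move=> z; exact: wstep.2.
  split; last by move=> z; rewrite lee_fin.
  apply/measurable_EFinP; apply: (measurableT_comp mnu (measurable_fun_pair (f := fun z : (X * S) * S => z.1.1) _ _)) => //.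
  exact: (measurableT_comp measurable_fst).
by have [+ _] := nneg_measurable_kernel (kpull P (@measurable_snd _ _ X S)) hF.
Qed.

Lemma measurable_isw d' (X : measurableType d') (nu : X -> S -> R) :
  measurable_fun setT (fun z : X * S => nu z.1 z.2) -> (forall t x, 0 <= nu t x) ->
  measurable_fun setT (fun z : X * (S * S) => isw (nu z.1) z.2.1 z.2.2).
Proof.
move=> mnu nu0; apply: measurable_funM.
  have m1 : measurable_fun setT (fun z : X * (S * S) => (z.1, z.2.1)).
    apply: measurable_fun_pair => //; exact: (measurableT_comp measurable_fst).
  exact: (measurableT_comp (measurable_gR mnu nu0) m1).
apply: measurable_inv_nneg; last by move=> z; rewrite addr_ge0.
have m2 : measurable_fun setT (fun z : X * (S * S) => (z.1, z.2.2)).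
  apply: measurable_fun_pair => //; exact: (measurableT_comp measurable_snd).
apply: measurable_funD; first exact: (measurableT_comp ms measurable_snd).
exact: (measurableT_comp mnu m2).
Qed.

Lemma measurable_dens d' (X : measurableType d') (nu : X -> S -> R) :
  measurable_fun setT (fun z : X * S => nu z.1 z.2) -> (forall t x, 0 <= nu t x) ->
  measurable_fun setT (fun z : X * (S * S) => dens (nu z.1) z.2).
Proof.
move=> mnu nu0.
have m1 : measurable_fun setT (fun z : X * (S * S) => (z.1, z.2.1)).
  apply: measurable_fun_pair => //; exact: (measurableT_comp measurable_fst).
have m2 : measurable_fun setT (fun z : X * (S * S) => (z.1, z.2.2)).
  apply: measurable_fun_pair => //; exact: (measurableT_comp measurable_snd).
have mal : measurable_fun setT (fun z : X * (S * S) => alive R K z.2.1).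
  exact: (measurableT_comp (weight_alive1 R mK).1 measurable_snd).
apply: measurable_funD; first exact: measurable_funB.
apply: (measurable_funM mal); apply: measurable_funM.
  apply: measurable_funM; last exact: (measurableT_comp mbeta measurable_snd).
  apply: measurable_funD; first exact: (measurableT_comp ms measurable_snd).
  exact: (measurableT_comp mnu m2).
apply: measurable_inv_nneg; last first.
  move=> z; apply: addr_ge0; first exact: fine_cost0_ge0.
  apply: fine_ge0; apply: integral_ge0 => y _.
  by rewrite mule_ge0 ?lee_fin//; exact: wstep.2.
exact: (measurableT_comp (measurable_gR mnu nu0) m1).
Qed.

End importance_density.

Section importance_sampling.
Context (R : realType) d (S : measurableType d) (P : R.-pker S ~> S)
  (K : set S) (mK : measurable K) (s beta : S -> S -> R).
Hypotheses (ms : measurable_fun setT (fun z : S * S => s z.1 z.2))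
  (mbeta : measurable_fun setT (fun z : S * S => beta z.1 z.2))
  (s_ge0 : forall x y, 0 <= s x y) (beta_gt0 : forall x y, 0 < beta x y).
Variables (PP : S -> probability (trajectory S) R)
  (PP_law : forall x, markov_law (fun x B => P x B) x (PP x)).
Variables (sM bM : R) (sM0 : 0 <= sM) (bM0 : 0 <= bM).
Hypotheses (s_le : forall x y, ~ K x -> s x y <= sM)
  (beta_le : forall x y, ~ K x -> beta x y <= bM).
Variables (m : S -> R) (M : R) (bm : bounded_weight K m M)
  (muE : forall x, mu K s beta PP x = (m x)%:E)
  (AE : A K s beta PP = ~` K).

Notation cost := (cost P K s beta).
Notation cost0 := (cost0 P K s beta).
Notation T := (kop P (step K beta)).
Notation gR := (gR P K s beta).
Notation isw := (isw P K s beta).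
Notation dens := (dens P K s beta).

(** With [nu = m] the normalising function is [m] itself; this identity is what makes importance
    sampling at the exact target free of error. *)
Lemma value_gR x : m x = gR m x.
Proof.
apply: EFin_inj.
rewrite (gREFin P mK ms mbeta s_ge0 beta_gt0 sM0 bM0 s_le beta_le x bm) -muE.
rewrite (mu_eq mK ms mbeta s_ge0 beta_gt0 PP_law); congr (_ + T _ x)%E.
by apply/funext => y; rewrite /= muE.
Qed.

Lemma value_gt0 x : ~ K x -> 0 < m x.
Proof.
move=> nK; have : (~` K) x by []. 
by rewrite -AE /A /= muE lte_fin.
Qed.

Variables (nu : S -> R) (N : R) (bnu : bounded_weight K nu N)
  (nu_gt0 : forall x, ~ K x -> 0 < nu x).

Let nu_ge0 x : 0 <= nu x. Proof. by case: bnu. Qed.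
Let nu_dead x : K x -> nu x = 0. Proof. by case: bnu => _ _ h _; exact: h. Qed.

Lemma gR_gt0' x : ~ K x -> 0 < gR nu x.
Proof.
move=> nK; exact: (gR_gt0 mK ms mbeta s_ge0 beta_gt0 bM0 beta_le bnu
  nu_gt0 bm (value_gt0 nK) (value_gR x)).
Qed.

Lemma g_gR x : ~ K x -> g P s beta PP nu x = (gR nu x)%:E.
Proof.
move=> nK; rewrite (gE ms mbeta s_ge0 beta_gt0 PP_law nu_dead nK).
by rewrite (gREFin P mK ms mbeta s_ge0 beta_gt0 sM0 bM0 s_le beta_le x bnu).
Qed.

Lemma weight_dens : weight (dens nu).
Proof.
have mnu : measurable_fun setT (fun z : S * S => nu z.2).
  by apply: measurableT_comp => //; case: bnu.
split.
  exact: (measurableT_comp (measurable_dens P mK ms mbeta s_ge0 beta_gt0 mnu (fun=> nu_ge0))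
    (measurable_fun_pair (@measurable_fst _ _ S S) (@measurable_id _ _ _))).
move=> [x y]; rewrite /dens /=; have [Kx|nK] := pselect (K x).
  by rewrite alive0// mul0r subr0 addr0.
rewrite alive1// subrr add0r mul1r; apply: divr_ge0; last exact/ltW/gR_gt0'.
by apply: mulr_ge0; [apply: addr_ge0|exact: ltW].
Qed.

Lemma pweight_isw : pweight (isw nu).
Proof.
have mnu : measurable_fun setT (fun z : S * S => nu z.2).
  by apply: measurableT_comp => //; case: bnu.
split.
  exact: (measurableT_comp (measurable_isw P mK ms mbeta s_ge0 beta_gt0 mnu (fun=> nu_ge0))
    (measurable_fun_pair (@measurable_fst _ _ S S) (@measurable_id _ _ _))).
move=> [x y]; rewrite /isw /=; apply: divr_ge0; last exact: addr_ge0.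
exact: (gR_ge0 P mK ms mbeta s_ge0 beta_gt0 x bnu).
Qed.

Lemma den_gt0 x y : ~ K y -> 0 < s x y + nu y.
Proof. by move=> nK; rewrite ltr_wpDl// nu_gt0. Qed.

Lemma dens_alive x y : ~ K x ->
  dens nu (x, y) = (s x y + nu y) * beta x y / gR nu x.
Proof. by move=> nK; rewrite /dens /= alive1// subrr add0r mul1r. Qed.

Lemma dens_dead x y : K x -> dens nu (x, y) = 1.
Proof. by move=> Kx; rewrite /dens /= alive0// mul0r subr0 addr0. Qed.

Lemma dens_step z : dens nu z * step K (isw nu) z = step K beta z.
Proof.
case: z => x y; rewrite /step /=; have [Kx|nKx] := pselect (K x).
  by rewrite alive0// !mul0r mulr0.
have [Ky|nKy] := pselect (K y).
  by rewrite (alive0 R Ky) mulr0 !mul0r mulr0.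
rewrite dens_alive// !alive1// !mul1r /isw.
have h1 := gR_gt0' nKx; have h2 := den_gt0 x nKy.
by field; rewrite !gt_eqF.
Qed.

Lemma dens_reward z : dens nu z * reward K s (isw nu) z = reward K s beta z.
Proof.
case: z => x y; rewrite /reward /=; have [Kx|nKx] := pselect (K x).
  by rewrite alive0// !mul0r mulr0.
rewrite dens_alive// !alive1// !mul1r /isw.
have [->|sn0] := eqVneq (s x y) 0; first by rewrite !mul0r mulr0.
have h1 := gR_gt0' nKx; have h2 : 0 < s x y + nu y.
  by rewrite ltr_wpDr// lt_def sn0 s_ge0.
by field; rewrite !gt_eqF.
Qed.

Lemma Q_dens x B : measurable B ->
  (Q P K s beta PP nu x B = \int[P x]_(y in B) (dens nu (x, y))%:E)%E.
Proof.
move=> mB; rewrite /Q AE; case: ifPn => [/set_mem nK|/negP nA].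
  apply: eq_integral => y _; rewrite dens_alive// g_gR//.
  by rewrite inver gt_eqF ?gR_gt0'.
have Kx : K x by apply: contrapT => nK; apply: nA; exact/mem_set.
under [RHS]eq_integral do rewrite dens_dead//.
by rewrite integral_cst// mul1e.
Qed.

Variables (x : S) (L : probability (trajectory S) R)
  (hL : markov_law (Q P K s beta PP nu) x L).

Lemma law_dens :
  markov_law (fun z B => \int[P z]_(y in B) (dens nu (z, y))%:E)%E x L.
Proof.
case: hL => h0 h1; split=> // n C B mC mB; rewrite h1//.
by apply: eq_integral => w _; rewrite Q_dens.
Qed.

Lemma Ynu_terms w : Ynu P K s beta PP nu w =
  (\sum_(0 <= i <oo) (term K s (isw nu) i w)%:E)%E.
Proof.
rewrite (@YnuE R d S K s beta s_ge0 beta_gt0 P PP nu (gR nu) nu_ge0 nu_gt0 g_gR)//.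
by move=> y nK; exact/ltW/gR_gt0'.
Qed.

Lemma nneg_Ynu : nneg_measurable (Ynu P K s beta PP nu : trajectory S -> \bar R).
Proof.
have ht i := nneg_term mK ms s_ge0 pweight_isw i.
split=> [|w]; last by rewrite Ynu_terms; apply: nneseries_ge0 => i _ _; case: (ht i).
rewrite (_ : Ynu P K s beta PP nu = fun w => \sum_(0 <= i <oo) (term K s (isw nu) i w)%:E)%E.
  by apply: ge0_emeasurable_sum => i; case: (ht i).
by apply/funext => w; exact: Ynu_terms.
Qed.

Lemma Ynu_mean : (\int[L]_w Ynu P K s beta PP nu w = (m x)%:E)%E.
Proof.
under eq_integral do rewrite Ynu_terms.
rewrite (series_expectation mK ms s_ge0 weight_dens pweight_isw dens_step dens_reward law_dens).
by rewrite -muE (mu_series mK ms mbeta s_ge0 beta_gt0 PP_law).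
Qed.

Lemma partial_mean n :
  (\int[L]_w (\sum_(i < n) term K s (isw nu) i w)%:E = \sum_(i < n) cost i x)%E.
Proof.
exact: (partial_expectation mK ms s_ge0 weight_dens pweight_isw dens_step dens_reward law_dens).
Qed.

End importance_sampling.

(** * Geometric tails and second moments *)

Section kop_sums.
Context (R : realType) d (S : measurableType d) (P : R.-pker S ~> S).

Lemma monotone_kop (v : S * S -> R) x : weight v ->
  monotone_functional (fun f => kop P v f x).
Proof.
move=> wv; apply: (@mf_integral R _ _ _ _ (P x) (fun y f => (v (x, y))%:E * f y)%E).
  by move=> f hf; case: (nneg_measurable_wM x wv hf).
move=> y; apply: (@mf_mul R _ S (fun=> v (x, y)) (fun f => f y)) => //.
  by move=> _; exact: wv.2.
exact: mf_eval.
Qed.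

Lemma kop_sum (v : S * S -> R) x n (f : nat -> S -> \bar R) : weight v ->
  (forall i, nneg_measurable (f i)) ->
  kop P v (fun y => \sum_(i < n) f i y)%E x = (\sum_(i < n) kop P v (f i) x)%E.
Proof. by move=> wv hf; exact: (mf_sum _ (monotone_kop x wv)). Qed.

Lemma nneg_sum n (f : nat -> S -> \bar R) :
  (forall i, nneg_measurable (f i)) -> nneg_measurable (fun y => \sum_(i < n) f i y)%E.
Proof.
move=> hf; split; first by apply: emeasurable_sum => i; case: (hf i).
by move=> y; apply: sume_ge0 => i _; case: (hf i).
Qed.

End kop_sums.

(** * Killing at K and the last score *)

Section killing.
Context (R : realType) d (S : measurableType d) (P : R.-pker S ~> S)
  (K : set S) (mK : measurable K) (s : S -> S -> R).
Hypotheses (ms : measurable_fun setT (fun z : S * S => s z.1 z.2))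
  (s_ge0 : forall x y, 0 <= s x y) (s_stop : forall x y, K x -> s x y = 0).
Variables (PP : S -> probability (trajectory S) R)
  (PP_law : forall x, markov_law (fun x B => P x B) x (PP x)).

Definition stay (z : S * S) : R := alive R K z.1 * alive R K z.2.
Definition leave (z : S * S) : R := alive R K z.1 * (1 - alive R K z.2).
(** A product of [stay] factors followed by [last_gain] is the last score on the event that [tau]
    has the corresponding value, and 0 elsewhere. *)
Definition last_gain (z : S * S) : R := leave z * s z.1 z.2.

Lemma weight_stay : weight stay.
Proof. exact: weightM (weight_alive1 R mK) (weight_alive2 R mK). Qed.

Lemma weight_leave : weight leave.
Proof.
apply: weightM; first exact: weight_alive1.
split; first by apply: measurable_funB => //; exact: (weight_alive2 R mK).1.
by move=> z; rewrite subr_ge0 alive_le1.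
Qed.

Lemma weight_last_gain : weight last_gain.
Proof. exact: weightM weight_leave (pweight_s ms s_ge0). Qed.

Lemma tau_SomeP (w : nat -> S) t : tau K w = Some t <->
  (forall j, (j < t)%N -> ~ K (w j)) /\ K (w t).
Proof.
rewrite /tau; case: pselect => [h|h]; last first.
  by split=> // -[_ Kt]; exfalso; apply: h; exists t; exact/mem_set.
case: ex_minnP => u /set_mem Ku minu; split.
  by move=> [<-]; split=> // j ju Kj; have := minu j (mem_set Kj); rewrite leqNgt ju.
move=> [h1 Kt]; congr Some; apply/eqP; rewrite eqn_leq minu ?mem_set//=.
by rewrite leqNgt; apply/negP => /h1; exact.
Qed.

Lemma stay_path t (w : nat -> S) : (forall j, (j <= t)%N -> ~ K (w j)) ->
  \prod_(j < t) stay (w j, w j.+1) = 1.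
Proof.
move=> h; apply: big1 => j _; rewrite /stay /= !alive1 ?mulr1//; apply: h => //.
exact: ltnW.
Qed.

Lemma stay_path_dead t (w : nat -> S) j : (j <= t)%N -> K (w j) ->
  (\prod_(j < t) stay (w j, w j.+1)) * alive R K (w t) = 0.
Proof.
rewrite leq_eqVlt => /predU1P[-> Kj|jt Kj]; first by rewrite alive0// mulr0.
by rewrite (bigD1 (Ordinal jt))//= /stay /= (alive0 R Kj) !mul0r.
Qed.

Lemma gain_path t (w : nat -> S) :
  (\prod_(j < t) stay (w j, w j.+1)) * last_gain (w t, w t.+1) =
  if tau K w == Some t.+1 then s (w t) (w t.+1) else 0.
Proof.
case: ifPn => [/eqP/tau_SomeP[h1 h2]|/eqP h].
  rewrite stay_path ?mul1r; last by move=> j jt; exact: h1.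
  by rewrite /last_gain /leave /= alive1 ?alive0 ?subr0 ?mul1r//; exact: h1.
have [[j jt Kj]|h'] := pselect (exists2 j, (j <= t)%N & K (w j)).
  by rewrite /last_gain /leave /= !mulrA (stay_path_dead jt Kj) !mul0r.
rewrite /last_gain /leave /= (@alive1 R _ _ K (w t.+1)) ?subrr ?mulr0 ?mul0r ?mulr0//.
move=> Kt; apply: h; apply/tau_SomeP; split=> // j jt Kj; apply: h'.
by exists j.
Qed.

(** The event of hitting [K] within [n] steps is split according to the value of [tau]; a path that
    starts in [K] contributes nothing because [s] vanishes there. *)
Lemma last_score_expectation n x :
  (\int[PP x]_(w in [set w | exists2 t, tau K w = Some t & (t <= n)%N])
      (last_score K s w)%:E =
   \sum_(t < n) iter t (kop P stay) (kop P last_gain (fun=> 1)) x)%E.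
Proof.
have e t : (iter t (kop P stay) (kop P last_gain (fun=> 1)) x =
    \int[PP x]_w ((\prod_(j < t) stay (w j, w j.+1)) * last_gain (w t, w t.+1))%:E)%E.
  pose u j := if (j < t)%N then stay else last_gain.
  have wu j : weight (u j).
    by rewrite /u; case: ifP => _; [exact: weight_stay|exact: weight_last_gain].
  have := path_expectation (weight_one R S).1 (weight_one R S).2 (PP_density PP_law x)
    t.+1 (fun j => (wu j).1) (fun j => (wu j).2) (nneg_cst S ler01).
  rewrite /= /u ltnn.
  rewrite (_ : (fun z => 1 * last_gain z) = last_gain); last first.
    by apply/funext => z; rewrite mul1r.
  rewrite (@eq_kops _ _ _ _ _ (fun=> stay)); last first.
    by move=> j ji; apply/funext => z; rewrite ji mul1r.
  rewrite kops_iter => <-; apply: eq_integral => w _.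
  rewrite mule1 big_ord_recr /= ltnn; congr (_ * _)%:E.
  by apply: eq_bigr => j _; rewrite ltn_ord.
rewrite (eq_bigr _ (fun (t : 'I_n) _ => e t)) integral_indicM.
have hg t : nneg_measurable (fun w : trajectory S =>
    ((\prod_(j < t) stay (w j, w j.+1)) * last_gain (w t, w t.+1))%:E).
  split; last by move=> w; rewrite lee_fin gain_path; case: ifP.
  have mjj j : measurable_fun setT (fun w : trajectory S => (w j, w j.+1)).
    by apply: measurable_fun_pair; exact: measurable_coord.
  apply/measurable_EFinP; apply: measurable_funM.
    apply: measurable_prod => j _; exact: (measurableT_comp weight_stay.1 (mjj j)).
  exact: (measurableT_comp weight_last_gain.1 (mjj t)).
rewrite -ge0_integral_sum//; [|by move=> t; exact: (hg t).1|by move=> t w _; exact: (hg t).2].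
apply: eq_integral => w _.
under [RHS]eq_bigr do rewrite gain_path.
rewrite sumEFin -EFinM; congr EFin.
rewrite indicE /last_score.
have [[t tn tE]|h] := pselect (exists2 t, (t < n)%N & tau K w = Some t.+1).
  rewrite tE mem_set ?mul1r//; last by exists t.+1.
  rewrite (bigD1 (Ordinal tn))//= eqxx big1 ?addr0// => i.
  by rewrite -val_eqE /= => it; case: eqP => // -[ti]; rewrite ti eqxx in it.
rewrite [RHS]big1; last first.
  move=> t _; case: eqP => // tE; exfalso; apply: h; exists t => //.
case E : (tau K w) => [[|t]|]; last by rewrite mulr0.
- have /tau_SomeP[_ K0] := E; by rewrite s_stop// mulr0.
- rewrite memNset ?mul0r// => -[t' /=]; rewrite E => -[<-] tn.
  by apply: h; exists t.
Qed.

End killing.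

(** * Geometric tail of the hitting time under importance sampling *)

Section importance_tail.
Context (R : realType) d (S : measurableType d) (P : R.-pker S ~> S)
  (K : set S) (mK : measurable K) (s beta : S -> S -> R).
Hypotheses (ms : measurable_fun setT (fun z : S * S => s z.1 z.2))
  (mbeta : measurable_fun setT (fun z : S * S => beta z.1 z.2))
  (s_ge0 : forall x y, 0 <= s x y) (beta_gt0 : forall x y, 0 < beta x y).
Variables (PP : S -> probability (trajectory S) R)
  (PP_law : forall x, markov_law (fun x B => P x B) x (PP x)).
Variables (sM bM : R) (sM0 : 0 <= sM) (bM0 : 0 <= bM).
Hypotheses (s_le : forall x y, ~ K x -> s x y <= sM)
  (beta_le : forall x y, ~ K x -> beta x y <= bM).
Variables (m : S -> R) (M : R) (bm : bounded_weight K m M)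
  (muE : forall x, mu K s beta PP x = (m x)%:E)
  (AE : A K s beta PP = ~` K).

Notation cost := (cost P K s beta).
Notation cost0 := (cost0 P K s beta).
Notation T := (kop P (step K beta)).
Notation gR := (gR P K s beta).
Notation isw := (isw P K s beta).
Notation dens := (dens P K s beta).

Let wstep := weight_step mK (pweight_beta mbeta beta_gt0).
Let wrew := weight_reward mK ms s_ge0 (pweight_beta mbeta beta_gt0).

Variables (nu : S -> R) (N : R) (bnu : bounded_weight K nu N)
  (nu_gt0 : forall x, ~ K x -> 0 < nu x).
Variables (x0 : S) (L : probability (trajectory S) R)
  (hL : markov_law (Q P K s beta PP nu) x0 L).
Variables (eps bmin G0 : R) (eps0 : 0 < eps) (bmin0 : 0 < bmin) (G0_gt0 : 0 < G0).
Hypotheses (nu_eps : forall x, ~ K x -> eps <= nu x)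
  (beta_ge : forall x y, ~ K x -> bmin <= beta x y)
  (gR_G0 : forall x, gR nu x <= G0) (G0_ge : eps * bmin <= G0).

Let nu_ge0 x : 0 <= nu x. Proof. by case: bnu. Qed.
Let nu_dead x : K x -> nu x = 0. Proof. by case: bnu => _ _ h _; exact: h. Qed.
Let gpos x : ~ K x -> 0 < gR nu x.
Proof.
exact: (gR_gt0' mK ms mbeta s_ge0 beta_gt0 PP_law sM0 bM0 s_le beta_le bm muE AE bnu nu_gt0).
Qed.
Let wdens : weight (dens nu).
Proof.
exact: (weight_dens mK ms mbeta s_ge0 beta_gt0 PP_law sM0 bM0 s_le beta_le bm muE AE bnu nu_gt0).
Qed.

Notation gain := (last_gain K s).

(** The indicator of [tau > n], written as a product so that [path_expectation] applies. *)
Definition surv n (w : nat -> S) : R :=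
  (\prod_(j < n) (stay R K) (w j, w j.+1)) * alive R K (w n).

(** [U] is the importance sampling chain killed on entering [K], and [hK] the probability of being
    killed at the next step. *)
Let U := kop P (fun z => dens nu z * (stay R K) z).
Let hK := kop P (fun z => dens nu z * (leave R K) z) (fun=> 1%E).
Let aliveE : S -> \bar R := EFin \o alive R K.

Let wU : weight (fun z => dens nu z * (stay R K) z).
Proof. exact: weightM wdens (weight_stay R mK). Qed.
Let wK : weight (fun z => dens nu z * (leave R K) z).
Proof. exact: weightM wdens (weight_leave R mK). Qed.
Let h1 : @nneg_measurable R _ S (fun=> 1%E). Proof. exact: (nneg_cst _ ler01). Qed.
Let hal : nneg_measurable aliveE.
Proof.
split; first by apply/measurable_EFinP; exact: measurable_alive.
by move=> y; rewrite lee_fin alive_ge0.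
Qed.

Lemma surv_tail n : (\int[L]_w (surv n w)%:E = iter n U aliveE x0)%E.
Proof.
have := path_expectation wdens.1 wdens.2
  (law_dens mK ms mbeta s_ge0 beta_gt0 PP_law sM0 bM0 s_le beta_le bm muE AE bnu nu_gt0 hL)
  n (fun=> (weight_stay R mK).1) (fun=> (weight_stay R mK).2) hal.
by rewrite kops_iter => <-; apply: eq_integral => w _; rewrite -EFinM.
Qed.

(** [gR] is the total mass of the unnormalised density; on [K] the value of [nu] is zero, in
    accordance with the killing in [T]. *)
Lemma dens_mass y : ~ K y -> kop P (dens nu) (fun=> 1%E) y = 1%E.
Proof.
move=> nK; have gy := gpos nK.
transitivity ((gR nu y)^-1%:E * (cost0 y + T (EFin \o nu) y))%E; last first.
  rewrite -(gREFin P mK ms mbeta s_ge0 beta_gt0 sM0 bM0 s_le beta_le y bnu).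
  by rewrite -EFinM mulVf// gt_eqF.
have hnu := nneg_bounded bnu.
have [mr r0] := nneg_measurable_wM y wrew h1.
have [mt t0] := nneg_measurable_wM y wstep hnu.
rewrite /cost0 /kop -ge0_integralD// -ge0_integralZl_EFin//; last 3 first.
- by move=> z _; exact: adde_ge0.
- exact: emeasurable_funD.
- by rewrite invr_ge0 ltW.
apply: eq_integral => z _; rewrite /= !mule1 -!(EFinM, EFinD); congr EFin.
rewrite dens_alive// /reward /step /= alive1// !mul1r.
have [Kz|nKz] := pselect (K z).
  by rewrite alive0// nu_dead//; field; rewrite gt_eqF.
by rewrite alive1//; field; rewrite gt_eqF.
Qed.

Lemma U_mass y : (U aliveE y + hK y = aliveE y)%E.
Proof.
have [Ky|nK] := pselect (K y).
  rewrite /U /hK !kop_dead; first by rewrite adde0 /aliveE /= alive0.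
    by move=> z; rewrite /leave /= alive0// mul0r mulr0.
  by move=> z; rewrite /stay /= alive0// mul0r mulr0.
rewrite [RHS]/aliveE /= alive1// -(dens_mass nK).
rewrite /U (@eq_kop _ _ _ _ _ (fun z => dens nu z * (stay R K) z) _ (fun=> 1%E)).
  rewrite -kopDl//; apply: eq_kop => z; congr (_%:E * _)%E.
  by rewrite /stay /leave /= alive1//; ring.
move=> z; rewrite /aliveE mule1 -EFinM /stay /=; congr EFin.
by have [Kz|nKz] := pselect (K z); rewrite ?(alive0 R Kz) ?(alive1 R nKz) ?mulr0 ?mulr1.
Qed.

Lemma le_iterU n f g : nneg_measurable f -> nneg_measurable g ->
  (forall y, f y <= g y)%E -> forall y, (iter n U f y <= iter n U g y)%E.
Proof.
move=> hf hg fg; elim: n => //= n ih y.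
apply: (mf_le (monotone_kop P y wU)) => //; exact: nneg_iter_kop.
Qed.

Lemma iterUZ n f r : 0 <= r -> nneg_measurable f ->
  iter n U (fun y => r%:E * f y)%E = (fun y => r%:E * iter n U f y)%E.
Proof.
move=> r0 hf; elim: n => //= n ->; apply/funext => y.
by apply: kopZ => //; exact: nneg_iter_kop.
Qed.

Lemma U_alive_le n y : (iter n U aliveE y <= aliveE y)%E.
Proof.
elim: n => //= n ih in y *.
apply: (@le_trans _ _ (U aliveE y)).
  by apply: (mf_le (monotone_kop P y wU)) => //; exact: nneg_iter_kop.
rewrite -U_mass leeDl//; by case: (nneg_kop P wK h1).
Qed.

(** A chain started off [K] either survives [n] steps or is killed at exactly one of them. *)
Lemma U_split n y : (iter n U aliveE y + \sum_(t < n) iter t U hK y = aliveE y)%E.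
Proof.
have hhK : nneg_measurable hK by exact: nneg_kop.
elim: n y => [|n ih] y; first by rewrite big_ord0 adde0.
rewrite big_ord_recl /= -U_mass.
have hi t := nneg_iter_kop P t wU hhK.
rewrite -(kop_sum P y n wU hi) [(hK y + _)%E]addeC addeA.
rewrite -(mf_add (monotone_kop P y wU)); last 2 first.
- exact: nneg_iter_kop.
- exact: nneg_sum.
by congr (kop _ _ _ _ + _)%E; apply/funext => z; exact: ih.
Qed.

Let q0 := eps * bmin / G0.
Let q1 := bmin / G0.

Lemma dens_stay z : q0 * (stay R K) z <= dens nu z * (stay R K) z.
Proof.
case: z => a b; rewrite /stay /=; have [Ka|nKa] := pselect (K a).
  by rewrite alive0// mul0r !mulr0.
have [Kb|nKb] := pselect (K b); first by rewrite (alive0 _ Kb) !mulr0.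
rewrite !alive1// !mulr1 dens_alive//.
have ga := gpos nKa.
rewrite ler_pdivlMr// /q0 mulrAC ler_pdivrMr//.
apply: ler_pM; [by rewrite mulr_ge0// ltW|exact: ltW| |exact: gR_G0].
apply: ler_pM; [exact: ltW|exact: ltW| |exact: beta_ge].
by rewrite ler_wpDl// nu_eps.
Qed.

(** As [nu] vanishes on [K], the sampling chain enters [K] only with a positive score. The density
    is bounded below by a multiple of that score rather than by a constant, and this is where the
    weight in Assumption 2 is needed. *)
Lemma dens_leave z : q1 * gain z <= dens nu z * (leave R K) z.
Proof.
case: z => a b; rewrite /last_gain /leave /=; have [Ka|nKa] := pselect (K a).
  by rewrite alive0// !mul0r !mulr0.
rewrite alive1// mul1r dens_alive// mulrCA [leRHS]mulrC.
apply: ler_wpM2l; first by rewrite subr_ge0 alive_le1.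
have ga := gpos nKa.
rewrite ler_pdivlMr// /q1 -mulrA mulrAC ler_pdivrMr//.
rewrite mulrA; apply: ler_pM => //; [by rewrite mulr_ge0// ?ltW|exact: ltW| ].
rewrite mulrC; apply: ler_pM => //; [exact: ltW| |exact: beta_ge].
by rewrite lerDl.
Qed.

Variables (n0 : nat) (c0 : R).
Hypothesis hc0 : forall y, ~ K y ->
  (c0%:E <= \sum_(t < n0) iter t (kop P (stay R K)) (kop P gain (fun=> 1)) y)%E.

Let c := q0 ^+ n0 * q1 * c0.

Let q0_gt0 : 0 < q0. Proof. by rewrite !mulr_gt0// invr_gt0. Qed.
Let q0_le1 : q0 <= 1. Proof. by rewrite ler_pdivrMr// mul1r. Qed.
Let q1_gt0 : 0 < q1. Proof. by rewrite mulr_gt0// invr_gt0. Qed.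
Let q0_ge0 : 0 <= q0 := ltW q0_gt0.
Let q1_ge0 : 0 <= q1 := ltW q1_gt0.
Let wstay : weight (stay R K) := weight_stay R mK.
Let wgain : weight gain := weight_last_gain mK ms s_ge0.
Let hgain : nneg_measurable (kop P gain (fun=> 1%E)) := nneg_kop P wgain h1.
Let hhK : nneg_measurable hK := nneg_kop P wK h1.

(** Compared with the original kernel, each surviving step costs a factor [q0] and the entry into
    [K] a factor [q1]. *)
Lemma iter_U_ge t y : ((q0 ^+ t * q1)%:E * iter t (kop P (stay R K)) (kop P gain (fun=> 1)) y
  <= iter t U hK y)%E.
Proof.
elim: t y => [|t ih] y /=.
  rewrite expr0 mul1r /hK -kopZ//; apply: le_kop => //.
    by apply: nneg_measurable_mul.
  by move=> z; rewrite !mule1 -EFinM lee_fin mulrC dens_leave.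
have hi : nneg_measurable (iter t (kop P (stay R K)) (kop P gain (fun=> 1%E))).
  exact: nneg_iter_kop.
have hU := nneg_iter_kop P t wU hhK.
have q_ge0 : 0 <= q0 ^+ t.+1 * q1 by rewrite mulr_ge0// exprn_ge0.
rewrite -kopZ// -[leRHS]/(kop P (fun z => dens nu z * (stay R K) z) (iter t U hK) y).
apply: le_kop => //; first by apply: nneg_measurable_mul.
move=> z.
have -> : (((stay R K) (y, z))%:E * ((q0 ^+ t.+1 * q1)%:E *
    iter t (kop P (stay R K)) (kop P gain (fun=> 1)) z) =
  (q0 * (stay R K) (y, z))%:E * ((q0 ^+ t * q1)%:E *
    iter t (kop P (stay R K)) (kop P gain (fun=> 1)) z))%E.
  by rewrite !muleA -!EFinM; congr (_%:E * _)%E; rewrite exprS; ring.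
apply: lee_pmul; [| | |exact: ih].
- by rewrite lee_fin mulr_ge0//; exact: wstay.2.
- by apply: mule_ge0; [rewrite lee_fin mulr_ge0// exprn_ge0|exact: hi.2].

by rewrite lee_fin dens_stay.
Qed.

Lemma lee_complement (a b : \bar R) (r : R) :
  (0 <= a)%E -> (a + b = 1)%E -> (r%:E <= b)%E -> (a <= (1 - r)%:E)%E.
Proof.
by move=> a0 ab rb; rewrite EFinB leeBrDr// -ab leeD2l.
Qed.

Lemma block_mass y : ~ K y -> (c%:E <= \sum_(t < n0) iter t U hK y)%E.
Proof.
move=> nK; have q_ge0 t : 0 <= q0 ^+ t * q1 by rewrite mulr_ge0// exprn_ge0.
apply: (@le_trans _ _ ((q0 ^+ n0 * q1)%:E *
    \sum_(t < n0) iter t (kop P (stay R K)) (kop P gain (fun=> 1)) y)%E).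
  by rewrite /c EFinM lee_pmul2l ?hc0// lte_fin mulr_gt0// exprn_gt0.
have hi t : (0 <= iter t (kop P (stay R K)) (kop P gain (fun=> 1)) y)%E.
  by case: (nneg_iter_kop P t wstay hgain).
rewrite ge0_sume_distrr//; apply: lee_sum => t _.
apply: le_trans (iter_U_ge t y); apply: lee_wpmul2r => //.
(* As [q0 <= 1], the exponent [n0] gives a factor valid over the whole block. *)
rewrite lee_fin ler_wpM2r//; apply: ler_wiXn2l => //; exact: ltnW.
Qed.

Lemma c_le1 y : ~ K y -> c <= 1.
Proof.
move=> nK; rewrite -lee_fin; apply: le_trans (block_mass nK) _.
have := U_split n0 y; rewrite [RHS]/aliveE /= alive1// => <-.
by rewrite leeDr//; case: (nneg_iter_kop P n0 wU hal).
Qed.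

Lemma tail_block y : (iter n0 U aliveE y <= (1 - c)%:E * aliveE y)%E.
Proof.
have [Ky|nK] := pselect (K y).
  by apply: le_trans (U_alive_le _ _) _; rewrite /aliveE /= alive0// mule0.
rewrite [X in (_ * X)%E]/aliveE /= alive1// mule1.
apply: lee_complement (block_mass nK); first by case: (nneg_iter_kop P n0 wU hal).
by rewrite U_split /aliveE /= alive1.
Qed.

(** Each whole block of [n0] steps contributes a factor [1 - c]; for the remaining steps it is
    enough that [U] does not increase mass. *)
Lemma tail_bound n : ~ K x0 ->
  (iter n U aliveE x0 <= ((1 - c) ^+ (n %/ n0))%:E)%E.
Proof.
move=> nK; have c1 : 0 <= 1 - c by rewrite subr_ge0; exact: c_le1 nK.
have hit k := nneg_iter_kop P k wU hal.
have hc r : 0 <= r -> nneg_measurable (fun y => r%:E * aliveE y)%E.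
  by move=> r0; exact: nneg_measurable_mul.
have blocks k y : (iter (k * n0) U aliveE y <= ((1 - c) ^+ k)%:E * aliveE y)%E.
  elim: k y => [|k ih] y; first by rewrite mul0n expr0 mul1e.
  rewrite mulSn iterD; apply: (@le_trans _ _ (iter n0 U (fun y => ((1 - c) ^+ k)%:E * aliveE y)%E y)).
    by apply: le_iterU => //; apply: hc; exact: exprn_ge0.
  rewrite iterUZ// ?exprn_ge0// exprSr EFinM -muleA; apply: lee_wpmul2l.
    by rewrite lee_fin exprn_ge0.
  exact: tail_block.
rewrite {1}(divn_eq n n0) addnC iterD.
apply: (@le_trans _ _ (iter (n %% n0) U (fun y => ((1 - c) ^+ (n %/ n0))%:E * aliveE y)%E x0)).
  by apply: le_iterU => //; apply: hc; exact: exprn_ge0.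
rewrite iterUZ// ?exprn_ge0//; rewrite -[leRHS]mule1; apply: lee_wpmul2l.
  by rewrite lee_fin exprn_ge0.
by apply: le_trans (U_alive_le _ _) _; rewrite lee_fin alive_le1.
Qed.

Lemma surv_tail_bound n : ~ K x0 ->
  (\int[L]_w (surv n w)%:E <= ((1 - c) ^+ (n %/ n0))%:E)%E.
Proof. by move=> nK; rewrite surv_tail; exact: tail_bound. Qed.

End importance_tail.

Section geometric_bounds.
Context (R : realType).

Lemma bernoulli_le (x : R) n : 0 <= x <= 1 -> 1 - n%:R * x <= (1 - x) ^+ n.
Proof.
move=> /andP[x0 x1]; elim: n => [|n ih]; first by rewrite mul0r subr0 expr0.
rewrite exprS; apply: (@le_trans _ _ ((1 - x) * (1 - n%:R * x))).
  have n0 : 0 <= n%:R :> R by [].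
  by rewrite -natr1; nra.
by apply: ler_wpM2l => //; rewrite subr_ge0.
Qed.

Lemma geo_sum_le (a : R) k : 0 <= a < 1 -> \sum_(j < k) a ^+ j <= (1 - a)^-1.
Proof.
move=> /andP[a0 a1]; have a1' : 0 < 1 - a by rewrite subr_gt0.
have : (1 - a) * \sum_(j < k) a ^+ j = 1 - a ^+ k.
  elim: k => [|k ih]; first by rewrite big_ord0 mulr0 expr0 subrr.
  by rewrite big_ord_recr /= mulrDr ih exprS; ring.
rewrite -(ler_pM2l a1') => ->; rewrite divff ?gt_eqF//.
by rewrite gerBl exprn_ge0.
Qed.

(** The weights along a path may grow like [rho ^ k], so second moments meet [rho ^ 2]: it is the
    square that the tail of [tau] has to beat. *)
Lemma block_geometric (c : R) n : 0 < c <= 1 -> (0 < n)%N ->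
  exists rho C : R, [/\ 1 < rho, 0 < C &
    forall k, \sum_(j < k) (rho ^+ 2) ^+ j * (1 - c) ^+ (j %/ n) <= C].
Proof.
move=> /andP[c0 c1] n0.
have nR : 1 <= n%:R :> R by rewrite ler1n.
(* By Bernoulli's inequality [(1 - y)^n >= 1 - c/2], so [n] steps at rate [1 - y] decay no faster
   than one block at rate [1 - c]. *)
pose y := c / 2 / n%:R; pose r := 1 - y.
have y0 : 0 < y by rewrite !divr_gt0// (lt_le_trans ltr01 nR).
have y1 : y <= 2^-1.
  rewrite /y ler_pdivrMr ?(lt_le_trans ltr01 nR)//; nra.
have rn : 1 - c <= r ^+ n.
  apply: le_trans (bernoulli_le n _); last by rewrite ltW//=; nra.
  rewrite /y mulrCA divff ?mulr1 ?gt_eqF ?(lt_le_trans ltr01 nR)//; nra.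
have r0 : 0 < r by rewrite /r; nra.
have r1 : r <= 1 by rewrite /r; nra.
have r0' := ltW r0.
have c1' : 0 <= 1 - c by rewrite subr_ge0.
(* [(1 + y/4)^2] is below [1 + y], hence [a < 1]. *)
pose rho := 1 + y / 4; pose a := rho ^+ 2 * r.
have a01 : 0 <= a < 1.
  rewrite /a /rho /r; apply/andP; split; first by rewrite mulr_ge0 ?sqr_ge0.
  nra.
exists rho, ((1 - a)^-1 * (r ^- n)); split; first by rewrite /rho; nra.
  by rewrite mulr_gt0 ?invr_gt0 ?exprn_gt0// subr_gt0; case/andP: a01.
move=> k; apply: (@le_trans _ _ (\sum_(j < k) a ^+ j * r ^- n)); last first.
  rewrite -mulr_suml ler_wpM2r ?invr_ge0 ?exprn_ge0//; exact: geo_sum_le.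
apply: ler_sum => j _; rewrite [a ^+ j]exprMn -mulrA.
apply: ler_wpM2l; first by apply: exprn_ge0; exact: sqr_ge0.
rewrite ler_pdivlMr ?exprn_gt0//.
apply: (@le_trans _ _ ((r ^+ n) ^+ (j %/ n) * r ^+ (j %% n))).
  apply: ler_pM; rewrite ?exprn_ge0//.
    by apply: lerXn2r; rewrite ?nnegrE ?exprn_ge0.
  by apply: ler_wiXn2l => //; rewrite ltnW// ltn_mod.
by rewrite -exprM mulnC -exprD -divn_eq.
Qed.

End geometric_bounds.

(** * Deterministic estimates along one path *)

Section near_path.
Context (R : realType) d (S : measurableType d) (K : set S) (s : S -> S -> R).
Variables (m nu g : S -> R) (eps N V G0 bM rho : R).
Hypotheses (s_ge0 : forall x y, 0 <= s x y)
  (m_dead : forall x, K x -> m x = 0) (nu_dead : forall x, K x -> nu x = 0)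
  (nu_ge0 : forall x, 0 <= nu x) (nu_eps : forall x, ~ K x -> eps <= nu x)
  (nu_le : forall x, nu x <= N) (eps0 : 0 < eps) (V0 : 0 <= V) (bM0 : 0 <= bM)
  (num : forall x, `|nu x - m x| <= V)
  (gm : forall x, ~ K x -> `|g x - m x| <= bM * V)
  (g_ge0 : forall x, 0 <= g x) (g_le : forall x, g x <= G0)
  (g_nu : forall x, ~ K x -> g x <= rho * nu x) (rho1 : 1 < rho).
Variable w : nat -> S.
Hypothesis good : forall k, ~ K (w k) -> 0 < s (w k) (w k.+1) + nu (w k.+1).

Let v x y := g x / (s x y + nu y).
Let W n := \prod_(j < n) step K v (w j, w j.+1).

Let v_ge0 x y : 0 <= v x y.
Proof. by rewrite divr_ge0// addr_ge0. Qed.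

Let W_ge0 n : 0 <= W n.
Proof.
by apply: prodr_ge0 => j _; apply: mulr_ge0 => //; apply: mulr_ge0; exact: alive_ge0.
Qed.

(** Multiplied by [nu] at the arrival point, the weight of a step is at most [g] at the departure
    point, hence at most [rho] times [nu] there; the bounds chain up along the path. *)
Lemma path_weight_le n : W n * nu (w n) <= rho ^+ n * nu (w 0%N).
Proof.
elim: n => [|n ih]; first by rewrite /W big_ord0 expr0.
rewrite /W big_ord_recr /= -/(W n) exprS -mulrA.
have r0 : 0 <= rho by rewrite ltW// (lt_trans ltr01).
have rhs0 : 0 <= rho * (rho ^+ n * nu (w 0%N)) by rewrite !mulr_ge0// exprn_ge0.
have [Kn|nKn] := pselect (K (w n)).
  by rewrite /step /= (alive0 R Kn) !mul0r mulr0 -mulrA.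
have [Kn1|nKn1] := pselect (K (w n.+1)).
  by rewrite nu_dead// !mulr0 -mulrA.
apply: (@le_trans _ _ (W n * (rho * nu (w n)))); last first.
  by rewrite mulrCA -mulrA; apply: ler_wpM2l.
apply: ler_wpM2l => //; rewrite /step /= !alive1// !mul1r.
apply: le_trans (g_nu nKn); rewrite /v mulrAC ler_pdivrMr ?good//.
by apply: ler_wpM2l => //; rewrite lerDr.
Qed.

Lemma surv01 n : surv R K n w = 0 \/ surv R K n w = 1.
Proof.
have [[j jn Kj]|h] := pselect (exists2 j, (j <= n)%N & K (w j)).
  by left; exact: stay_path_dead jn Kj.
right; rewrite /surv stay_path.
  by rewrite mul1r alive1// => Kn; apply: h; exists n.
by move=> j jn Kj; apply: h; exists j.
Qed.

Lemma path_incr n :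
  `|W n * (reward K s v (w n, w n.+1) + step K v (w n, w n.+1) * m (w n.+1) - m (w n))|
  <= ((G0 / eps + bM) * (N / eps) * V) * (rho ^+ n * surv R K n w).
Proof.
have r0 : 0 <= rho by rewrite ltW// (lt_trans ltr01).
have G00 : 0 <= G0 by exact: le_trans (g_ge0 (w 0%N)) (g_le _).
have N0 : 0 <= N by exact: le_trans (nu_ge0 (w 0%N)) (nu_le _).
have e0 := ltW eps0.
have c0 : 0 <= (G0 / eps + bM) * (N / eps) * V.
  by rewrite mulr_ge0// mulr_ge0// ?addr_ge0// divr_ge0.
have rhs0 : 0 <= ((G0 / eps + bM) * (N / eps) * V) * (rho ^+ n * surv R K n w).
  rewrite mulr_ge0// mulr_ge0//; first exact: exprn_ge0.
  by case: (surv01 n) => ->.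
have [Kn|nKn] := pselect (K (w n)).
  by rewrite /reward /step /= (alive0 R Kn) !mul0r m_dead// addr0 subr0 mulr0 normr0.
have [[j jn Kj]|h] := pselect (exists2 j, (j < n)%N & K (w j)).
  suff -> : W n = 0 by rewrite mul0r normr0.
  by rewrite /W (bigD1 (Ordinal jn))//= /step /= (alive0 R Kj) !mul0r.
have -> : surv R K n w = 1.
  have nK j : (j <= n)%N -> ~ K (w j).
    rewrite leq_eqVlt => /predU1P[->//|jn] Kj; apply: h; by exists j.
  by rewrite /surv stay_path// mul1r alive1.
rewrite mulr1 normrM ger0_norm//.
have Wn : W n <= rho ^+ n * (N / eps).
  rewrite mulrA ler_pdivlMr//.
  apply: (@le_trans _ _ (W n * nu (w n))); first by apply: ler_wpM2l => //; exact: nu_eps.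
  apply: le_trans (path_weight_le n) _; apply: ler_wpM2l => //; exact: exprn_ge0.
have -> : ((G0 / eps + bM) * (N / eps) * V) * rho ^+ n =
  (rho ^+ n * (N / eps)) * ((G0 / eps + bM) * V) by ring.
apply: ler_pM => //.
set x := w n; set y := w n.+1.
have sn : 0 < s x y + nu y by exact: good.
(* The one-step defect splits into the error of [g] and that of [nu], both of order [V]; it vanishes
   for an exact estimate. *)
have -> : reward K s v (x, y) + step K v (x, y) * m y - m x =
    (g x - m x) + g x * (m y - nu y) / (s x y + nu y).
  rewrite /reward /step /= alive1//.
  have -> : 1 * alive R K y * v x y * m y = v x y * m y.
    have [Ky|nKy] := pselect (K y); first by rewrite m_dead// !mulr0.
    by rewrite alive1// !mul1r.
  by rewrite /v; field; rewrite gt_eqF.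
apply: le_trans (ler_normD _ _) _; rewrite mulrDl addrC lerD//; last exact: gm.
have [Ky|nKy] := pselect (K y).
  by rewrite m_dead// nu_dead// subrr mulr0 mul0r normr0 mulr_ge0// divr_ge0.
have i0 : 0 <= (s x y + nu y)^-1 by rewrite invr_ge0 ltW.
rewrite normrM normrM ger0_norm// [`|(s x y + nu y)^-1|]ger0_norm//.
rewrite mulrAC; apply: ler_pM => //.
- exact: mulr_ge0.
- apply: ler_pM => //.
  rewrite lef_pV2 ?posrE//; apply: le_trans (nu_eps nKy) _; by rewrite lerDr.
- by rewrite distrC.
Qed.

(** For an exact estimate the partial scores plus the weighted value of [m] are constant along the
    path; in general the defects of the single steps add up. *)
Lemma path_telescope n :
  `|\sum_(i < n) term K s v i w + W n * m (w n) - m (w 0%N)|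
  <= ((G0 / eps + bM) * (N / eps) * V) * \sum_(k < n) rho ^+ k * surv R K k w.
Proof.
elim: n => [|n ih].
  by rewrite !big_ord0 /W big_ord0 mul1r add0r subrr normr0 mulr0.
rewrite big_ord_recr [X in _ <= _ * X]big_ord_recr /= mulrDr.
apply: le_trans (lerD ih (path_incr n)).
apply: le_trans (ler_normD _ _); rewrite le_eqVlt; apply/orP; left; apply/eqP.
congr (`| _ |); rewrite /W big_ord_recr /= -/(W n) /term -/(W n); ring.
Qed.

(** As [rho > 1], a geometric sum is dominated by its next term, so each new cross term is at most a
    multiple of the new square. The result is linear in [surv], so its mean is given by the tail of
    [tau]. *)
Lemma surv_sq n : (\sum_(k < n) rho ^+ k * surv R K k w) ^+ 2 <=
  (2 / (rho - 1) + 1) * \sum_(k < n) (rho ^+ 2) ^+ k * surv R K k w.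
Proof.
have r1 : 0 < rho - 1 by rewrite subr_gt0.
have sum_le k : \sum_(j < k) rho ^+ j * surv R K j w <= rho ^+ k / (rho - 1).
  elim: k => [|k ih]; first by rewrite big_ord0 divr_ge0// ?exprn_ge0//; exact: ltW.
  rewrite big_ord_recr /=; apply: (@le_trans _ _ (rho ^+ k / (rho - 1) + rho ^+ k)).
    apply: lerD => //; apply: ler_piMr; first by rewrite exprn_ge0// ltW// (lt_trans ltr01).
    by case: (surv01 k) => ->.
  by rewrite exprS le_eqVlt; apply/orP; left; apply/eqP; field; rewrite gt_eqF.
elim: n => [|n ih]; first by rewrite !big_ord0 expr0n mulr0.
rewrite !big_ord_recr /= mulrDr.
have [->|->] := surv01 n; first by rewrite !mulr0 !addr0.
rewrite !mulr1 sqrrD -addrA lerD//.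
have := sum_le n; set G := \sum_(j < n) _ => hG.
have rn : 0 <= rho ^+ n by rewrite exprn_ge0// ltW// (lt_trans ltr01).
rewrite -exprM mulnC exprM mulrDl mul1r lerD2r -mulr_natl.
apply: le_trans (ler_wpM2l (_ : 0 <= 2%:R) (ler_wpM2r rn hG)) _ => //.
by rewrite le_eqVlt; apply/orP; left; apply/eqP; ring.
Qed.

End near_path.

(** * Second moment of the scores near the target *)

Section importance_moments.
Context (R : realType) d (S : measurableType d) (P : R.-pker S ~> S)
  (K : set S) (mK : measurable K) (s beta : S -> S -> R).
Hypotheses (ms : measurable_fun setT (fun z : S * S => s z.1 z.2))
  (mbeta : measurable_fun setT (fun z : S * S => beta z.1 z.2))
  (s_ge0 : forall x y, 0 <= s x y) (beta_gt0 : forall x y, 0 < beta x y).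
Variables (PP : S -> probability (trajectory S) R)
  (PP_law : forall x, markov_law (fun x B => P x B) x (PP x)).
Variables (sM bM : R) (sM0 : 0 <= sM) (bM0 : 0 <= bM).
Hypotheses (s_le : forall x y, ~ K x -> s x y <= sM)
  (beta_le : forall x y, ~ K x -> beta x y <= bM).
Variables (m : S -> R) (M : R) (bm : bounded_weight K m M)
  (muE : forall x, mu K s beta PP x = (m x)%:E)
  (AE : A K s beta PP = ~` K).

Notation cost := (cost P K s beta).
Notation cost0 := (cost0 P K s beta).
Notation gR := (gR P K s beta).
Notation isw := (isw P K s beta).
Notation dens := (dens P K s beta).

Variables (nu : S -> R) (N : R) (bnu : bounded_weight K nu N)
  (nu_gt0 : forall x, ~ K x -> 0 < nu x).
Variables (x0 : S) (L : probability (trajectory S) R)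
  (hL : markov_law (Q P K s beta PP nu) x0 L).
Variables (eps bmin G0 : R) (eps0 : 0 < eps) (bmin0 : 0 < bmin) (G0_gt0 : 0 < G0).
Hypotheses (nu_eps : forall x, ~ K x -> eps <= nu x)
  (beta_ge : forall x y, ~ K x -> bmin <= beta x y)
  (gR_G0 : forall x, gR nu x <= G0) (G0_ge : eps * bmin <= G0).

Let nu_ge0 x : 0 <= nu x. Proof. by case: bnu. Qed.
Let nu_dead x : K x -> nu x = 0. Proof. by case: bnu => _ _ h _; exact: h. Qed.

Let lawd := law_dens mK ms mbeta s_ge0 beta_gt0 PP_law sM0 bM0 s_le beta_le bm muE AE bnu nu_gt0 hL.
Let Yterms := Ynu_terms mK ms mbeta s_ge0 beta_gt0 PP_law sM0 bM0 s_le beta_le bm muE AE bnu nu_gt0.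
Let nnegY := nneg_Ynu mK ms mbeta s_ge0 beta_gt0 PP_law sM0 bM0 s_le beta_le bm muE AE bnu nu_gt0.
Let wisw := pweight_isw P mK ms mbeta s_ge0 beta_gt0 bnu.
Let gR0 y : 0 <= gR nu y := gR_ge0 P mK ms mbeta s_ge0 beta_gt0 y bnu.

Lemma isw_step_le z : step K (isw nu) z <= G0 / eps.
Proof.
case: z => a b; have h0 : 0 <= G0 / eps by apply: divr_ge0; exact: ltW.
rewrite /step /=; have [Ka|nKa] := pselect (K a).
  by rewrite (alive0 R Ka) !mul0r.
have [Kb|nKb] := pselect (K b).
  by rewrite (alive0 R Kb) mulr0 mul0r.
rewrite !alive1// !mul1r; apply: ler_pM => //; first by rewrite invr_ge0 addr_ge0.
have h : eps <= s a b + nu b by rewrite ler_wpDl// nu_eps.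
by rewrite lef_pV2// posrE// (lt_le_trans eps0 h).
Qed.

(** The arrival point may lie in [K], where the denominator has no lower bound; [s / (s + nu) <= 1]
    replaces it. *)
Lemma isw_reward_le z : reward K s (isw nu) z <= G0.
Proof.
case: z => a b; rewrite /reward /=; have [Ka|nKa] := pselect (K a).
  by rewrite alive0// mul0r ltW.
rewrite alive1// mul1r /isw; have [->|s0] := eqVneq (s a b) 0.
  by rewrite mul0r ltW.
have sp : 0 < s a b + nu b by rewrite ltr_wpDr// lt_def s0 s_ge0.
apply: le_trans (gR_G0 a); rewrite mulrCA ler_piMr// ler_pdivrMr// mul1r lerDl//.
Qed.

(** Possibly exponential in [n], which is harmless: it only raises the number of replications. *)
Definition partial_cap n : R := \sum_(i < n) (G0 / eps) ^+ i * G0.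

Lemma partial_le n w : \sum_(i < n) term K s (isw nu) i w <= partial_cap n.
Proof.
apply: ler_sum => i _; apply: ler_pM => //.
- by apply: prodr_ge0 => j _; exact: (weight_step mK wisw).2.
- exact: (weight_reward mK ms s_ge0 wisw).2.
- rewrite -[X in _ <= _ ^+ X](card_ord i) -prodr_const; apply: ler_prod => j _.
  by rewrite isw_step_le (weight_step mK wisw).2.
- exact: isw_reward_le.
Qed.

Variables (n0 : nat) (c0 : R).
Hypothesis hc0 : forall y, ~ K y ->
  (c0%:E <= \sum_(t < n0) iter t (kop P (stay R K)) (kop P (last_gain K s) (fun=> 1)) y)%E.
Hypothesis nKx0 : ~ K x0.

Let c := (eps * bmin / G0) ^+ n0 * (bmin / G0) * c0.
Variables (rho C V : R) (rho1 : 1 < rho) (C0 : 0 < C) (V0 : 0 <= V).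
Hypotheses (hC : forall k, \sum_(j < k) (rho ^+ 2) ^+ j * (1 - c) ^+ (j %/ n0) <= C)
  (num : forall y, `|nu y - m y| <= V) (hV : (bM + 1) * V <= (rho - 1) * eps).

Let F (w : trajectory S) : \bar R :=
  (\sum_(0 <= j <oo) ((rho ^+ 2) ^+ j * (surv R K) j w)%:E)%E.

Let rho2_ge0 j : 0 <= (rho ^+ 2) ^+ j. Proof. by rewrite exprn_ge0// sqr_ge0. Qed.

Let surv_ge0 j w : 0 <= (surv R K) j w.
Proof. by case: (surv01 R K w j) => h; rewrite h. Qed.

Let nneg_surv0 j : nneg_measurable (fun w : trajectory S => ((surv R K) j w)%:E).
Proof.
split; last by move=> w; rewrite lee_fin.
apply/measurable_EFinP.
have mjj i : measurable_fun setT (fun w : trajectory S => (w i, w i.+1)).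
  by apply: measurable_fun_pair; exact: measurable_coord.
have mj := measurableT_comp (@measurable_alive R d S K mK) (@measurable_coord _ S j).
apply: (measurable_funM _ mj).
by apply: measurable_prod => i _; exact: (measurableT_comp (weight_stay R mK).1 (mjj i)).
Qed.

Let nneg_surv j : nneg_measurable (fun w : trajectory S => ((rho ^+ 2) ^+ j * (surv R K) j w)%:E).
Proof.
rewrite (_ : (fun w => _) = fun w : trajectory S => ((rho ^+ 2) ^+ j)%:E * ((surv R K) j w)%:E)%E.
  by apply: nneg_measurable_mul.
by apply/funext => w; rewrite EFinM.
Qed.

Let nneg_F : nneg_measurable F.
Proof.
split; last by move=> w; apply: nneseries_ge0 => j _ _; exact: (nneg_surv j).2.
by apply: ge0_emeasurable_sum => j; [move=> w _ _; exact: (nneg_surv j).2|move=> _; exact: (nneg_surv j).1].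
Qed.

Lemma integral_F_le : (\int[L]_w F w <= C%:E)%E.
Proof.
rewrite integral_nneseries//; [|by move=> j; exact: (nneg_surv j).1|by move=> j w _; exact: (nneg_surv j).2].
apply: lime_le; first by apply: is_cvg_nneseries => j _ _; apply: integral_ge0 => w _; exact: (nneg_surv j).2.
apply: nearW => k; rewrite big_mkord.
apply: (@le_trans _ _ (\sum_(j < k) ((rho ^+ 2) ^+ j * (1 - c) ^+ (j %/ n0))%:E)%E); last first.
  by rewrite sumEFin lee_fin hC.
apply: lee_sum => j _; under eq_integral do rewrite EFinM.
rewrite ge0_integralZl_EFin//; last 2 first.
- by move=> w _; exact: (nneg_surv0 j).2.
- exact: (nneg_surv0 j).1.
rewrite EFinM; apply: lee_wpmul2l; first by rewrite lee_fin.
exact: (surv_tail_bound mK ms mbeta s_ge0 beta_gt0 PP_law sM0 bM0 s_le beta_le bm muE AE bnu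
  nu_gt0 hL eps0 bmin0 G0_gt0 nu_eps beta_ge gR_G0 G0_ge hc0 j nKx0).
Qed.

(** Along a path that never meets [K] all terms of [F] are at least 1, so [F] is infinite there,
    against its finite mean. *)
Lemma ae_hit : {ae L, forall w, exists t, K (w t)}.
Proof.
have iF : L.-integrable setT F.
  apply/integrableP; split; first exact: nneg_F.1.
  under eq_integral do rewrite (gee0_abs (nneg_F.2 _)).
  exact: le_lt_trans integral_F_le (ltry _).
have := integrable_ae measurableT iF; apply: filterS => w /(_ I).
apply: contraPP => /forallNP nK.
have s1 j : (surv R K) j w = 1.
  by rewrite /surv stay_path ?mul1r ?alive1// => i _; exact: nK.
rewrite (_ : F w = +oo%E)//; apply/eqyP => A A0.
pose k := (Num.truncn A).+1.
apply: (@le_trans _ _ (\sum_(0 <= j < k) ((rho ^+ 2) ^+ j * (surv R K) j w)%:E)%E); last first.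
  by apply: nneseries_lim_ge => j _ _; exact: (nneg_surv j).2.
rewrite sumEFin lee_fin big_mkord.
apply: (@le_trans _ _ (\sum_(j < k) 1)).
  rewrite sumr_const card_ord /k; by apply: ltW; exact: truncnS_gt.
apply: ler_sum => j _; rewrite s1 mulr1; apply: exprn_ege1; apply: exprn_ege1.
exact: ltW.
Qed.

(** In an abstract measurable space [{x0}] need not be measurable; the level set of [m] through [x0]
    is, and it suffices. *)
Lemma ae_start : {ae L, forall w, m (w 0%N) = m x0}.
Proof.
have mB : measurable (m @^-1` [set m x0]).
  by case: bm => mm _ _ _; rewrite -[X in measurable X]setTI; exact: mm.
have := hL.1 _ mB; rewrite diracE mem_set// => L1.
exists (~` [set w : trajectory S | (m @^-1` [set m x0]) (w 0%N)]); split => //.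
  apply: measurableC; rewrite -[X in measurable X]setTI.
  exact: (measurable_coord 0 measurableT mB).
rewrite probability_setC; first by rewrite L1 subee.
rewrite -[X in measurable X]setTI; exact: (measurable_coord 0 measurableT mB).
Qed.

Let bad (z : S * S) : R :=
  alive R K z.1 * \1_((fun z => s z.1 z.2 + nu z.2) @^-1` `]-oo, 0]) z.

Let weight_bad : weight bad.
Proof.
split; last by move=> z; rewrite mulr_ge0// ?alive_ge0// indicE.
apply: measurable_funM; first exact: (weight_alive1 R mK).1.
apply: measurable_indic; rewrite -[X in measurable X]setTI.
have mf : measurable_fun setT (fun z : S * S => s z.1 z.2 + nu z.2).
  apply: measurable_funD => //; case: bnu => mnu _ _ _.
  exact: (measurableT_comp mnu measurable_snd).
exact: (mf measurableT _ (measurable_itv _)).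
Qed.

Let dens_bad z : dens nu z * bad z = 0.
Proof.
case: z => a b; rewrite /bad /=; have [Ka|nKa] := pselect (K a).
  by rewrite alive0// mul0r mulr0.
rewrite indicE; case: (boolP (_ \in _)); last by rewrite !mulr0.
rewrite inE /= in_itv /= => sn; rewrite dens_alive//.
have -> : s a b + nu b = 0 by apply/eqP; rewrite eq_le sn addr_ge0.
by rewrite !mul0r.
Qed.

Lemma kops0 (v : nat -> S * S -> R) n : kops P v n (fun=> 0%E) = (fun=> 0%E).
Proof.
elim: n => //= n ih; rewrite -[RHS]ih; congr (kops _ _ _ _).
by apply/funext => y; apply: integral0_eq => z _; rewrite mule0.
Qed.

(** Transitions off [K] with [s + nu = 0] carry density 0, so the path expectation of their
    indicator vanishes. *)
Lemma ae_good : {ae L, forall w, forall k, ~ K (w k) ->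
   0 < s (w k) (w k.+1) + nu (w k.+1)}.
Proof.
apply: ae_foralln => k.
pose u j := if (j < k)%N then (fun _ : S * S => 1 : R) else bad.
have wu j : weight (u j) by rewrite /u; case: ifP.
have mjj i : measurable_fun setT (fun w : trajectory S => (w i, w i.+1)).
  by apply: measurable_fun_pair; exact: measurable_coord.
have mb : measurable_fun setT (fun w : trajectory S => (bad (w k, w k.+1))%:E).
  by apply/measurable_EFinP; exact: (measurableT_comp weight_bad.1 (mjj k)).
have wd := weight_dens mK ms mbeta s_ge0 beta_gt0 PP_law sM0 bM0 s_le beta_le bm muE AE bnu nu_gt0.
have := path_expectation wd.1 wd.2 lawd k.+1 (fun j => (wu j).1) (fun j => (wu j).2)
  (nneg_cst S ler01).
rewrite /= /u ltnn (_ : (fun z => dens nu z * bad z) = fun=> 0); last first.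
  by apply/funext => z; exact: dens_bad.
rewrite (_ : kop P (fun=> 0) (fun=> 1%:E) = fun=> 0%E); last first.
  by apply/funext => y; exact: kop_dead.
rewrite kops0 => H.
have : (\int[L]_w `|(bad (w k, w k.+1))%:E| = 0)%E.
  rewrite -[RHS]H; apply: eq_integral => w _.
  rewrite mule1 big_ord_recr /= ltnn big1; last by move=> j _; rewrite ltn_ord.
  by rewrite mul1r ger0_norm//; exact: weight_bad.2.
move=> /(ae_eq_integral_abs _ measurableT mb).1; apply: filterS => w /(_ I) [].
rewrite /bad /= => b0 nK; rewrite ltNge; apply/negP => sn.
by move: b0; rewrite alive1// mul1r indicE mem_set ?oner_eq0//= ?in_itv//= => /eqP; rewrite oner_eq0.
Qed.

Definition moment_const : R :=
  ((G0 / eps + bM) * (N / eps)) ^+ 2 * (2 / (rho - 1) + 1).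

Lemma path_sq_le (w : trajectory S) : (exists t, K (w t)) -> m (w 0%N) = m x0 ->
  (forall k, ~ K (w k) -> 0 < s (w k) (w k.+1) + nu (w k.+1)) ->
  Ynu P K s beta PP nu w \is a fin_num /\
  (((fine (Ynu P K s beta PP nu w) - m x0) ^+ 2)%:E <=
    (moment_const * V ^+ 2)%:E * F w)%E.
Proof.
move=> [t Kt] mw good.
have dead i : (t <= i)%N -> term K s (isw nu) i w = 0.
  move=> ti; apply: term_dead; apply/negP => /le_tauP/(_ t); rewrite ltnS => /(_ ti).
  exact.
have YE : Ynu P K s beta PP nu w = (\sum_(i < t.+1) term K s (isw nu) i w)%:E.
  rewrite Yterms (nneseries_split _ t.+1); last first.
    by move=> k _; exact: (nneg_term mK ms s_ge0 wisw k).2.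
  rewrite add0n [X in (_ + X)%E]eseries0; last by move=> i ti _; rewrite dead// ltnW.
  by rewrite adde0 sumEFin big_mkord.
split; first by rewrite YE.
rewrite YE /=.
(* After the visit to [K] the weight is 0, so the telescoped expression is the full score minus the
   target value. *)
have W0 : \prod_(j < t.+1) step K (isw nu) (w j, w j.+1) = 0.
  by rewrite big_ord_recr /= /step /= (alive0 R Kt) !mul0r mulr0.
have gm y : ~ K y -> `|gR nu y - m y| <= bM * V.
  move=> nK; have mg := value_gR mK ms mbeta s_ge0 beta_gt0 PP_law sM0 bM0 s_le beta_le bm muE y.
  have bN : bounded_weight K nu (Num.max N M) by case: bnu => ? ? ? h; split=> // z; rewrite le_max h.
  have bM' : bounded_weight K m (Num.max N M) by case: bm => ? ? ? h; split=> // z; rewrite le_max h orbT.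
  rewrite mg ler_distlC; apply/andP; split.
    rewrite lerBlDr; apply: (gR_lip P mK s mbeta beta_gt0 bM0 beta_le y bN bM' V0).
    by move=> z; have := num z; rewrite ler_norml => /andP[_]; lra.
  apply: (gR_lip P mK s mbeta beta_gt0 bM0 beta_le y bM' bN V0).
  by move=> z; have := num z; rewrite ler_norml => /andP[+ _]; lra.
(* [g <= m + bM V <= nu + (bM + 1) V <= nu + (rho - 1) eps <= rho nu]. *)
have g_nu y : ~ K y -> gR nu y <= rho * nu y.
  move=> nK; have := gm _ nK; have := num y; rewrite !ler_norml => /andP[h1 h2] /andP[h3 h4].
  have := nu_eps nK; have := hV; have := rho1; nra.
have nuN y : nu y <= N by case: bnu.
have mdead y : K y -> m y = 0 by case: bm => _ _ h _; exact: h.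
have := path_telescope s_ge0 mdead nu_dead nu_ge0 nu_eps nuN eps0 V0 bM0 num gm gR0 gR_G0 g_nu
  rho1 good t.+1.
rewrite W0 mul0r addr0 mw => H.
set a := \sum_(i < t.+1) _ - m x0.
have c0' : 0 <= (G0 / eps + bM) * (N / eps).
  have N0 : 0 <= N := le_trans (nu_ge0 x0) (nuN x0).
  by rewrite mulr_ge0// ?addr_ge0// divr_ge0// ltW.
have := surv_sq K rho1 w t.+1; set Sg := \sum_(k < t.+1) _ => Sg2.
apply: (@le_trans _ _ (moment_const * V ^+ 2 * \sum_(k < t.+1) (rho ^+ 2) ^+ k * (surv R K) k w)%:E).
  rewrite lee_fin -(real_normK (num_real a)).
  apply: (@le_trans _ _ (((G0 / eps + bM) * (N / eps) * V * Sg) ^+ 2)).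
    by rewrite ler_sqr ?nnegrE// (le_trans _ H).
  set X := \sum_(k < t.+1) _.
  have -> : moment_const * V ^+ 2 * X =
    ((G0 / eps + bM) * (N / eps) * V) ^+ 2 * ((2 / (rho - 1) + 1) * X).
    by rewrite /moment_const; ring.
  rewrite exprMn; apply: ler_wpM2l; first exact: sqr_ge0.
  exact: Sg2.
rewrite EFinM; apply: lee_wpmul2l.
  rewrite lee_fin mulr_ge0 ?sqr_ge0// mulr_ge0 ?sqr_ge0// addr_ge0// divr_ge0//.
  by rewrite subr_ge0 ltW.
rewrite -sumEFin -[leLHS](big_mkord xpredT (fun k => ((rho ^+ 2) ^+ k * (surv R K) k w)%:E)).
by apply: nneseries_lim_ge => j _ _; exact: (nneg_surv j).2.
Qed.

Lemma near_second_moment :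
  (\int[L]_w ((fine (Ynu P K s beta PP nu w) - m x0) ^+ 2)%:E <=
   (moment_const * C * V ^+ 2)%:E)%E.
Proof.
have cV0 : 0 <= moment_const * V ^+ 2.
  rewrite mulr_ge0 ?sqr_ge0// mulr_ge0 ?sqr_ge0// addr_ge0// divr_ge0//.
  by rewrite subr_ge0 ltW.
apply: (@le_trans _ _ (\int[L]_w ((moment_const * V ^+ 2)%:E * F w))%E).
  apply: ae_ge0_le_integral => //.
  - by move=> w _; rewrite lee_fin sqr_ge0.
  - apply/measurable_EFinP; apply: measurable_funX; apply: measurable_funB => //.
    by apply: measurableT_comp => //; exact: nnegY.1.
  - by move=> w _; rewrite mule_ge0 ?lee_fin//; exact: nneg_F.2.
  - by apply: emeasurable_funM => //; exact: nneg_F.1.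
  - have FF : Filter (almost_everywhere L) := ae_filter_ringOfSetsType L.
    apply: filterS (filterI ae_hit (filterI ae_start ae_good)) => w [h1 [h2 h3]] _.
    exact: (path_sq_le h1 h2 h3).2.
rewrite ge0_integralZl_EFin//; [|by move=> w _; exact: nneg_F.2|exact: nneg_F.1].
have -> : moment_const * C * V ^+ 2 = moment_const * V ^+ 2 * C by ring.
rewrite [leRHS]EFinM; apply: lee_wpmul2l; last exact: integral_F_le.
by rewrite lee_fin.
Qed.

End importance_moments.

(** * Measurable dependence on the estimate *)

Section parametric_law.
Context (R : realType) d (S : measurableType d) (P : R.-pker S ~> S).

Definition all_rectangles : set (set (nat -> S)) :=
  [set E | exists n, rectangles n E].

Lemma all_rectanglesI : setI_closed all_rectangles.
Proof.
move=> _ _ [n [C [mC ->]]] [n' [C' [mC' ->]]].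
exists (maxn n n'), (fun i => (if (i <= n)%N then C i else setT) `&`
  (if (i <= n')%N then C' i else setT)); split.
  by move=> i; apply: measurableI; case: ifP.
apply/seteqP; split=> w /=.
  by move=> [h h'] i _; split; case: ifP => // ?; [exact: h|exact: h'].
move=> h; split=> i i_n; have := h i; rewrite leq_max i_n ?orbT /=;
  by move=> /(_ isT)[].
Qed.

Lemma measurable_all_rectangles :
  @measurable _ (trajectory S) = <<s all_rectangles >>.
Proof.
apply/seteqP; split.
  apply: smallest_sub; first exact: smallest_sigma_algebra.
  move=> _ [n [B [mB ->]]]; apply: sub_sigma_algebra.
  exists n, (fun i => if i == n then B else setT); split; first by move=> i; case: ifP.
  apply/seteqP; split=> w /=; first by move=> Bw i _; case: eqP => // ->.
  by move=> /(_ n (leqnn n)); rewrite eqxx.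
apply: smallest_sub; first exact: sigma_algebra_measurable.
by move=> E [n]; exact: measurable_rectangle.
Qed.

Context d' (X : measurableType d').
Variables (q : X * (S * S) -> R) (mq : measurable_fun setT q) (q0 : forall z, 0 <= q z).

Lemma nneg_measurable_kops_param (u : nat -> S * S -> R) n (F : X * S -> \bar R) :
  (forall j, weight (u j)) -> nneg_measurable F ->
  nneg_measurable (fun z : X * S =>
    kops P (fun j y => q (z.1, y) * u j y) n (fun y => F (z.1, y)) z.2).
Proof.
move=> wu; elim: n F => [|n ih] F hF /=.
  by rewrite (_ : (fun z => _) = F)//; apply/funext => -[].
apply: (ih (fun z => kop P (fun y => q (z.1, y) * u n y) (fun y => F (z.1, y)) z.2)).
pose G (z : (X * S) * S) := ((q (z.1.1, (z.1.2, z.2)) * u n (z.1.2, z.2))%:E * F (z.1.1, z.2))%E.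
have m12 : measurable_fun setT (fun z : (X * S) * S => (z.1.2, z.2)).
  by apply: measurable_fun_pair => //; exact: (measurableT_comp measurable_snd).
have m11 : measurable_fun setT (fun z : (X * S) * S => z.1.1).
  exact: (measurableT_comp measurable_fst).
have hG : nneg_measurable G.
  apply: nneg_measurable_mul.
  - apply: measurable_funM; last exact: (measurableT_comp (wu n).1 m12).
    exact: (measurableT_comp mq (measurable_fun_pair m11 m12)).
  - by move=> z; rewrite mulr_ge0//; exact: (wu n).2.
  - exact: (nneg_measurable_comp (measurable_fun_pair m11 measurable_snd) hF).
have := nneg_measurable_kernel (kpull P (@measurable_snd _ _ X S)) hG.
by apply.
Qed.

Variables (x : S) (LL : X -> probability (trajectory S) R).
Hypothesis hLL : forall t,
  markov_law (fun z B => \int[P z]_(y in B) (q (t, (z, y)))%:E)%E x (LL t).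

(** On a rectangle the law is an iterated kernel integral depending measurably on the parameter;
    Dynkin's theorem extends this to all events. *)
Lemma measurable_law C : measurable C -> measurable_fun setT (fun t => LL t C).
Proof.
move=> mC; have mC' := mC; rewrite measurable_all_rectangles in mC'.
apply: (dynkin_induction (P := fun C => measurable_fun setT (fun t => LL t C))
  measurable_all_rectangles all_rectanglesI _ _ _ _ mC').
- rewrite (_ : (fun t => _) = cst 1%E)//.
  by apply/funext => t; rewrite probability_setT.
- move=> _ [n [E [mE ->]]].
  pose u j (z : S * S) : R := \1_(E j) z.1.
  have wu j : weight (u j).
    split=> [|z]; last by rewrite /u indicE.
    have mi : measurable_fun setT (\1_(E j) : S -> R) by exact: measurable_indic.
    exact: (measurableT_comp mi (@measurable_fst _ _ S S)).
  have hf := nneg_measurable_indic R (mE n).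
  have hE : rectangles n [set w | forall i, (i <= n)%N -> E i (w i)] by exists E.
  rewrite (_ : (fun t => _) = fun t =>
      kops P (fun j y => q (t, y) * u j y) n (EFin \o \1_(E n)) x).
    have hF := nneg_measurable_comp (@measurable_snd _ _ X S) hf.
    have [h _] := nneg_measurable_kops_param n wu hF.
    exact: (measurableT_comp h (measurable_fun_pair (@measurable_id _ _ _) (measurable_cst x))).
  apply/funext => t.
  have mqt : measurable_fun setT (fun z => q (t, z)).
    exact: (measurableT_comp mq (@pair1_measurable _ _ _ _ t)).
  rewrite -(path_expectation mqt (fun z => q0 _) (hLL t) n (fun j => (wu j).1)
    (fun j => (wu j).2) hf).
  rewrite -[X in LL t X]setIT -integral_indic//; last exact: measurable_rectangle hE.
  apply: eq_integral => w _; rewrite -EFinM; congr EFin.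
  have -> : \1_[set w0 | forall i, (i <= n)%N -> E i (w0 i)] w =
      \prod_(j < n.+1) \1_(E j) (w j) :> R.
    have [h|h] := pselect (forall i, (i <= n)%N -> E i (w i)).
      rewrite indicE mem_set// big1// => j _; rewrite indicE mem_set//; apply: h.
      by rewrite -ltnS.
    rewrite indicE memNset//.
    have [i i_n nE] : exists2 i, (i <= n)%N & ~ E i (w i).
      by apply: contrapT => h'; apply: h => i i_n; apply: contrapT => nE; apply: h'; exists i.
    rewrite -ltnS in i_n.
    by rewrite (bigD1 (Ordinal i_n))//= indicE memNset// mul0r.
  by rewrite big_ord_recr.
- move=> E mE h; rewrite (_ : (fun t => _) = fun t => 1 - LL t E)%E.
    exact: emeasurable_funB.
  by apply/funext => t; rewrite probability_setC.
- move=> F mF tF h; rewrite (_ : (fun t => _) = fun t => (\sum_(0 <= k <oo) LL t (F k))%E).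
    by apply: ge0_emeasurable_sum.
  by apply/funext => t; rewrite measure_semi_bigcup//; exact: bigcup_measurable.
Qed.

End parametric_law.

(** * Joint measurability of a Lipschitz family *)

Section caratheodory.
Context (R : realType) d d' (X : measurableType d) (S : measurableType d') (n : nat).
Variables (y : X -> 'rV[R]_n) (F : 'rV[R]_n -> S -> R) (C : R).
Hypotheses (my : forall i, measurable_fun setT (fun t => y t ord0 i))
  (y_ge0 : forall t i, 0 <= y t ord0 i)
  (mF : forall v : 'rV[R]_n, (forall i, 0 <= v ord0 i) -> measurable_fun setT (F v))
  (lipF : forall v v' : 'rV[R]_n, (forall i, 0 <= v ord0 i) -> (forall i, 0 <= v' ord0 i) ->
    forall x, `|F v x - F v' x| <= C * `|v - v'|).

Let cell k (t : X) : {ffun 'I_n -> nat} := [ffun i => Num.truncn (k.+1%:R * y t ord0 i)].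
Let node k (c : {ffun 'I_n -> nat}) : 'rV[R]_n := \row_i ((c i)%:R / k.+1%:R).

Let node_ge0 k c i : 0 <= node k c ord0 i.
Proof. by rewrite mxE divr_ge0. Qed.

Let measurable_cell k c : measurable [set t | cell k t = c].
Proof.
rewrite (_ : [set t | _] = \bigcap_(i in [set: 'I_n])
  ((fun t => k.+1%:R * y t ord0 i) @^-1` `[(c i)%:R, (c i).+1%:R[)).
  apply: fin_bigcap_measurable => // i _; rewrite -[X in measurable X]setTI.
  by apply: (measurable_funM (measurable_cst _) (my i)) => //; exact: measurable_itv.
have h t i : 0 <= k.+1%:R * y t ord0 i by rewrite mulr_ge0.
apply/seteqP; split => t /=.
  by move=> <- i _; rewrite /= in_itv /= ffunE -truncn_eq.
move=> ht; apply/ffunP => i; have := ht i I; rewrite /= in_itv /= ffunE -truncn_eq//.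
by move/eqP.
Qed.

Let measurable_grid k : measurable_fun setT (fun z : X * S => F (node k (cell k z.1)) z.2).
Proof.
move=> _ B mB; rewrite setTI.
rewrite (_ : _ @^-1` _ = \bigcup_j (if unpickle j is Some c then
   [set t | cell k t = c] `*` (F (node k c) @^-1` B) else set0)).
  apply: bigcupT_measurable => j; case: unpickle => // c.
  apply: measurableX => //; rewrite -[X in measurable X]setTI.
  by apply: mF => //; exact: node_ge0.
apply/seteqP; split => -[t x] /=.
  by move=> h; exists (pickle (cell k t)) => //; rewrite pickleK.
by move=> [j _]; case: unpickle => // c /= -[<-].
Qed.

Let node_near k t : `|y t - node k (cell k t)| <= k.+1%:R^-1.
Proof.
rewrite /Num.Def.normr/= mx_normrE bigmax_le//= => -[i j] _ /=.
rewrite ord1 !mxE ffunE.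
have h : 0 <= k.+1%:R * y t ord0 j by rewrite mulr_ge0.
have k0 : 0 < k.+1%:R :> R by [].
have /andP[h1 h2] := truncn_itv h.
rewrite ler_norml; apply/andP; split.
  apply: (@le_trans _ _ 0); first by rewrite oppr_le0 invr_ge0.
  by rewrite subr_ge0 ler_pdivrMr// [X in _ <= X]mulrC.
rewrite lerBlDr -[X in _ <= X + _]mul1r -mulrDl ler_pdivlMr//.
by rewrite [leLHS]mulrC addrC natr1 ltW.
Qed.

(** The parameter is rounded down to a grid of mesh [1/(k+1)]. At each level only countably many
    grid points occur, and the Lipschitz bound gives pointwise convergence. *)
Lemma measurable_caratheodory : measurable_fun setT (fun z : X * S => F (y z.1) z.2).
Proof.
apply: (measurable_fun_cvg (fun k => measurable_grid k)) => -[t x] _ /=.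
apply/cvgrPdist_le => e e0; exists (Num.truncn (`|C| / e)) => // k /= Nk.
apply: le_trans (lipF (y_ge0 t) (node_ge0 k (cell k t)) x) _.
apply: (@le_trans _ _ (`|C| * k.+1%:R^-1)).
  apply: (@le_trans _ _ (`|C| * `|y t - node k (cell k t)|)).
    by apply: ler_wpM2r => //; exact: ler_norm.
  by apply: ler_wpM2l.
rewrite ler_pdivrMr// mulrC -ler_pdivrMr//; apply: ltW.
apply: (lt_le_trans (truncnS_gt _)); by rewrite ler_nat.
Qed.

End caratheodory.

(** * Sample means within one stage *)

Section probability_family.
Context (R : realType) d1 d2 (X : measurableType d1) (Y : measurableType d2)
  (k : X -> probability Y R)
  (mk : forall C, measurable C -> measurable_fun setT (fun t => k t C)).

Definition kfam of (forall C, measurable C -> measurable_fun setT (fun t => k t C)) :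
  X -> {measure set Y -> \bar R} := fun t => k t.

HB.instance Definition _ := isKernel.Build _ _ _ _ _ (kfam mk) mk.

Let kfam_prob t : kfam mk t setT = 1%E.
Proof. exact: probability_setT. Qed.

HB.instance Definition _ :=
  Kernel_isProbability.Build _ _ _ _ _ (kfam mk) kfam_prob.

End probability_family.

Section stage.
Context (R : realType) d0 d1 d2 (W : measurableType d0) (X : measurableType d1)
  (T : measurableType d2) (Pr : probability W R) (a : W -> X)
  (ma : measurable_fun setT a).
Variables (I J : finType) (k : I -> X -> probability T R)
  (mk : forall i C, measurable C -> measurable_fun setT (fun t => k i t C))
  (sim : I -> J -> W -> T) (msim : forall i j, measurable_fun setT (sim i j)).
Hypothesis joint : forall (E : set X) (C : I -> J -> set T), measurable E ->
  (forall i j, measurable (C i j)) ->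
  Pr (a @^-1` E `&` [set w | forall i j, C i j (sim i j w)]) =
  (\int[Pr]_(w in a @^-1` E) \prod_(i : I) \prod_(j : J) k i (a w) (C i j))%E.

Let pi_X : @measurable _ X = <<s @measurable _ X >>.
Proof. by apply/esym/(@sigma_algebra_id _ setT); exact: sigma_algebra_measurable. Qed.

Lemma stage_joint1 i j E C : measurable E -> measurable C ->
  (Pr (a @^-1` E `&` sim i j @^-1` C) = \int[Pr]_(w in a @^-1` E) k i (a w) C)%E.
Proof.
move=> mE mC; pose C' i' j' := if (i' == i) && (j' == j) then C else setT.
have mC' i' j' : measurable (C' i' j') by rewrite /C'; case: ifP.
have -> : sim i j @^-1` C = [set w | forall i' j', C' i' j' (sim i' j' w)].
  apply/seteqP; split=> w /= h.
    by move=> i' j'; rewrite /C'; case: ifP => // /andP[/eqP -> /eqP ->].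
  by have := h i j; rewrite /C' !eqxx.
rewrite joint//; apply: eq_integral => w _.
rewrite (bigD1 i)//= (bigD1 j)//= {1}/C' !eqxx /= big1 ?mule1; last first.
  by move=> j' jj'; rewrite /C' (negbTE jj') andbF probability_setT.
rewrite big1 ?mule1// => i' ii'; apply: big1 => j' _.
by rewrite /C' (negbTE ii') probability_setT.
Qed.

Lemma stage_joint2 i j j' E C C' : j != j' -> measurable E -> measurable C -> measurable C' ->
  (Pr (a @^-1` E `&` sim i j @^-1` C `&` sim i j' @^-1` C') =
   \int[Pr]_(w in a @^-1` E) (k i (a w) C * k i (a w) C'))%E.
Proof.
move=> jj mE mC mC'.
pose D i1 j1 := if i1 == i then (if j1 == j then C else if j1 == j' then C' else setT) else setT.
have mD i1 j1 : measurable (D i1 j1) by rewrite /D; do ![case: ifP => // _].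
have -> : a @^-1` E `&` sim i j @^-1` C `&` sim i j' @^-1` C' =
    a @^-1` E `&` [set w | forall i1 j1, D i1 j1 (sim i1 j1 w)].
  apply/seteqP; split=> w /= [].
    move=> [Ew Cw] C'w; split=> // i1 j1; rewrite /D; case: eqP => // ->.
    by case: eqP => [->//|_]; case: eqP => [->|].
  move=> Ew h; have := h i j; have := h i j'.
  by rewrite /D !eqxx eq_sym (negbTE jj).
rewrite joint//; apply: eq_integral => w _.
rewrite (bigD1 i)//= (bigD1 j)//= (bigD1 j')/=; last by rewrite eq_sym.
rewrite /D !eqxx eq_sym (negbTE jj) [X in (X * _)%E]muleA.
rewrite big1 ?mule1; last first.
  move=> j1 /andP[/negbTE -> /negbTE ->]; exact: probability_setT.
rewrite big1 ?mule1// => i1 /negbTE ii; apply: big1 => j1 _.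
by rewrite ii probability_setT.
Qed.

Lemma stage_expectation i j (F : X * T -> \bar R) : nneg_measurable F ->
  (\int[Pr]_w F (a w, sim i j w) = \int[Pr]_w \int[k i (a w)]_y F (a w, y))%E.
Proof.
move=> hF.
rewrite (@disintegration R _ _ _ _ _ _ Pr a (sim i j) ma (msim i j) measurable
   pi_X (@measurableI _ _) measurableT (kfam (mk i)) (fun=> 1) _ _ _ F hF) => //.
  by apply: eq_integral => w _; under eq_integral do rewrite mul1e.
move=> E C mE mC; rewrite stage_joint1//; apply: eq_integral => w _.
by rewrite integral_cst// mul1e.
Qed.

(** The trajectory [j] is added to the past; given both, trajectory [j'] still has the law
    prescribed by the estimate alone, so [disintegration] applies once more. *)
Lemma stage_expectation2 i j j' (F F' : X * T -> \bar R) : j != j' ->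
  nneg_measurable F -> nneg_measurable F' ->
  (\int[Pr]_w (F (a w, sim i j w) * F' (a w, sim i j' w)) =
   \int[Pr]_w ((\int[k i (a w)]_y F (a w, y)) * (\int[k i (a w)]_y F' (a w, y))))%E.
Proof.
move=> jj hF hF'.
pose G := [set E `*` C | E in @measurable _ X & C in @measurable _ T].
have mG : @measurable _ (X * T)%type = <<s G >> by exact: measurable_prod_measurableType.
have GI : setI_closed G.
  move=> _ _ [A1 mA1 [B1 mB1 <-]] [A2 mA2 [B2 mB2 <-]].
  exists (A1 `&` A2); first exact: measurableI.
  by exists (B1 `&` B2); [exact: measurableI|rewrite setXI].
have GT : G setT by exists setT => //; exists setT => //; rewrite setXTT.
have mas := measurable_fun_pair ma (msim i j).
pose H (z : (X * T) * T) : \bar R := (F z.1 * F' (z.1.1, z.2))%E.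
have m12 : measurable_fun setT (fun z : (X * T) * T => (z.1.1, z.2)).
  by apply: measurable_fun_pair => //; exact: (measurableT_comp measurable_fst).
have hH : nneg_measurable H.
  have h1 := nneg_measurable_comp (@measurable_fst _ _ (X * T)%type T) hF.
  have h2 := nneg_measurable_comp m12 hF'.
  by split; [exact: emeasurable_funM h1.1 h2.1|move=> z; exact: mule_ge0 (h1.2 z) (h2.2 z)].
have mF'x x : measurable_fun setT (fun y => F' (x, y)).
  exact: (measurableT_comp hF'.1 (@pair1_measurable _ _ _ _ x)).
have mFx x : measurable_fun setT (fun y => F (x, y)).
  exact: (measurableT_comp hF.1 (@pair1_measurable _ _ _ _ x)).
transitivity (\int[Pr]_w H ((a w, sim i j w), sim i j' w))%E; first by [].
rewrite (@disintegration R _ _ _ _ _ _ Pr (fun w => (a w, sim i j w)) (sim i j') mas (msim i j') G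
   mG GI GT (kpull (kfam (mk i)) (@measurable_fst _ _ X T)) (fun=> 1) _ _ _ H hH) => //; last first.
  move=> _ C' [E mE [C mC <-]] mC'.
  have -> : (fun w => (a w, sim i j w)) @^-1` (E `*` C) `&` sim i j' @^-1` C' =
    a @^-1` E `&` sim i j @^-1` C `&` sim i j' @^-1` C' by [].
  rewrite stage_joint2//.
  pose F2 (z : X * T) : \bar R := ((\1_E z.1 * \1_C z.2)%:E * k i z.1 C')%E.
  have hF2 : nneg_measurable F2.
    apply: nneg_measurable_mul.
    - by apply: measurable_funM; apply: measurableT_comp => //; exact: measurable_indic.
    - by move=> z; rewrite !indicE mulr_ge0.
    - by split=> //; exact: (measurableT_comp (mk i mC') measurable_fst).
  transitivity (\int[Pr]_w F2 (a w, sim i j w))%E; last first.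
    rewrite [RHS]integral_indicM; apply: eq_integral => w _.
    rewrite /F2 /= integral_cst// mul1e; congr (_%:E * _)%E.
    rewrite !indicE -natrM mulnb; congr ((_ : bool)%:R).
    apply/andP/idP => [[/set_mem h1 /set_mem h2]|/set_mem[/= h1 h2]]; first exact/mem_set.
    by split; apply/mem_set.
  rewrite [RHS]stage_expectation// [LHS]integral_indicM; apply: eq_integral => w _.
  rewrite /F2 /= -[X in (_ * (X * _))%E](_ : \int[k i (a w)]_y (\1_C y)%:E = _)%E; last first.
    by rewrite integral_indic// setIT.
  have m1C : measurable_fun setT (fun y => (\1_C y : R)%:E).
    by apply/measurable_EFinP; exact: measurable_indic.
  rewrite -ge0_integralZr//.
  rewrite -ge0_integralZl//; [|exact: emeasurable_funM|by move=> y _; rewrite mule_ge0].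
  by apply: eq_integral => y _; rewrite EFinM muleA.
transitivity (\int[Pr]_w (fun z : X * T => F z * \int[k i z.1]_y F' (z.1, y))%E (a w, sim i j w))%E.
  apply: eq_integral => w _ /=; under eq_integral do rewrite mul1e.
  rewrite /H /= ge0_integralZl//; [by move=> y _; exact: hF'.2|exact: hF.2].
rewrite (stage_expectation i j (F := (fun z : X * T => F z * \int[k i z.1]_y F' (z.1, y))%E)).
  apply: eq_integral => w _ /=.
  rewrite ge0_integralZr//; first by move=> y _; exact: hF.2.
  by apply: integral_ge0 => y _; exact: hF'.2.
have [h1 h2] := nneg_measurable_kernel (kfam (mk i)) hF'.
split; last by move=> z; apply: mule_ge0; [exact: hF.2|exact: h2].
by apply: emeasurable_funM; [exact: hF.1|exact: (measurableT_comp h1 measurable_fst)].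
Qed.

End stage.

Section real_integrals.
Context (R : realType) d (Z : measurableType d) (m : {measure set Z -> \bar R})
  (D : set Z) (mD : measurable D).
Implicit Types F G : Z -> R.

Lemma integralD_real F G : measurable_fun D F -> measurable_fun D G ->
  (forall w, 0 <= F w) -> (forall w, 0 <= G w) ->
  (\int[m]_(w in D) (F w + G w)%:E =
   \int[m]_(w in D) (F w)%:E + \int[m]_(w in D) (G w)%:E)%E.
Proof.
move=> mF mG F0 G0; under eq_integral do rewrite EFinD.
by apply: ge0_integralD => //;
  solve [exact/measurable_EFinP | move=> w _; rewrite lee_fin; auto].
Qed.

Lemma integralZ_real (r : R) F : 0 <= r -> measurable_fun D F ->
  (forall w, 0 <= F w) ->
  (\int[m]_(w in D) (r * F w)%:E = r%:E * \int[m]_(w in D) (F w)%:E)%E.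
Proof.
move=> r0 mF F0; under eq_integral do rewrite EFinM.
by apply: ge0_integralZl_EFin => //;
  solve [exact/measurable_EFinP | move=> w _; rewrite lee_fin; auto].
Qed.

Lemma integral_sum_real (I : finType) (F : I -> Z -> R) :
  (forall i, measurable_fun D (F i)) -> (forall i w, 0 <= F i w) ->
  (\int[m]_(w in D) (\sum_i F i w)%:E = \sum_i \int[m]_(w in D) (F i w)%:E)%E.
Proof.
move=> mF F0; under eq_integral do rewrite -sumEFin.
by apply: ge0_integral_sum => //;
  solve [move=> i; exact/measurable_EFinP | move=> i w _; rewrite lee_fin; auto].
Qed.

Lemma le_integral_real F G : measurable_fun D F -> measurable_fun D G ->
  (forall w, 0 <= F w) -> (forall w, D w -> F w <= G w) ->
  (\int[m]_(w in D) (F w)%:E <= \int[m]_(w in D) (G w)%:E)%E.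
Proof.
move=> mF mG F0 FG; by apply: ge0_le_integral => //;
  solve [exact/measurable_EFinP | move=> w Dw; rewrite lee_fin; auto].
Qed.

End real_integrals.

Section sample_mean_variance.
Context (R : realType) d0 d1 d2 (W : measurableType d0) (X : measurableType d1)
  (T : measurableType d2) (Pr : probability W R) (a : W -> X)
  (ma : measurable_fun setT a).
Variables (I J : finType) (k : I -> X -> probability T R)
  (mk : forall i C, measurable C -> measurable_fun setT (fun t => k i t C))
  (sim : I -> J -> W -> T) (msim : forall i j, measurable_fun setT (sim i j)).
Hypothesis joint : forall (E : set X) (C : I -> J -> set T), measurable E ->
  (forall i j, measurable (C i j)) ->
  Pr (a @^-1` E `&` [set w | forall i j, C i j (sim i j w)]) =
  (\int[Pr]_(w in a @^-1` E) \prod_(i : I) \prod_(j : J) k i (a w) (C i j))%E.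

Let stageE := stage_expectation ma mk msim joint.
Let stageE2 := stage_expectation2 ma mk msim joint.

Variables (E : set X) (mE : measurable E).
Let D := a @^-1` E.
Let mD : measurable D.
Proof. by rewrite -[X in measurable X]setTI; exact: ma. Qed.

Lemma stage_expectation_on i j (F : X * T -> \bar R) : nneg_measurable F ->
  (\int[Pr]_(w in D) F (a w, sim i j w) =
   \int[Pr]_(w in D) \int[k i (a w)]_y F (a w, y))%E.
Proof.
move=> hF.
have hG : nneg_measurable (fun z : X * T => (\1_E z.1)%:E * F z)%E.
  apply: nneg_measurable_mul => //.
  by apply: (measurableT_comp _ measurable_fst); exact: measurable_indic.
rewrite [LHS]integral_indicM [RHS]integral_indicM.
rewrite (stageE i j hG); apply: eq_integral => w _ /=.
rewrite ge0_integralZl_EFin//.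
- by move=> y _; exact: hF.2.
- exact: (measurableT_comp hF.1 (@pair1_measurable _ _ _ _ (a w))).
Qed.

Variables (i : I) (f : X * T -> R) (mu0 : R).
Hypotheses (mf : measurable_fun setT f) (f_ge0 : forall z, 0 <= f z) (mu0_ge0 : 0 <= mu0).
Hypothesis f_mean : forall x, E x -> (\int[k i x]_y (f (x, y))%:E = mu0%:E)%E.

Let fj j w := f (a w, sim i j w).
Let p : R := fine (Pr D).
Let pE : Pr D = p%:E.
Proof. by rewrite fineK// fin_num_measure. Qed.

Let cstD (r : R) : (\int[Pr]_(w in D) r%:E = (r * p)%:E)%E.
Proof. by rewrite (integral_cst _ mD) EFinM; congr (_ * _)%E; exact: pE. Qed.

Let mfj j : measurable_fun D (fj j).
Proof.
apply: measurable_funTS.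
exact: (measurableT_comp mf (measurable_fun_pair ma (msim i j))).
Qed.

Let nneg_f : nneg_measurable (EFin \o f).
Proof. by split=> [|z]; [exact/measurable_EFinP|rewrite lee_fin]. Qed.

Lemma mean_on j : (\int[Pr]_(w in D) (fj j w)%:E = (mu0 * p)%:E)%E.
Proof.
rewrite (stage_expectation_on i j nneg_f).
transitivity (\int[Pr]_(w in D) mu0%:E)%E; last by rewrite cstD.
by apply: eq_integral => w /set_mem Dw; exact: f_mean.
Qed.

Lemma cross_on j l : j != l ->
  (\int[Pr]_(w in D) (fj j w * fj l w)%:E = (mu0 ^+ 2 * p)%:E)%E.
Proof.
move=> jl.
have hG : nneg_measurable (fun z : X * T => (\1_E z.1)%:E * (f z)%:E)%E.
  apply: nneg_measurable_mul => //.
  by apply: (measurableT_comp _ measurable_fst); exact: measurable_indic.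
rewrite integral_indicM.
transitivity (\int[Pr]_w (((\1_E (a w))%:E * (fj j w)%:E) * (fj l w)%:E))%E.
  by apply: eq_integral => w _; rewrite EFinM muleA.
rewrite (stageE2 i jl hG nneg_f).
transitivity (\int[Pr]_(w in D) (mu0 ^+ 2)%:E)%E; last by rewrite cstD.
rewrite [RHS]integral_indicM; apply: eq_integral => w _ /=.
rewrite ge0_integralZl_EFin//; last first.
- exact: (measurableT_comp nneg_f.1 (@pair1_measurable _ _ _ _ (a w))).
- by move=> y _; rewrite lee_fin.
rewrite !indicE; have [Ew|nEw] := pselect (E (a w)).
  by rewrite !mem_set// !mul1e !f_mean// expr2 -EFinM.
by rewrite memNset// memNset// !mul0e.
Qed.

Let V := (\int[Pr]_(w in D) \int[k i (a w)]_y (((f (a w, y) - mu0) ^+ 2)%:E))%E.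

Let nneg_sq : nneg_measurable (fun z => ((f z - mu0) ^+ 2)%:E).
Proof.
split; last by move=> z; rewrite lee_fin sqr_ge0.
by apply/measurable_EFinP; apply: measurable_funX; exact: measurable_funB.
Qed.

(** [V] may be infinite and all integrals are of nonnegative functions, so the square is expanded
    without subtraction and the finite term is cancelled at the end. *)
Lemma square_on j : (\int[Pr]_(w in D) (fj j w ^+ 2)%:E = V + (mu0 ^+ 2 * p)%:E)%E.
Proof.
have hV : (\int[Pr]_(w in D) ((fj j w - mu0) ^+ 2)%:E = V)%E.
  exact: (stage_expectation_on i j nneg_sq).
have m1 : measurable_fun D (fun w => (fj j w) ^+ 2) by exact: measurable_funX.
have m2 : measurable_fun D (fun w => (fj j w - mu0) ^+ 2).
  by apply: measurable_funX; exact: measurable_funB.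
have m3 : measurable_fun D (fun w => 2 * mu0 * fj j w) by exact: measurable_funM.
have e : ((\int[Pr]_(w in D) (fj j w ^+ 2)%:E) + (mu0 ^+ 2 * p)%:E =
    V + (2 * mu0 ^+ 2 * p)%:E)%E.
  rewrite -cstD -(integralD_real Pr mD m1 (measurable_cst _) (fun w => sqr_ge0 _) (fun w => sqr_ge0 _)).
  transitivity (\int[Pr]_(w in D) ((fj j w - mu0) ^+ 2 + 2 * mu0 * fj j w)%:E)%E.
    by apply: eq_integral => w _; congr EFin; rewrite /=; ring.
  have c0 : 0 <= 2 * mu0 by rewrite mulr_ge0.
  have h0 w : 0 <= 2 * mu0 * fj j w by apply: mulr_ge0 => //; exact: f_ge0.
  rewrite (integralD_real Pr mD m2 m3 (fun w => sqr_ge0 _) h0).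
  rewrite hV (integralZ_real Pr mD c0 (mfj j) (fun w => f_ge0 _)).
  by rewrite mean_on -EFinM; congr (_ + _%:E)%E; ring.
apply: (@addIe_fin _ (mu0 ^+ 2 * p)%:E) => //.
by rewrite [LHS]addeC e [RHS]addeCA -EFinD; congr (_ + _%:E)%E; ring.
Qed.

Let n : R := #|J|%:R.

(** Off-diagonal products factor by conditional independence, so only the diagonal contributes [V].
    As before, the mixed term is added to both sides rather than subtracted. *)
Lemma sum_square_on :
  (\int[Pr]_(w in D) ((\sum_j fj j w - n * mu0) ^+ 2)%:E = n%:E * V)%E.
Proof.
have n0 : 0 <= n by [].
have mS : measurable_fun D (fun w => \sum_j fj j w) by exact: measurable_sum.
have S0 w : 0 <= \sum_j fj j w by apply: sumr_ge0 => j _; exact: f_ge0.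
have mprod j l : measurable_fun D (fun w => fj j w * fj l w) by exact: measurable_funM.
have p0 j l w : 0 <= fj j w * fj l w by apply: mulr_ge0; exact: f_ge0.
have m1 : measurable_fun D (fun w => (\sum_j fj j w - n * mu0) ^+ 2).
  by apply: measurable_funX; exact: measurable_funB.
have e : (\int[Pr]_(w in D) ((\sum_j fj j w - n * mu0) ^+ 2)%:E +
    (2 * n ^+ 2 * mu0 ^+ 2 * p)%:E = n%:E * V + (2 * n ^+ 2 * mu0 ^+ 2 * p)%:E)%E.
  transitivity (\int[Pr]_(w in D)
      ((\sum_j fj j w - n * mu0) ^+ 2 + 2 * n * mu0 * \sum_j fj j w)%:E)%E.
    have c0 : 0 <= 2 * n * mu0 by rewrite !mulr_ge0.
    have h0 w : 0 <= 2 * n * mu0 * \sum_j fj j w by rewrite mulr_ge0.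
    rewrite (integralD_real Pr mD m1 (measurable_funM (measurable_cst _) mS) (fun w => sqr_ge0 _) h0).
    congr (_ + _)%E; rewrite (integralZ_real Pr mD c0 mS S0).
    rewrite (integral_sum_real Pr mD mfj (fun j w => f_ge0 _)).
    under eq_bigr do rewrite mean_on.
    by rewrite sumEFin -EFinM sumr_const -mulr_natl -/n; congr EFin; ring.
  transitivity (\int[Pr]_(w in D)
      (\sum_j \sum_l (fj j w * fj l w) + n ^+ 2 * mu0 ^+ 2)%:E)%E.
    apply: eq_integral => w _; congr EFin.
    have -> : \sum_j \sum_l fj j w * fj l w = (\sum_j fj j w) ^+ 2.
      by rewrite expr2 mulr_suml; apply: eq_bigr => j _; rewrite mulr_sumr.
    ring.
  have mi j : measurable_fun D (fun w => \sum_l fj j w * fj l w) by exact: measurable_sum.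
  have i0 j w : 0 <= \sum_l fj j w * fj l w by exact: sumr_ge0.
  have h0 (w : W) : 0 <= n ^+ 2 * mu0 ^+ 2 by rewrite mulr_ge0// sqr_ge0.
  rewrite (integralD_real Pr mD (measurable_sum _ mi) (measurable_cst _)
    (fun w => sumr_ge0 _ (fun j _ => i0 j w)) h0).
  rewrite cstD (integral_sum_real Pr mD mi i0).
  have inner j : (\int[Pr]_(w in D) (\sum_l (fj j w * fj l w))%:E =
      V + (n * mu0 ^+ 2 * p)%:E)%E.
    rewrite (integral_sum_real Pr mD (mprod j) (p0 j)) (bigD1 j)//=.
    under eq_integral do rewrite -expr2.
    rewrite square_on (eq_bigr (fun=> (mu0 ^+ 2 * p)%:E)); last first.
      by move=> l lj; rewrite cross_on// eq_sym.
    rewrite sumEFin -addeA -EFinD; congr (_ + _%:E)%E.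
    have -> : n = 1 + #|predC1 j|%:R :> R.
      by rewrite addrC natr1 cardC1 prednK//; apply/card_gt0P; exists j.
    rewrite (_ : \sum_(l | l != j) mu0 ^+ 2 * p = #|predC1 j|%:R * (mu0 ^+ 2 * p)).
      by ring.
    by rewrite sumr_const -[LHS]mulr_natl.
  rewrite (eq_bigr _ (fun j _ => inner j)).
  rewrite big_split/= sumEFin -addeA -EFinD; congr (_ + _%:E)%E.
    transitivity (\sum_(j : J) (1%:E * V))%E; first by apply: eq_bigr => j _; rewrite mul1e.
    by rewrite -ge0_sume_distrl ?sumEFin ?sumr_const// => j _; rewrite lee_fin.
  by rewrite sumr_const -[X in X + _]mulr_natl -/n; ring.
apply: (@addIe_fin _ (2 * n ^+ 2 * mu0 ^+ 2 * p)%:E) => //.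
by rewrite addeC e addeC.
Qed.

Lemma mean_square : (0 < #|J|)%N ->
  (\int[Pr]_(w in D) ((n^-1 * \sum_j fj j w - mu0) ^+ 2)%:E = n^-1%:E * V)%E.
Proof.
move=> J0; have n0 : 0 < n by rewrite ltr0n.
transitivity (\int[Pr]_(w in D) (n ^- 2 * (\sum_j fj j w - n * mu0) ^+ 2)%:E)%E.
  by apply: eq_integral => w _; congr EFin; field; rewrite gt_eqF.
have c0 : 0 <= n ^- 2 by rewrite invr_ge0 exprn_ge0// ltW.
have mS : measurable_fun D (fun w => (\sum_j fj j w - n * mu0) ^+ 2).
  by apply: measurable_funX; apply: measurable_funB => //; exact: measurable_sum.
rewrite (integralZ_real Pr mD c0 mS (fun w => sqr_ge0 _)).
rewrite sum_square_on muleA -EFinM; congr (_%:E * _)%E.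
by field; rewrite gt_eqF.
Qed.

End sample_mean_variance.

(** * Contraction of the squared error *)

Section lyapunov_function.
Context (R : realType) (M b : R).

(* Errors beyond [M] weigh 16 times more than those in [b, M]: only the first moment is
   available from there, which does not keep the next error below [M] with probability 1. *)
Definition lyapunov (E : R) : R := if E <= M then Num.min E b else 16 * b.

Hypotheses (b_ge0 : 0 <= b) (bM : b <= M).

Lemma lyapunov_le E : lyapunov E <= 16 * b.
Proof.
rewrite /lyapunov; case: ifP => // _; rewrite ge_min; apply/orP; right.
by rewrite ler_peMl// ler1n.
Qed.

Lemma lyapunov_ge0 E : 0 <= E -> 0 <= lyapunov E.
Proof.
by move=> E0; rewrite /lyapunov; case: ifP => _; rewrite ?le_min ?E0 ?mulr_ge0.
Qed.

Lemma lyapunov_le16 E : 0 <= E -> lyapunov E <= 16 * E.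
Proof.
move=> E0; rewrite /lyapunov; case: ifP => [_|/negbT].
  by rewrite ge_min ler_peMl// ler1n.
by rewrite -ltNge => ME; rewrite ler_pM2l//; apply: le_trans bM (ltW ME).
Qed.

Lemma lyapunov_small E : E <= M -> lyapunov E <= b.
Proof. by move=> EM; rewrite /lyapunov EM ge_min lexx orbT. Qed.

Lemma lyapunov_le_id E : E <= M -> lyapunov E <= E.
Proof. by move=> EM; rewrite /lyapunov EM ge_min lexx. Qed.

Lemma lyapunov_lt E : lyapunov E < b -> lyapunov E = E.
Proof.
rewrite /lyapunov; case: ifP => _; first by rewrite /Num.min; case: ifP => //; rewrite ltxx.
by move=> h; have := b_ge0; lra.
Qed.

Lemma measurable_lyapunov d (T : measurableType d) (F : T -> R) :
  measurable_fun setT F -> measurable_fun setT (fun x => lyapunov (F x)).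
Proof.
move=> mF; apply: measurable_fun_ifT => //; first exact: measurable_fun_ler.
exact: measurable_minr.
Qed.

End lyapunov_function.

Lemma sqr_dist_le (R : realType) (x y c : R) : 0 <= x <= c -> 0 <= y <= c ->
  (x - y) ^+ 2 <= c ^+ 2.
Proof.
move=> /andP[x0 xc] /andP[y0 yc]; rewrite -subr_ge0.
have -> : c ^+ 2 - (x - y) ^+ 2 = (c - (x - y)) * (c + (x - y)) by ring.
by apply: mulr_ge0; lra.
Qed.

Lemma norm_add3_le (R : realType) (t x r e : R) : `|x| <= t / 4 ->
  0 <= r <= t / 4 -> 0 <= e <= t / 4 -> `|x + (r - e)| <= t.
Proof.
rewrite !ler_norml => /andP[h1 h2] /andP[h3 h4] /andP[h5 h6]; apply/andP; split; lra.
Qed.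

(** * One stage of simulation with abstract scores *)

Section stage_lyapunov.
Context (R : realType) d0 d1 d2 (W : measurableType d0) (X : measurableType d1)
  (T : measurableType d2) (Pr : probability W R) (a : W -> X)
  (ma : measurable_fun setT a).
Variables (I J : finType) (k : I -> X -> probability T R)
  (mk : forall i C, measurable C -> measurable_fun setT (fun t => k i t C))
  (sim : I -> J -> W -> T) (msim : forall i j, measurable_fun setT (sim i j)).
Hypothesis joint : forall (E : set X) (C : I -> J -> set T), measurable E ->
  (forall i j, measurable (C i j)) ->
  Pr (a @^-1` E `&` [set w | forall i j, C i j (sim i j w)]) =
  (\int[Pr]_(w in a @^-1` E) \prod_(i : I) \prod_(j : J) k i (a w) (C i j))%E.

Let stageE := stage_expectation ma mk msim joint.

Variables (Y : I -> X * T -> \bar R) (mY : forall i, nneg_measurable (Y i))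
  (mu : I -> R) (mu_ge0 : forall i, 0 <= mu i).
Hypothesis Y_mean : forall i x, (\int[k i x]_y Y i (x, y) = (mu i)%:E)%E.
Hypothesis J_gt0 : (0 < #|J|)%N.

Let n : R := #|J|%:R.
Let n_gt0 : 0 < n. Proof. by rewrite ltr0n. Qed.

Definition score_mean i w : R :=
  fine (n^-1%:E * \sum_(j : J) Y i (a w, sim i j w))%E.

Let f i z := fine (Y i z).

Definition average (h : X * T -> R) i w : R := n^-1 * \sum_(j : J) h (a w, sim i j w).

Lemma measurable_score_mean i : measurable_fun setT (score_mean i).
Proof.
apply: measurableT_comp => //; apply: emeasurable_funM => //.
apply: emeasurable_sum => j.
exact: (measurableT_comp (mY i).1 (measurable_fun_pair ma (msim i j))).
Qed.

Lemma score_mean_ge0 i w : 0 <= score_mean i w.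
Proof.
apply: fine_ge0; apply: mule_ge0; first by rewrite lee_fin invr_ge0 ltW.
by apply: sume_ge0 => j _; exact: (mY i).2.
Qed.

Lemma measurable_f i : measurable_fun setT (f i).
Proof. by apply: measurableT_comp => //; exact: (mY i).1. Qed.

Lemma f_ge0 i z : 0 <= f i z.
Proof. by apply: fine_ge0; exact: (mY i).2. Qed.

Lemma ae_score_fin i x : {ae k i x, forall y, Y i (x, y) \is a fin_num}.
Proof.
have m1 : measurable_fun setT (fun y => Y i (x, y)).
  exact: (measurableT_comp (mY i).1 (@pair1_measurable _ _ _ _ x)).
have : (k i x).-integrable setT (fun y => Y i (x, y)).
  apply/integrableP; split => //.
  under eq_integral do rewrite (gee0_abs ((mY i).2 _)).
  by rewrite Y_mean ltry.
move=> /(integrable_ae measurableT); have FF : Filter (almost_everywhere (k i x)) := ae_filter_ringOfSetsType (k i x).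
by apply: filterS => y; apply.
Qed.

Lemma f_mean i x : (\int[k i x]_y (f i (x, y))%:E = (mu i)%:E)%E.
Proof.
have m1 : measurable_fun setT (fun y => Y i (x, y)).
  exact: (measurableT_comp (mY i).1 (@pair1_measurable _ _ _ _ x)).
have m2 : measurable_fun setT (fun y => (f i (x, y))%:E).
  by apply/measurable_EFinP; exact: (measurableT_comp (measurable_f i) (@pair1_measurable _ _ _ _ x)).
have f0 y : setT y -> (0 <= (f i (x, y))%:E)%E by rewrite lee_fin f_ge0.
have Y0 y : setT y -> (0 <= Y i (x, y))%E by move=> _; exact: (mY i).2.
rewrite -(Y_mean i x); apply: (ge0_ae_eq_integral measurableT m2 m1 f0 Y0).
have FF : Filter (almost_everywhere (k i x)) := ae_filter_ringOfSetsType (k i x).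
by apply: filterS (ae_score_fin i x) => y h _; rewrite /f fineK.
Qed.

(** The scores have finite mean given the past, so almost surely the default value of [fine] does
    not intervene. *)
Lemma ae_sample_fin : {ae Pr, forall w, forall i j, Y i (a w, sim i j w) \is a fin_num}.
Proof.
have FF : Filter (almost_everywhere Pr) := ae_filter_ringOfSetsType Pr.
have h i j : {ae Pr, forall w, Y i (a w, sim i j w) \is a fin_num}.
  have m1 : measurable_fun setT (fun w => Y i (a w, sim i j w)).
    exact: (measurableT_comp (mY i).1 (measurable_fun_pair ma (msim i j))).
  have : Pr.-integrable setT (fun w => Y i (a w, sim i j w)).
    apply/integrableP; split => //.
    under eq_integral do rewrite (gee0_abs ((mY i).2 _)).
    rewrite (stageE i j (mY i)); under eq_integral do rewrite Y_mean.
    by rewrite integral_cst// [X in (_ * X)%E](@probability_setT _ _ _ Pr) mule1 ltry.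
  by move=> /(integrable_ae measurableT); apply: filterS => y; apply.
have h2 i : {ae Pr, forall w, forall j, Y i (a w, sim i j w) \is a fin_num}.
  exact: (filter_forall FF (h i)).
exact: (filter_forall FF h2).
Qed.

Lemma score_mean_average w i : (forall i j, Y i (a w, sim i j w) \is a fin_num) ->
  score_mean i w = average (f i) i w.
Proof.
move=> fin; rewrite /score_mean /average.
rewrite (eq_bigr (fun j => (f i (a w, sim i j w))%:E)); last by move=> j _; rewrite /f fineK.
by rewrite sumEFin.
Qed.

Lemma le_integral_ae (D : set W) (F G : W -> R) : measurable D ->
  measurable_fun setT F -> measurable_fun setT G ->
  (forall w, 0 <= F w) -> (forall w, 0 <= G w) ->
  {ae Pr, forall w, D w -> F w <= G w} ->
  (\int[Pr]_(w in D) (F w)%:E <= \int[Pr]_(w in D) (G w)%:E)%E.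
Proof.
move=> mD mF mG F0 G0 FG; have F0' w : D w -> (0 <= (F w)%:E)%E by rewrite lee_fin.
have G0' w : D w -> (0 <= (G w)%:E)%E by rewrite lee_fin.
have mF' : measurable_fun D (EFin \o F) by apply/measurable_EFinP; exact: measurable_funTS.
have mG' : measurable_fun D (EFin \o G) by apply/measurable_EFinP; exact: measurable_funTS.
apply: (ae_ge0_le_integral mD F0' mF' G0' mG').
have FF : Filter (almost_everywhere Pr) := ae_filter_ringOfSetsType Pr.
by apply: filterS FG => w h Dw; rewrite lee_fin; exact: h.
Qed.

Variables (E : set X) (mE : measurable E).
Let D := a @^-1` E.
Let mD : measurable D.
Proof. by rewrite -[X in measurable X]setTI; exact: ma. Qed.
Let p : R := fine (Pr D).
Let p_ge0 : 0 <= p. Proof. by rewrite fine_ge0. Qed.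
Let cstD (r : R) : (\int[Pr]_(w in D) r%:E = (r * p)%:E)%E.
Proof.
rewrite (integral_cst _ mD) EFinM; congr (_ * _)%E.
by rewrite /p fineK//; exact: fin_num_measure.
Qed.

Lemma measurable_average h i : measurable_fun setT h ->
  measurable_fun setT (average h i).
Proof.
move=> mh; apply: measurable_funM => //; apply: measurable_sum => j.
exact: (measurableT_comp mh (measurable_fun_pair ma (msim i j))).
Qed.

Lemma average_ge0 h i w : (forall z, 0 <= h z) -> 0 <= average h i w.
Proof. by move=> h0; rewrite mulr_ge0 ?invr_ge0 ?sumr_ge0// ltW. Qed.

Lemma average_on (h : X * T -> R) i (r : R) : measurable_fun setT h ->
  (forall z, 0 <= h z) -> 0 <= r ->
  (forall x, E x -> (\int[k i x]_y (h (x, y))%:E = r%:E)%E) ->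
  (\int[Pr]_(w in D) (average h i w)%:E = (r * p)%:E)%E.
Proof.
move=> mh h0 r0 hr.
have mhj j : measurable_fun D (fun w => h (a w, sim i j w)).
  apply: measurable_funTS.
  exact: (measurableT_comp mh (measurable_fun_pair ma (msim i j))).
have i0 : 0 <= n^-1 by rewrite invr_ge0 ltW.
rewrite (integralZ_real Pr mD i0 (measurable_sum _ mhj) (fun w => sumr_ge0 _ (fun j _ => h0 _))).
rewrite (integral_sum_real Pr mD mhj (fun j w => h0 _)).
rewrite (eq_bigr (fun=> (r * p)%:E)); last first.
  by move=> j _; exact: (mean_on ma mk msim joint mE mh h0 hr).
rewrite sumEFin -EFinM sumr_const -[(r * p) *+ _]mulr_natl -/n; congr EFin.
by field; rewrite gt_eqF.
Qed.

Lemma average_square (h : X * T -> R) i (r : R) (v : X -> R) : measurable_fun setT h ->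
  (forall z, 0 <= h z) -> 0 <= r -> measurable_fun setT v -> (forall x, 0 <= v x) ->
  (forall x, E x -> (\int[k i x]_y (h (x, y))%:E = r%:E)%E) ->
  (forall x, E x -> (\int[k i x]_y ((h (x, y) - r) ^+ 2)%:E <= (v x)%:E)%E) ->
  (\int[Pr]_(w in D) ((average h i w - r) ^+ 2)%:E <=
    n^-1%:E * \int[Pr]_(w in D) (v (a w))%:E)%E.
Proof.
move=> mh h0 r0 mv v0 hr hv.
rewrite (mean_square ma mk msim joint mE mh h0 r0 hr J_gt0).
apply: lee_wpmul2l; first by rewrite lee_fin invr_ge0 ltW.
have nsq : nneg_measurable (fun z => ((h z - r) ^+ 2)%:E).
  split; last by move=> z; rewrite lee_fin sqr_ge0.
  by apply/measurable_EFinP; apply: measurable_funX; exact: measurable_funB.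
have := nneg_measurable_comp ma (nneg_measurable_kernel (kfam (mk i)) nsq).
move=> [m1 n1].
have mv' : measurable_fun D (fun w => (v (a w))%:E).
  by apply/measurable_EFinP; apply: measurable_funTS; exact: measurableT_comp.
apply: ge0_le_integral => //.
- by move=> w _; exact: n1.
- exact: measurable_funTS m1.
- by move=> w Dw; exact: hv.
Qed.

Definition err w : R := \sum_i (score_mean i w - mu i) ^+ 2.

Lemma err_ge0 w : 0 <= err w.
Proof. by apply: sumr_ge0 => i _; exact: sqr_ge0. Qed.

Lemma measurable_err : measurable_fun setT err.
Proof.
apply: measurable_sum => i; apply: measurable_funX; apply: measurable_funB => //.
exact: measurable_score_mean.
Qed.

Let ae_scores : {ae Pr, forall w, forall i, score_mean i w = average (f i) i w}.
Proof.
have FF : Filter (almost_everywhere Pr) := ae_filter_ringOfSetsType Pr.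
by apply: filterS ae_sample_fin => w h i; exact: score_mean_average.
Qed.

Lemma score_mean_on i : (\int[Pr]_(w in D) (score_mean i w)%:E = (mu i * p)%:E)%E.
Proof.
rewrite -(average_on (measurable_f i) (f_ge0 i) (mu_ge0 i) (fun x _ => f_mean i x)).
apply: ae_eq_integral => //.
- by apply/measurable_EFinP; apply: measurable_funTS; exact: measurable_score_mean.
- apply/measurable_EFinP; apply: measurable_funTS.
  exact: (measurable_average i (measurable_f i)).
have FF : Filter (almost_everywhere Pr) := ae_filter_ringOfSetsType Pr.
by apply: filterS ae_scores => w h _; rewrite h.
Qed.

Variables (M b : R) (b_ge0 : 0 <= b) (bM : b <= M).

(** If all sample means are at most [t], the error is at most [M] and weighs at most [b]. Otherwise
    it weighs at most [16 b], and by Markov's inequality this has probability at most the sum of the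
    means over [t], that is 1/16. *)
Lemma lyapunov_far (t : R) : 0 < t -> \sum_i (t + mu i) ^+ 2 <= M ->
  16 * \sum_i mu i <= t ->
  (\int[Pr]_(w in D) (lyapunov M b (err w))%:E <= (2 * b * p)%:E)%E.
Proof.
move=> t0 tM mut.
have mW := measurable_lyapunov M b measurable_err.
have W0 w : 0 <= lyapunov M b (err w) by apply: lyapunov_ge0 => //; exact: err_ge0.
have mS : measurable_fun D (fun w => \sum_i score_mean i w).
  by apply: measurable_sum => i; apply: measurable_funTS; exact: measurable_score_mean.
have S0 w : 0 <= \sum_i score_mean i w by apply: sumr_ge0 => i _; exact: score_mean_ge0.
have c0 : 0 <= 16 * b / t by rewrite divr_ge0 ?mulr_ge0// ltW.
have le1 w : D w -> lyapunov M b (err w) <= b + 16 * b / t * \sum_i score_mean i w.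
  move=> _; have [ht|/existsNP[i /negP]] := pselect (forall i, score_mean i w <= t).
    apply: le_trans (lyapunov_small b _) _; last by rewrite lerDl mulr_ge0.
    apply: le_trans tM; apply: ler_sum => i _.
    have := score_mean_ge0 i w; have := mu_ge0 i; have := ht i.
    move=> h1 h2 h3; rewrite -subr_ge0.
    have -> : (t + mu i) ^+ 2 - (score_mean i w - mu i) ^+ 2 =
      (t - score_mean i w + 2 * mu i) * (t + score_mean i w) by ring.
    by apply: mulr_ge0; lra.
  rewrite -ltNge => ti; apply: le_trans (lyapunov_le M b_ge0 _) _.
  rewrite -[X in X <= _]add0r; apply: lerD => //.
  rewrite -mulrA [t^-1 * _]mulrC ler_peMr ?mulr_ge0// ler_pdivlMr// mul1r.
  apply: le_trans (ltW ti) _; rewrite (bigD1 i)//= lerDl.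
  by apply: sumr_ge0 => j _; exact: score_mean_ge0.
apply: le_trans (le_integral_real Pr mD (measurable_funTS mW) _ W0 le1) _.
  by apply: measurable_funD => //; exact: measurable_funM.
rewrite (integralD_real Pr mD (measurable_cst _) (measurable_funM (measurable_cst _) mS) (fun=> b_ge0) (fun w => mulr_ge0 c0 (S0 w))).
rewrite cstD (integralZ_real Pr mD c0 mS S0).
rewrite (integral_sum_real Pr mD (fun i => measurable_funTS (measurable_score_mean i)) (fun i w => score_mean_ge0 i w)).
under eq_bigr do rewrite score_mean_on.
rewrite sumEFin -EFinM -EFinD lee_fin -mulr_suml mulrA -mulrDl.
apply: ler_wpM2r => //.
have -> : 16 * b / t * \sum_i mu i = b * ((16 * \sum_i mu i) / t).
  by ring.
have h : (16 * \sum_i mu i) / t <= 1 by rewrite ler_pdivrMr// mul1r.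
by have := ler_wpM2l b_ge0 h; lra.
Qed.

(** On the good event every truncated average is within [tau0/4] of its mean and every remainder is
    at most [tau0/4]; with [eta <= tau0/4] the error is at most [#|I| * tau0^2 <= b/16]. Chebyshev
    for the averages and Markov for the remainders bound the complement by 1/256, and there the
    weight is at most [16 b]: in total [b/16 + b/16]. *)
Lemma lyapunov_truncated (g : I -> X * T -> R) (muN : I -> R) (cap eta tau0 : R) :
  (forall i, measurable_fun setT (g i)) -> (forall i z, 0 <= g i z) ->
  (forall i z, ((g i z)%:E <= Y i z)%E) ->
  (forall i x y, E x -> g i (x, y) <= cap) ->
  (forall i x, E x -> (\int[k i x]_y (g i (x, y))%:E = (muN i)%:E)%E) ->
  (forall i, 0 <= muN i <= cap) -> (forall i, muN i <= mu i <= muN i + eta) ->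
  0 < tau0 -> eta <= tau0 / 4 -> #|I|%:R * tau0 ^+ 2 <= b / 16 ->
  #|I|%:R * (16 * cap ^+ 2 / (tau0 ^+ 2 * n) + 4 * eta / tau0) <= 256^-1 ->
  (\int[Pr]_(w in D) (lyapunov M b (err w))%:E <= (b / 8 * p)%:E)%E.
Proof.
have b16M : b / 16 <= M by have := b_ge0; have := bM; lra.
move=> mg g0 gY gcap gN muN0 muNle t0 etale It Ie.
have mW := measurable_lyapunov M b measurable_err.
have W0 w : 0 <= lyapunov M b (err w) by apply: lyapunov_ge0 => //; exact: err_ge0.
pose G i w : R := `|score_mean i w - average (g i) i w|.
have mG i : measurable_fun setT (G i).
  apply: measurableT_comp => //; apply: measurable_funB; first exact: measurable_score_mean.
  exact: measurable_average.
have G0 i w : 0 <= G i w by exact: normr_ge0.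
have ae_G : {ae Pr, forall w, forall i, score_mean i w = average (g i) i w + G i w}.
  have FF : Filter (almost_everywhere Pr) := ae_filter_ringOfSetsType Pr.
  apply: filterS ae_sample_fin => w fin i; rewrite /G (score_mean_average i fin).
  rewrite ger0_norm; first by rewrite addrC subrK.
  rewrite subr_ge0; apply: ler_wpM2l; first by rewrite invr_ge0 ltW.
  by apply: ler_sum => j _; rewrite -lee_fin /f fineK.
have mean_G i : (\int[Pr]_(w in D) (G i w)%:E = ((mu i - muN i) * p)%:E)%E.
  have e : (\int[Pr]_(w in D) (score_mean i w)%:E =
      \int[Pr]_(w in D) (average (g i) i w + G i w)%:E)%E.
    apply: ae_eq_integral => //.
    - by apply/measurable_EFinP; apply: measurable_funTS; exact: measurable_score_mean.
    - apply/measurable_EFinP; apply: measurable_funTS; apply: measurable_funD => //.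
      exact: measurable_average.
    have FF : Filter (almost_everywhere Pr) := ae_filter_ringOfSetsType Pr.
    by apply: filterS ae_G => w h _; rewrite h.
  have muN_ge0 : 0 <= muN i by have /andP[] := muN0 i.
  move: e; rewrite score_mean_on (integralD_real Pr mD (measurable_funTS (measurable_average i (mg i))) (measurable_funTS (mG i)) (fun w => average_ge0 i w (g0 i)) (G0 i)).
  rewrite (average_on (mg i) (g0 i) muN_ge0 (gN i)) => e.
  apply: (@addIe_fin _ (muN i * p)%:E) => //.
  by rewrite -e -EFinD -mulrDl [muN i + _]addrC subrK.
pose H i w := (average (g i) i w - muN i) ^+ 2.
have mH i : measurable_fun setT (H i).
  by apply: measurable_funX; apply: measurable_funB => //; exact: measurable_average.
have H0 i w : 0 <= H i w by exact: sqr_ge0.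
have cap0 (i : I) : 0 <= cap by have /andP[] := muN0 i; exact: le_trans.
have mean_H i : (\int[Pr]_(w in D) (H i w)%:E <= (n^-1 * cap ^+ 2 * p)%:E)%E.
  have muN_ge0 : 0 <= muN i by have /andP[] := muN0 i.
  have hv x : E x -> (\int[k i x]_y ((g i (x, y) - muN i) ^+ 2)%:E <= (cap ^+ 2)%:E)%E.
    move=> Ex; apply: le_trans (_ : \int[k i x]_y (cap ^+ 2)%:E <= _)%E.
      apply: le_integral_real => //.
      - apply: measurable_funX; apply: measurable_funB => //.
        exact: (measurableT_comp (mg i) (@pair1_measurable _ _ _ _ x)).
      - by move=> y; exact: sqr_ge0.
      by move=> y _; apply: sqr_dist_le; rewrite ?g0 ?gcap.
    by rewrite integral_cst// [X in (_ * X)%E](@probability_setT _ _ _ (k i x)) mule1.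
  have := average_square (mg i) (g0 i) muN_ge0 (measurable_cst (cap ^+ 2)) (fun=> sqr_ge0 _) (gN i) hv.
  by rewrite cstD -EFinM mulrA.
(* Dominates the indicator of the bad event: a summand is at least 1 as soon as one threshold is
   passed. *)
pose U w := \sum_i (16 / tau0 ^+ 2 * H i w + 4 / tau0 * G i w).
have c1 : 0 <= 16 / tau0 ^+ 2 by rewrite divr_ge0// sqr_ge0.
have c2 : 0 <= 4 / tau0 by rewrite divr_ge0// ltW.
have s0 i w : 0 <= 16 / tau0 ^+ 2 * H i w + 4 / tau0 * G i w.
  by rewrite addr_ge0// mulr_ge0.
have U0 w : 0 <= U w by exact: sumr_ge0.
have c0 : 0 <= 16 * b by rewrite mulr_ge0.
have mterm i : measurable_fun setT (fun w => 16 / tau0 ^+ 2 * H i w + 4 / tau0 * G i w).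
  by apply: measurable_funD; exact: measurable_funM.
have mU : measurable_fun setT U by exact: measurable_sum.
have le1 : {ae Pr, forall w, D w -> lyapunov M b (err w) <= b / 16 + 16 * b * U w}.
  have FF : Filter (almost_everywhere Pr) := ae_filter_ringOfSetsType Pr.
  apply: filterS ae_G => w hG _.
  have [h|/existsNP[i hi]] := pselect (forall i, H i w <= tau0 ^+ 2 / 16 /\ G i w <= tau0 / 4).
    have errle : err w <= b / 16.
      apply: le_trans It; rewrite mulr_natl -sumr_const; apply: ler_sum => i _.
      have [h1 h2] := h i; have /andP[h3 h4] := muNle i; have h5 := G0 i w.
      have h6 : `|average (g i) i w - muN i| <= tau0 / 4.
        have t4 : 0 <= tau0 / 4 by rewrite divr_ge0// ltW.
        rewrite -(@ler_pXn2r _ 2) ?nnegrE// (real_normK (num_real _)).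
        by have -> : (tau0 / 4) ^+ 2 = tau0 ^+ 2 / 16 by field.
      have : `|score_mean i w - mu i| <= tau0.
        have -> : score_mean i w - mu i = (average (g i) i w - muN i) + (G i w - (mu i - muN i)).
          by rewrite {1}hG; ring.
        by apply: (@norm_add3_le _ tau0 _ _ _ h6); [rewrite h5|rewrite subr_ge0 h3 lerBlDl (le_trans h4)// lerD2l].
      move=> h7; rewrite -(real_normK (num_real (score_mean i w - mu i))).
      by rewrite ler_pXn2r// nnegrE ltW.
    have errM : err w <= M by exact: le_trans errle b16M.
    apply: le_trans (lyapunov_le_id b errM) _; apply: le_trans errle _.
    by rewrite lerDl mulr_ge0.
  apply: le_trans (lyapunov_le M b_ge0 _) _.
  rewrite -[X in X <= _]add0r; apply: lerD; first by rewrite divr_ge0.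
  rewrite ler_peMr//.
  apply: le_trans (_ : 16 / tau0 ^+ 2 * H i w + 4 / tau0 * G i w <= _); last first.
    by rewrite /U (bigD1 i)//= lerDl; apply: sumr_ge0.
  have t20 : 0 < tau0 ^+ 2 by exact: exprn_gt0.
  have [hH|hH] := ltP (tau0 ^+ 2 / 16) (H i w).
    rewrite -[X in X <= _]addr0; apply: lerD; last exact: mulr_ge0.
    rewrite [leLHS](_ : _ = 16 / tau0 ^+ 2 * (tau0 ^+ 2 / 16)); last by field; rewrite gt_eqF.
    by apply: ler_wpM2l => //; exact: ltW.
  have [hG'|hG'] := ltP (tau0 / 4) (G i w); last by exfalso; apply: hi.
  rewrite -[X in X <= _]add0r; apply: lerD; first exact: mulr_ge0.
  rewrite [leLHS](_ : _ = 4 / tau0 * (tau0 / 4)); last by field; rewrite gt_eqF.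
  by apply: ler_wpM2l => //; exact: ltW.
have b16 : 0 <= b / 16 by rewrite divr_ge0.
apply: le_trans (le_integral_ae mD mW _ W0 _ le1) _.
- by apply: measurable_funD => //; exact: measurable_funM.
- by move=> w; rewrite addr_ge0// mulr_ge0.
rewrite (integralD_real Pr mD (measurable_cst _) (measurable_funM (measurable_cst _) (measurable_funTS mU)) (fun=> b16) (fun w => mulr_ge0 c0 (U0 w))).
rewrite cstD (integralZ_real Pr mD c0 (measurable_funTS mU) U0).
rewrite (integral_sum_real Pr mD (fun i => measurable_funTS (mterm i)) s0).
apply: le_trans (_ : (b / 16 * p)%:E + (16 * b)%:E * \sum_(i : I)
    ((16 * cap ^+ 2 / (tau0 ^+ 2 * n) + 4 * eta / tau0) * p)%:E <= _)%E.
  apply: leeD => //; apply: lee_wpmul2l; first by rewrite lee_fin.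
  apply: lee_sum => i _.
  have h1 w : 0 <= 16 / tau0 ^+ 2 * H i w by exact: mulr_ge0.
  have h2 w : 0 <= 4 / tau0 * G i w by exact: mulr_ge0.
  rewrite (integralD_real Pr mD (measurable_funM (measurable_cst _) (measurable_funTS (mH i))) (measurable_funM (measurable_cst _) (measurable_funTS (mG i))) h1 h2).
  rewrite (integralZ_real Pr mD c1 (measurable_funTS (mH i)) (H0 i)).
  rewrite (integralZ_real Pr mD c2 (measurable_funTS (mG i)) (G0 i)).
  rewrite [X in (_ <= X%:E)%E]mulrDl EFinD; apply: leeD.
    apply: le_trans (lee_wpmul2l _ (mean_H i)) _; first by rewrite lee_fin.
    rewrite -EFinM lee_fin le_eqVlt; apply/orP; left; apply/eqP.
    by field; rewrite !gt_eqF.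
  rewrite mean_G -EFinM lee_fin.
  have /andP[_ h] := muNle i.
  have -> : 4 * eta / tau0 * p = 4 / tau0 * (eta * p) by ring.
  apply: ler_wpM2l => //; by apply: ler_wpM2r; rewrite ?lerBlDl.
rewrite sumEFin -EFinM -EFinD lee_fin -mulr_suml sumr_const -[X in 16 * b * (X * p)]mulr_natl.
rewrite mulrA -mulrDl; apply: ler_wpM2r => //.
apply: le_trans (lerD (lexx _) (ler_wpM2l c0 Ie)) _.
by have -> : b / 16 + 16 * b * 256^-1 = b / 8 by field.
Qed.

(** [W <= 16 * err] reduces the claim to the variance of sample means. *)
Lemma lyapunov_near (v : X -> R) : measurable_fun setT v -> (forall x, 0 <= v x) ->
  (forall i x, E x -> (\int[k i x]_y ((f i (x, y) - mu i) ^+ 2)%:E <= (v x)%:E)%E) ->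
  (\int[Pr]_(w in D) (lyapunov M b (err w))%:E <=
    (16 * #|I|%:R / n)%:E * \int[Pr]_(w in D) (v (a w))%:E)%E.
Proof.
move=> mv v0 hv.
have mW := measurable_lyapunov M b measurable_err.
have W0 w : 0 <= lyapunov M b (err w) by apply: lyapunov_ge0 => //; exact: err_ge0.
pose H i w := (average (f i) i w - mu i) ^+ 2.
have mH i : measurable_fun setT (H i).
  apply: measurable_funX; apply: measurable_funB => //.
  exact: (measurable_average i (measurable_f i)).
have H0 i w : 0 <= H i w by exact: sqr_ge0.
have le1 : {ae Pr, forall w, D w -> lyapunov M b (err w) <= 16 * \sum_i H i w}.
  have FF : Filter (almost_everywhere Pr) := ae_filter_ringOfSetsType Pr.
  apply: filterS ae_scores => w h _.
  apply: le_trans (lyapunov_le16 bM (err_ge0 w)) _; rewrite ler_wpM2l//.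
  by apply: ler_sum => i _; rewrite h.
have mS : measurable_fun setT (fun w => \sum_i H i w) by exact: measurable_sum.
have S0 w : 0 <= \sum_i H i w by exact: sumr_ge0.
apply: le_trans (le_integral_ae mD mW (measurable_funM (measurable_cst _) mS) W0 (fun w => mulr_ge0 (ler0n _ _) (S0 w)) le1) _.
rewrite (integralZ_real Pr mD (ler0n _ _) (measurable_funTS mS) S0).
rewrite (integral_sum_real Pr mD (fun i => measurable_funTS (mH i)) H0).
apply: le_trans (lee_wpmul2l _ (lee_sum _ (fun i _ => average_square (measurable_f i) (f_ge0 i) (mu_ge0 i) mv v0 (fun x _ => f_mean i x) (hv i)))) _.
  by rewrite lee_fin.
set V := (\int[Pr]_(w in D) (v (a w))%:E)%E.
rewrite (eq_bigr (fun=> n^-1%:E * V)%E)//.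
have -> : (\sum_(i : I) n^-1%:E * V = (#|I|%:R * n^-1)%:E * V)%E.
  rewrite -ge0_sume_distrl ?sumEFin ?sumr_const ?mulr_natl// => i _.
  by rewrite lee_fin invr_ge0 ltW.
by rewrite muleA -EFinM mulrA.
Qed.

End stage_lyapunov.

(** * One stage of the importance sampling algorithm *)

Section importance_stage.
Context (R : realType) d (S : measurableType d) (P : R.-pker S ~> S)
  (K : set S) (mK : measurable K) (s beta : S -> S -> R).
Hypotheses (ms : measurable_fun setT (fun z : S * S => s z.1 z.2))
  (mbeta : measurable_fun setT (fun z : S * S => beta z.1 z.2))
  (s_ge0 : forall x y, 0 <= s x y) (beta_gt0 : forall x y, 0 < beta x y).
Variables (PP : S -> probability (trajectory S) R)
  (PP_law : forall x, markov_law (fun x B => P x B) x (PP x)).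
Variables (sM bM : R) (sM0 : 0 <= sM) (bM0 : 0 <= bM).
Hypotheses (s_le : forall x y, ~ K x -> s x y <= sM)
  (beta_le : forall x y, ~ K x -> beta x y <= bM).
Variables (m : S -> R) (M : R) (bm : bounded_weight K m M)
  (muE : forall x, mu K s beta PP x = (m x)%:E)
  (AE : A K s beta PP = ~` K).

Notation cost := (cost P K s beta).
Notation cost0 := (cost0 P K s beta).
Notation gR := (gR P K s beta).
Notation isw := (isw P K s beta).
Notation dens := (dens P K s beta).

Context d1 d2 (W : measurableType d1) (X : measurableType d2) (Pr : probability W R)
  (a : W -> X) (ma : measurable_fun setT a).
Variables (nu : X -> S -> R) (mnu : measurable_fun setT (fun z : X * S => nu z.1 z.2))
  (Nu : X -> R) (bnu : forall x, bounded_weight K (nu x) (Nu x))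
  (nu_gt0 : forall x y, ~ K y -> 0 < nu x y).
Variables (dim rep : nat) (D : 'I_dim -> S) (nKD : forall i, ~ K (D i)).
Variables (LL : 'I_dim -> X -> probability (trajectory S) R)
  (hLL : forall i x, markov_law (Q P K s beta PP (nu x)) (D i) (LL i x)).

Let nu_ge0 x y : 0 <= nu x y. Proof. by case: (bnu x). Qed.

Lemma measurable_importance_law i C : measurable C -> measurable_fun setT (fun x => LL i x C).
Proof.
pose q (z : X * (S * S)) : R := dens (nu z.1) z.2.
have mq : measurable_fun setT q by exact: measurable_dens.
have q0 z : 0 <= q z.
  exact: (weight_dens mK ms mbeta s_ge0 beta_gt0 PP_law sM0 bM0 s_le beta_le bm muE AE (bnu z.1) (@nu_gt0 z.1)).2.
apply: (measurable_law mq q0 (x := D i)) => x.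
exact: (law_dens mK ms mbeta s_ge0 beta_gt0 PP_law sM0 bM0 s_le beta_le bm muE AE (bnu x) (@nu_gt0 x) (hLL i x)).
Qed.

Definition score (i : 'I_dim) (z : X * trajectory S) : \bar R := Ynu P K s beta PP (nu z.1) z.2.

Definition truncated n (i : 'I_dim) (z : X * trajectory S) : R :=
  \sum_(i < n) term K s (isw (nu z.1)) i z.2.

Let Yterms x := Ynu_terms mK ms mbeta s_ge0 beta_gt0 PP_law sM0 bM0 s_le beta_le bm muE AE (bnu x) (@nu_gt0 x).
Let wisw x := pweight_isw P mK ms mbeta s_ge0 beta_gt0 (bnu x).

Lemma nneg_path_term i :
  nneg_measurable (fun z : X * trajectory S => (term K s (isw (nu z.1)) i z.2)%:E).
Proof.
split; last by move=> z; exact: (nneg_term mK ms s_ge0 (wisw z.1) i).2.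
apply/measurable_EFinP.
apply: (@measurable_term _ _ _ K mK s ms _ _ i snd (fun z : X * trajectory S => isw (nu z.1))) => //.
have m1 : measurable_fun setT (fun z : (X * trajectory S) * (S * S) => (z.1.1, z.2)).
  by apply: measurable_fun_pair => //; exact: (measurableT_comp measurable_fst).
exact: (measurableT_comp (measurable_isw P mK ms mbeta s_ge0 beta_gt0 mnu nu_ge0) m1).
Qed.

Lemma nneg_score i : nneg_measurable (score i).
Proof.
rewrite (_ : score i = fun z => \sum_(0 <= i <oo) (term K s (isw (nu z.1)) i z.2)%:E)%E.
  split; last by move=> z; apply: nneseries_ge0 => j _ _; exact: (nneg_path_term j).2.
  apply: ge0_emeasurable_sum => j; first by move=> z _ _; exact: (nneg_path_term j).2.
  by move=> _; exact: (nneg_path_term j).1.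
by apply/funext => z; exact: Yterms.
Qed.

Lemma truncated_ge0 n i z : 0 <= truncated n i z.
Proof. by apply: sumr_ge0 => j _; rewrite -lee_fin; exact: (nneg_path_term j).2. Qed.

Lemma measurable_truncated n i : measurable_fun setT (truncated n i).
Proof.
by apply: measurable_sum => j; apply/measurable_EFinP; exact: (nneg_path_term j).1.
Qed.

Lemma truncated_le n i z : ((truncated n i z)%:E <= score i z)%E.
Proof.
rewrite /score Yterms /truncated -sumEFin.
rewrite -[leLHS](big_mkord xpredT (fun k => (term K s (isw (nu z.1)) k z.2)%:E)).
by apply: nneseries_lim_ge => j _ _; exact: (nneg_path_term j).2.
Qed.

Lemma score_mean_value i x : (\int[LL i x]_y score i (x, y) = (m (D i))%:E)%E.
Proof.
exact: (Ynu_mean mK ms mbeta s_ge0 beta_gt0 PP_law sM0 bM0 s_le beta_le bm muE AE (bnu x) (@nu_gt0 x) (hLL i x)).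
Qed.

Lemma truncated_mean n i x :
  (\int[LL i x]_y (truncated n i (x, y))%:E = \sum_(j < n) cost j (D i))%E.
Proof.
exact: (partial_mean mK ms mbeta s_ge0 beta_gt0 PP_law sM0 bM0 s_le beta_le bm muE AE (bnu x) (@nu_gt0 x) (hLL i x)).
Qed.

Variables (sim : 'I_dim -> 'I_rep -> W -> trajectory S)
  (msim : forall i j, measurable_fun setT (sim i j)).
Hypothesis joint : forall (E : set X) (C : 'I_dim -> 'I_rep -> set (trajectory S)), measurable E ->
  (forall i j, measurable (C i j)) ->
  Pr (a @^-1` E `&` [set w | forall i j, C i j (sim i j w)]) =
  (\int[Pr]_(w in a @^-1` E) \prod_(i < dim) \prod_(j < rep) LL i (a w) (C i j))%E.
Hypothesis rep0 : (0 < rep)%N.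

Variables (eps bmin : R) (eps0 : 0 < eps) (bmin0 : 0 < bmin).
Hypothesis beta_ge : forall x y, ~ K x -> bmin <= beta x y.
Variables (n0 : nat) (c0 : R).
Hypothesis hc0 : forall y, ~ K y ->
  (c0%:E <= \sum_(t < n0) iter t (kop P (stay R K)) (kop P (last_gain K s) (fun=> 1)) y)%E.

Variables (b B Lip : R) (b0 : 0 < b) (bB : b <= B) (Lip0 : 0 <= Lip).
Variables (e : X -> R) (me : measurable_fun setT e) (e_ge0 : forall x, 0 <= e x).
Hypotheses (nu_lip : forall x y, `|nu x y - m y| <= Lip * Num.sqrt (e x))
  (nu_eps : forall x y, ~ K y -> eps <= nu x y).

Let mD i : R := m (D i).
Let error := err a sim score mD.

(* Far from the target: only the first moment of the scores is available. *)
Variables (t : R) (t0 : 0 < t).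
Hypotheses (tB : \sum_i (t + mD i) ^+ 2 <= B) (tm : 16 * \sum_i mD i <= t).

(* At moderate distance: truncated scores are bounded, the remainders have small mean. *)
Variables (G2 eta tau0 : R) (n2 : nat) (mN : 'I_dim -> R).
Hypotheses (G2_gt0 : 0 < G2) (G2_ge : bM * (sM + (M + Lip * Num.sqrt B)) <= G2)
  (mNE : forall i, (\sum_(j < n2) cost j (D i) = (mN i)%:E)%E)
  (mN_close : forall i, mD i <= mN i + eta)
  (tau00 : 0 < tau0) (eta_le : eta <= tau0 / 4)
  (tau0_le : dim%:R * tau0 ^+ 2 <= b / 16)
  (rep_trunc : dim%:R * (16 * partial_cap eps G2 n2 ^+ 2 / (tau0 ^+ 2 * rep%:R) + 4 * eta / tau0) <= 256^-1).

(* Close to the target the second moment is controlled by the squared distance. *)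
Variables (G1 rho C : R).
Hypotheses (G1_gt0 : 0 < G1) (G1_ge : bM * (sM + (M + 1)) <= G1) (G1_ge' : eps * bmin <= G1).
Let c := (eps * bmin / G1) ^+ n0 * (bmin / G1) * c0.
Hypotheses (rho1 : 1 < rho) (C0 : 0 < C)
  (hC : forall k, \sum_(j < k) (rho ^+ 2) ^+ j * (1 - c) ^+ (j %/ n0) <= C)
  (b_small : Lip * Num.sqrt b <= 1)
  (b_small' : (bM + 1) * (Lip * Num.sqrt b) <= (rho - 1) * eps)
  (rep_near : 16 * dim%:R / rep%:R *
     (moment_const bM (M + 1) eps G1 rho * C * Lip ^+ 2) <= 8^-1).

Let mLL := measurable_importance_law.
Let mD_ge0 i : 0 <= mD i. Proof. by case: bm => _ h _ _; exact: h. Qed.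
Let J0 : (0 < #|'I_rep|)%N. Proof. by rewrite card_ord. Qed.
Let b_ge0 : 0 <= b := ltW b0.

Let near_class := e @^-1` `]-oo, b[%classic.
Let middle_class := e @^-1` `[b, B]%classic.
Let far_class := e @^-1` `]B, +oo[%classic.

Let measurable_near : measurable near_class.
Proof. by rewrite -[X in measurable X]setTI; apply: me => //; exact: measurable_itv. Qed.

Let measurable_middle : measurable middle_class.
Proof. by rewrite -[X in measurable X]setTI; apply: me => //; exact: measurable_itv. Qed.

Let measurable_far : measurable far_class.
Proof. by rewrite -[X in measurable X]setTI; apply: me => //; exact: measurable_itv. Qed.

Let lyap_const E (r : R) : measurable E -> 0 <= r ->
  (forall x, E x -> lyapunov B b (e x) = r) ->
  (\int[Pr]_(w in a @^-1` E) (lyapunov B b (e (a w)))%:E =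
    (r * fine (Pr (a @^-1` E)))%:E)%E.
Proof.
move=> mE r0 hr.
have mD' : measurable (a @^-1` E) by rewrite -[X in measurable X]setTI; exact: ma.
transitivity (\int[Pr]_(w in a @^-1` E) r%:E)%E.
  by apply: eq_integral => w /set_mem Ew; rewrite hr.
rewrite (integral_cst _ mD') EFinM; congr (_ * _)%E.
by rewrite fineK//; exact: fin_num_measure.
Qed.

Lemma contraction_far :
  (\int[Pr]_(w in a @^-1` far_class) (lyapunov B b (error w))%:E <=
   (8^-1)%:E * \int[Pr]_(w in a @^-1` far_class) (lyapunov B b (e (a w)))%:E)%E.
Proof.
rewrite (@lyap_const far_class (16 * b)) ?mulr_ge0//; last first.
  by move=> x; rewrite /far_class /= in_itv /= andbT => Be; rewrite /lyapunov leNgt Be.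
apply: le_trans (lyapunov_far ma mLL msim joint nneg_score mD_ge0 score_mean_value J0
  measurable_far b_ge0 t0 tB tm) _.
by rewrite -EFinM lee_fin le_eqVlt; apply/orP; left; apply/eqP; field.
Qed.

Let nu_M x y : nu x y <= M + Lip * Num.sqrt (e x).
Proof.
have := nu_lip x y; rewrite ler_norml => /andP[_]; rewrite lerBlDl => h.
by apply: le_trans h _; rewrite lerD2r; case: bm.
Qed.

Lemma contraction_middle :
  (\int[Pr]_(w in a @^-1` middle_class) (lyapunov B b (error w))%:E <=
   (8^-1)%:E * \int[Pr]_(w in a @^-1` middle_class) (lyapunov B b (e (a w)))%:E)%E.
Proof.
rewrite (@lyap_const middle_class b)//; last first.
  by move=> x; rewrite /middle_class /= in_itv /= => /andP[be eB]; rewrite /lyapunov eB; apply/min_idPr.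
have mN_ge0 i : 0 <= mN i.
  rewrite -lee_fin -mNE; apply: sume_ge0 => j _.
  exact: (nneg_cost P mK ms mbeta s_ge0 beta_gt0 j).2.
have cap i x y : middle_class x -> truncated n2 i (x, y) <= partial_cap eps G2 n2.
  rewrite /middle_class /= in_itv /= => /andP[_ eB].
  apply: (partial_le mK ms mbeta s_ge0 beta_gt0 (bnu x) eps0 G2_gt0 (nu_eps x)) => z.
  have bx : bounded_weight K (nu x) (M + Lip * Num.sqrt B).
    case: (bnu x) => h1 h2 h3 _; split=> // z'; apply: le_trans (nu_M x z') _.
    by rewrite lerD2l ler_wpM2l// ler_wsqrtr.
  exact: le_trans (gR_le P mK ms mbeta s_ge0 beta_gt0 sM0 bM0 s_le beta_le z bx) G2_ge.
have cap_ge0 : 0 <= partial_cap eps G2 n2.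
  apply: sumr_ge0 => j _; apply: mulr_ge0; last exact: ltW.
  by apply: exprn_ge0; apply: divr_ge0; exact: ltW.
have trm i x : middle_class x ->
    (\int[LL i x]_y (truncated n2 i (x, y))%:E = (mN i)%:E)%E.
  by move=> _; rewrite truncated_mean mNE.
(* The bounds on [mN] are read off at a point of the class, so an empty class is disposed of
   first. *)
have [[x mx]|none] := pselect (exists x, middle_class x); last first.
  rewrite (_ : a @^-1` middle_class = set0); first by rewrite integral_set0 measure0 /= mulr0 mule0.
  by apply/seteqP; split=> w // h; apply: none; exists (a w).
have mN_cap i : 0 <= mN i <= partial_cap eps G2 n2.
  rewrite mN_ge0 /= -lee_fin -(trm i x mx).
  apply: le_trans (_ : \int[LL i x]_y (partial_cap eps G2 n2)%:E <= _)%E.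
    apply: le_integral_real => //.
    - exact: (measurableT_comp (measurable_truncated n2 i) (@pair1_measurable _ _ _ _ x)).
    - by move=> y; exact: truncated_ge0.
    - by move=> y _; exact: cap.
  by rewrite integral_cst// [X in (_ * X)%E](@probability_setT _ _ _ (LL i x)) mule1.
have mN_le i : mN i <= mD i <= mN i + eta.
  rewrite mN_close andbT -lee_fin -(trm i x mx) -(score_mean_value i x).
  apply: ge0_le_integral => //.
  - by move=> y _; rewrite lee_fin truncated_ge0.
  - apply/measurable_EFinP.
    exact: (measurableT_comp (measurable_truncated n2 i) (@pair1_measurable _ _ _ _ x)).
  - exact: (measurableT_comp (nneg_score i).1 (@pair1_measurable _ _ _ _ x)).
  - by move=> y _; exact: truncated_le.
have tau0_le' : #|'I_dim|%:R * tau0 ^+ 2 <= b / 16 by rewrite card_ord.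
have rep_trunc' : #|'I_dim|%:R * (16 * partial_cap eps G2 n2 ^+ 2 / (tau0 ^+ 2 * #|'I_rep|%:R) +
    4 * eta / tau0) <= 256^-1 by rewrite !card_ord.
apply: le_trans (lyapunov_truncated ma mLL msim joint nneg_score mD_ge0 score_mean_value J0
  measurable_middle b_ge0 bB (measurable_truncated n2) (@truncated_ge0 n2) (@truncated_le n2)
  cap trm mN_cap mN_le tau00 eta_le tau0_le' rep_trunc') _.
by rewrite -EFinM lee_fin le_eqVlt; apply/orP; left; apply/eqP; ring.
Qed.

(** The second moment is at most a multiple of [e x], which is its own weight when [e x < b];
    [rep_near] brings the resulting factor below 1/8. *)
Lemma contraction_near :
  (\int[Pr]_(w in a @^-1` near_class) (lyapunov B b (error w))%:E <=
   (8^-1)%:E * \int[Pr]_(w in a @^-1` near_class) (lyapunov B b (e (a w)))%:E)%E.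
Proof.
pose v x : R := moment_const bM (M + 1) eps G1 rho * C * Lip ^+ 2 * e x.
have v0 : 0 <= moment_const bM (M + 1) eps G1 rho * C * Lip ^+ 2.
  apply: mulr_ge0; last exact: sqr_ge0.
  apply: mulr_ge0; last exact: ltW.
  apply: mulr_ge0; first exact: sqr_ge0.
  by apply: addr_ge0 => //; apply: divr_ge0 => //; rewrite subr_ge0 ltW.
have mv : measurable_fun setT v by exact: measurable_funM.
have vx0 x : 0 <= v x by rewrite mulr_ge0.
have near i x : near_class x ->
    (\int[LL i x]_y ((fine (score i (x, y)) - mD i) ^+ 2)%:E <= (v x)%:E)%E.
  rewrite /near_class /= in_itv /= => eb.
  pose V := Lip * Num.sqrt (e x).
  have Vb : V <= Lip * Num.sqrt b by rewrite ler_wpM2l// ler_wsqrtr// ltW.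
  have V0 : 0 <= V by rewrite mulr_ge0// sqrtr_ge0.
  have bx : bounded_weight K (nu x) (M + 1).
    case: (bnu x) => h1 h2 h3 _; split=> // z; apply: le_trans (nu_M x z) _.
    by rewrite lerD2l; exact: le_trans Vb b_small.
  have gG z : gR (nu x) z <= G1.
    exact: le_trans (gR_le P mK ms mbeta s_ge0 beta_gt0 sM0 bM0 s_le beta_le z bx) G1_ge.
  have bV : (bM + 1) * V <= (rho - 1) * eps.
    by apply: le_trans b_small'; rewrite ler_wpM2l// addr_ge0.
  have := near_second_moment mK ms mbeta s_ge0 beta_gt0 PP_law sM0 bM0 s_le beta_le bm muE AE
    bx (@nu_gt0 x) (hLL i x) eps0 bmin0 G1_gt0 (nu_eps x) beta_ge gG G1_ge' hc0 (@nKD i)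
    rho1 V0 hC (nu_lip x) bV.
  move=> H; apply: le_trans H _; rewrite lee_fin /v /V exprMn sqr_sqrtr// mulrA.
  by [].
apply: le_trans (lyapunov_near ma mLL msim joint nneg_score mD_ge0 score_mean_value J0
  measurable_near b_ge0 bB mv vx0 near) _.
have mD' : measurable (a @^-1` near_class) by rewrite -[X in measurable X]setTI; exact: ma.
have mea : measurable_fun setT (fun w => e (a w)) by exact: measurableT_comp.
rewrite !card_ord (integralZ_real Pr mD' v0 (measurable_funTS mea) (fun w => e_ge0 _)).
rewrite muleA -EFinM; set c1 := 16 * _ / _ * _.
rewrite (_ : (\int[Pr]_(w in a @^-1` near_class) (e (a w))%:E =
   \int[Pr]_(w in a @^-1` near_class) (lyapunov B b (e (a w)))%:E)%E); last first.
  apply: eq_integral => w /set_mem; rewrite /near_class /= in_itv /= => eb.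
  rewrite /lyapunov (le_trans (ltW eb) bB); congr EFin; apply/esym/min_idPl; exact: ltW.
apply: lee_wpmul2r; last by rewrite lee_fin.
by apply: integral_ge0 => w _; rewrite lee_fin lyapunov_ge0.
Qed.

Lemma stage_contraction :
  (\int[Pr]_w (lyapunov B b (error w))%:E <=
   (8^-1)%:E * \int[Pr]_w (lyapunov B b (e (a w)))%:E)%E.
Proof.
have split3 (F : W -> R) : measurable_fun setT F -> (forall w, 0 <= F w) ->
    (\int[Pr]_w (F w)%:E = \int[Pr]_(w in a @^-1` near_class) (F w)%:E +
      (\int[Pr]_(w in a @^-1` middle_class) (F w)%:E +
       \int[Pr]_(w in a @^-1` far_class) (F w)%:E))%E.
  move=> mF F0; have mpre E : measurable E -> measurable (a @^-1` E).
    by move=> mE; rewrite -[X in measurable X]setTI; exact: ma.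
  have F0' (D' : set W) w : D' w -> (0 <= (F w)%:E)%E by rewrite lee_fin.
  have mF' (D' : set W) : measurable_fun D' (EFin \o F).
    by apply/measurable_EFinP; exact: measurable_funTS.
  have -> : [set: W] = a @^-1` near_class `|` (a @^-1` middle_class `|` a @^-1` far_class).
    apply/seteqP; split=> w // _; rewrite /near_class /middle_class /far_class /= !in_itv /= andbT.
    have [eb|be] := ltP (e (a w)) b; first by left.
    by right; have [eB|Be] := leP (e (a w)) B; [left|right].
  rewrite ge0_integral_setU//; [|exact: mpre|by apply: measurableU; exact: mpre|exact: F0'|]; last first.
    apply/disj_setPS => w []; rewrite /near_class /middle_class /far_class /= !in_itv /= andbT.
    move=> eb [/andP[be _]|Be].
      by move: eb; rewrite ltNge be.
    by move: eb; rewrite ltNge (le_trans bB (ltW Be)).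
  rewrite ge0_integral_setU//; [exact: mpre|exact: mpre|exact: F0'|].
  apply/disj_setPS => w []; rewrite /middle_class /far_class /= !in_itv /= andbT.
  by move=> /andP[_ eB]; rewrite ltNge eB.
have mea : measurable_fun setT (fun w => e (a w)) by exact: measurableT_comp.
have mL := measurable_lyapunov B b mea.
have mE := measurable_lyapunov B b (measurable_err ma msim nneg_score mD).
rewrite (split3 _ mL); last by move=> w; exact: lyapunov_ge0.
rewrite (split3 _ mE); last by move=> w; apply: lyapunov_ge0 => //; exact: err_ge0.
have i0 (E : set X) : (0 <= \int[Pr]_(w in a @^-1` E) (lyapunov B b (e (a w)))%:E)%E.
  by apply: integral_ge0 => w _; rewrite lee_fin lyapunov_ge0.
rewrite (ge0_muleDr _ (i0 _) (adde_ge0 (i0 _) (i0 _))) (ge0_muleDr _ (i0 _) (i0 _)).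
apply: leeD; first exact: contraction_near.
by apply: leeD; [exact: contraction_middle|exact: contraction_far].
Qed.

End importance_stage.

(** * Choice of the constants *)

Section contraction_constants.
Context (R : realType) d (S : measurableType d) (P : R.-pker S ~> S)
  (K : set S) (mK : measurable K) (s beta : S -> S -> R).
Hypotheses (ms : measurable_fun setT (fun z : S * S => s z.1 z.2))
  (mbeta : measurable_fun setT (fun z : S * S => beta z.1 z.2))
  (s_ge0 : forall x y, 0 <= s x y) (beta_gt0 : forall x y, 0 < beta x y).
Variables (PP : S -> probability (trajectory S) R)
  (PP_law : forall x, markov_law (fun x B => P x B) x (PP x)).
Variables (sM bM : R) (sM0 : 0 <= sM) (bM0 : 0 <= bM).
Hypotheses (s_le : forall x y, ~ K x -> s x y <= sM)
  (beta_le : forall x y, ~ K x -> beta x y <= bM).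
Variables (m : S -> R) (M : R) (bm : bounded_weight K m M)
  (muE : forall x, mu K s beta PP x = (m x)%:E)
  (AE : A K s beta PP = ~` K).

Notation cost := (cost P K s beta).
Notation cost0 := (cost0 P K s beta).
Notation gR := (gR P K s beta).
Notation isw := (isw P K s beta).
Notation dens := (dens P K s beta).

Hypothesis M0 : 0 <= M.
Variables (eps bmin : R) (eps0 : 0 < eps) (bmin0 : 0 < bmin).
Hypothesis beta_ge : forall x y, ~ K x -> bmin <= beta x y.
Variables (n0 : nat) (c0 : R) (n0_gt0 : (0 < n0)%N) (c0_gt0 : 0 < c0) (c0_le1 : c0 <= 1).
Hypothesis hc0 : forall y, ~ K y ->
  (c0%:E <= \sum_(t < n0) iter t (kop P (stay R K)) (kop P (last_gain K s) (fun=> 1)) y)%E.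
Variables (dim : nat) (D : 'I_dim -> S) (nKD : forall i, ~ K (D i)).
Variables (Lip : R) (Lip0 : 0 <= Lip).

Let mD i : R := m (D i).

(** The starting points are finitely many, so one truncation index serves them all. *)
Lemma cost_partial_close (eta : R) : 0 < eta -> exists n, forall i,
  ((mD i - eta)%:E <= \sum_(j < n) cost j (D i))%E.
Proof.
move=> eta0; have cost_ge0 j x : (0 <= cost j x)%E.
  exact: (nneg_cost P mK ms mbeta s_ge0 beta_gt0 j).2.
have close i : exists n, ((mD i - eta)%:E <= \sum_(j < n) cost j (D i))%E.
  apply: contrapT => /forallNP none.
  have : ((mD i)%:E <= (mD i - eta)%:E)%E.
    rewrite /mD -muE (mu_series mK ms mbeta s_ge0 beta_gt0 PP_law).
    apply: lime_le; first by apply: is_cvg_nneseries => j _ _.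
    apply: nearW => n; rewrite big_mkord leNgt; apply/negP => /ltW; exact: none.
  by rewrite lee_fin; have := eta0; lra.
have [f hf] := choice close.
exists (\max_i f i) => i; apply: le_trans (hf i) _.
rewrite -!(big_mkord xpredT (fun j => cost j (D i))).
by apply: lee_sum_nneg_natr; [move=> *; exact: cost_ge0|exact: leq_bigmax].
Qed.

(* One stage of the algorithm: [nu x] is the estimate, [e x] the squared error of the
   sample means that produced it. *)
Definition contracts (b B : R) rep : Prop :=
  forall d1 d2 (W : measurableType d1) (X : measurableType d2) (Pr : probability W R)
    (a : W -> X), measurable_fun setT a ->
  forall nu : X -> S -> R, measurable_fun setT (fun z : X * S => nu z.1 z.2) ->
  (forall x, exists N, bounded_weight K (nu x) N) ->
  (forall x y, ~ K y -> eps <= nu x y) ->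
  forall LL : 'I_dim -> X -> probability (trajectory S) R,
  (forall i x, markov_law (Q P K s beta PP (nu x)) (D i) (LL i x)) ->
  forall sim : 'I_dim -> 'I_rep -> W -> trajectory S,
  (forall i j, measurable_fun setT (sim i j)) ->
  (forall (E : set X) (C : 'I_dim -> 'I_rep -> set (trajectory S)), measurable E ->
    (forall i j, measurable (C i j)) ->
    Pr (a @^-1` E `&` [set w | forall i j, C i j (sim i j w)]) =
    (\int[Pr]_(w in a @^-1` E) \prod_(i < dim) \prod_(j < rep) LL i (a w) (C i j))%E) ->
  forall e : X -> R, measurable_fun setT e -> (forall x, 0 <= e x) ->
  (forall x y, `|nu x y - m y| <= Lip * Num.sqrt (e x)) ->
  (\int[Pr]_w (lyapunov B b (err a sim (score P K s beta PP nu (dim := dim)) mD w))%:E <=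
   (8^-1)%:E * \int[Pr]_w (lyapunov B b (e (a w)))%:E)%E.

(** The order of choice matters: [rho] and [b] come from the near regime, [B] from the far one, then
    [G2] and the truncation index, whose cap may be large, and the number of replications last. *)
Lemma contraction_constants : exists (b B : R) (R0 : nat), [/\ 0 < b, b <= B &
  forall rep, (R0 <= rep)%N ->
  contracts b B rep].
Proof.
have mD_ge0 i : 0 <= mD i by case: bm => _ h _ _; exact: h.
(* The summands provide the bound on [gR] near the target and make the two density factors
   [eps * bmin / G1] and [bmin / G1] at most 1. *)
pose G1 := bM * (sM + (M + 1)) + eps * bmin + bmin.
have h1 : 0 <= bM * (sM + (M + 1)) by rewrite mulr_ge0// !addr_ge0.
have h2 : 0 < eps * bmin by exact: mulr_gt0.
have G1_gt0 : 0 < G1 by rewrite ltr_wpDl// addr_ge0// ltW.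
have G1_ge : bM * (sM + (M + 1)) <= G1.
  by rewrite /G1 -addrA lerDl addr_ge0// ltW.
have G1_ge' : eps * bmin <= G1 by rewrite /G1; have := bmin0; lra.
have G1_ge'' : bmin <= G1 by rewrite /G1; lra.
pose c := (eps * bmin / G1) ^+ n0 * (bmin / G1) * c0.
have q1 : 0 < eps * bmin / G1 <= 1 by rewrite divr_gt0//= ler_pdivrMr// mul1r.
have q2 : 0 < bmin / G1 <= 1 by rewrite divr_gt0//= ler_pdivrMr// mul1r.
have c01 : 0 < c <= 1.
  case/andP: q1 => q1 q1'; case/andP: q2 => q2 q2'.
  have q3 : 0 < (eps * bmin / G1) ^+ n0 by exact: exprn_gt0.
  have q3' : (eps * bmin / G1) ^+ n0 <= 1 by apply: exprn_ile1 => //; exact: ltW.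
  apply/andP; split; first by apply: mulr_gt0 => //; exact: mulr_gt0.
  apply: mulr_ile1 => //; [by apply: mulr_ge0; exact: ltW|exact: ltW|].
  by apply: mulr_ile1 => //; exact: ltW.
have [rho [C [rho1 C0 hC]]] := block_geometric c01 n0_gt0.
(* Tolerance on the distance to the target: the entry 1 keeps the estimate below [M + 1], the other
   one ensures [g <= rho * nu]. *)
pose kappa := Num.min 1 ((rho - 1) * eps / (bM + 1)).
have bM1 : 0 < bM + 1 by rewrite ltr_wpDl.
have kappa0 : 0 < kappa.
  by rewrite lt_min ltr01 /= divr_gt0// mulr_gt0// subr_gt0.
have Lip1 : 0 < Lip + 1 by rewrite ltr_wpDl.
(* [Lip] may be 0, hence the division by [Lip + 1]. *)
have [b [b0 Lk]] : exists b, 0 < b /\ Lip * Num.sqrt b <= kappa.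
  exists ((kappa / (Lip + 1)) ^+ 2); split; first by rewrite exprn_gt0// divr_gt0.
  rewrite sqrtr_sqr ger0_norm; last by rewrite ltW// divr_gt0.
  by rewrite mulrCA ler_piMr ?(ltW kappa0)// ler_pdivrMr// mul1r lerDl.
have b_small : Lip * Num.sqrt b <= 1 by apply: le_trans Lk _; rewrite ge_min lexx.
have b_small' : (bM + 1) * (Lip * Num.sqrt b) <= (rho - 1) * eps.
  apply: (@le_trans _ _ ((bM + 1) * kappa)); first by rewrite ler_wpM2l// ltW.
  by rewrite mulrC -ler_pdivlMr// ge_min lexx orbT.
pose t := 16 * \sum_i mD i + 1.
have sm0 : 0 <= \sum_i mD i by exact: sumr_ge0.
have t0 : 0 < t by rewrite ltr_wpDl// mulr_ge0.
have tm : 16 * \sum_i mD i <= t by rewrite lerDl.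
pose B := Num.max b (\sum_i (t + mD i) ^+ 2).
have bB : b <= B by rewrite le_max lexx.
have tB : \sum_i (t + mD i) ^+ 2 <= B by rewrite le_max lexx orbT.
pose G2 := bM * (sM + (M + Lip * Num.sqrt B)) + 1.
have G2_ge : bM * (sM + (M + Lip * Num.sqrt B)) <= G2 by rewrite lerDl.
have G2_gt0 : 0 < G2.
  apply: ltr_wpDl => //; apply: mulr_ge0 => //; apply: addr_ge0 => //; apply: addr_ge0 => //.
  by apply: mulr_ge0 => //; exact: sqrtr_ge0.
(* [dim.+1] stands in for [dim], which may be 0, wherever one divides. *)
have d1_gt0 : 0 < dim.+1%:R :> R by [].
pose tau0 := Num.sqrt (b / (16 * dim.+1%:R)).
have tau00 : 0 < tau0 by rewrite sqrtr_gt0 divr_gt0// mulr_gt0.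
have tau02 : tau0 ^+ 2 = b / (16 * dim.+1%:R).
  by rewrite sqr_sqrtr// divr_ge0 ?(ltW b0)// mulr_ge0.
have tau0_le : dim%:R * tau0 ^+ 2 <= b / 16.
  rewrite tau02 invfM !mulrA ler_pdivrMr// [leLHS](_ : _ = b / 16 * dim%:R); last by ring.
  by rewrite ler_wpM2l ?divr_ge0 ?(ltW b0)// ler_nat.
have d1_ge1 : 1 <= dim.+1%:R :> R by rewrite ler1n.
(* The failure budget 1/256 is shared equally between the variance of the truncated averages and the
   truncation error. *)
have [delta [delta0 delta1 delta2]] : exists x : R, [/\ 0 < x, x <= 1 & x + x = 256^-1].
  have h0 : 0 < 256^-1 / 2 :> R by rewrite divr_gt0 ?invr_gt0 ?ltr0n.
  have hE : 256^-1 / 2 + 256^-1 / 2 = 256^-1 :> R by rewrite -splitr.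
  exists (256^-1 / 2); split=> //; apply: (@le_trans _ _ (256^-1)); first by rewrite -[leRHS]hE lerDl ltW.
  by rewrite invf_le1 ?ltr0n ?ler1n.
have [eta [eta0 eta_le etaE]] : exists x : R,
    [/\ 0 < x, x <= tau0 / 4 & 4 * x / tau0 = delta / dim.+1%:R].
  exists (tau0 / 4 * (delta / dim.+1%:R)); split.
  - by rewrite mulr_gt0 ?divr_gt0.
  - by rewrite ler_piMr ?divr_ge0 ?(ltW tau00)// ler_pdivrMr// mul1r (le_trans delta1).
  - by field; rewrite !gt_eqF.
have [n2 hn2] := cost_partial_close eta0.
have cost_le n i : (\sum_(j < n) cost j (D i) <= (mD i)%:E)%E.
  rewrite /mD -muE (mu_series mK ms mbeta s_ge0 beta_gt0 PP_law).
  rewrite -(big_mkord xpredT (fun j => cost j (D i))).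
  by apply: nneseries_lim_ge => j _ _; exact: (nneg_cost P mK ms mbeta s_ge0 beta_gt0 j).2.
pose mN i : R := fine (\sum_(j < n2) cost j (D i))%E.
have mNE i : (\sum_(j < n2) cost j (D i) = (mN i)%:E)%E.
  rewrite /mN fineK// ge0_fin_numE; first exact: le_lt_trans (cost_le _ _) (ltry _).
  by apply: sume_ge0 => j _; exact: (nneg_cost P mK ms mbeta s_ge0 beta_gt0 j).2.
have mN_close i : mD i <= mN i + eta.
  by have := hn2 i; rewrite mNE lee_fin lerBlDr.
pose c1 := dim%:R * (16 * partial_cap eps G2 n2 ^+ 2 / tau0 ^+ 2).
pose c2 := 16 * dim%:R * (moment_const bM (M + 1) eps G1 rho * C * Lip ^+ 2) * 8.
exists b, B, (Num.truncn (c1 / delta) + Num.truncn c2).+1; split=> // rep Rrep.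
have rep0 : (0 < rep)%N by apply: leq_trans Rrep.
have rep0' : 0 < rep%:R :> R by rewrite ltr0n.
have rep1 : c1 / delta <= rep%:R.
  apply: ltW; apply: lt_le_trans (truncnS_gt _) _; rewrite ler_nat; apply: leq_trans Rrep.
  by rewrite ltnS leq_addr.
have rep2 : c2 <= rep%:R.
  apply: ltW; apply: lt_le_trans (truncnS_gt _) _; rewrite ler_nat; apply: leq_trans Rrep.
  by rewrite ltnS leq_addl.
have rep_near : 16 * dim%:R / rep%:R *
     (moment_const bM (M + 1) eps G1 rho * C * Lip ^+ 2) <= 8^-1.
  by rewrite mulrAC ler_pdivrMr// [leRHS]mulrC ler_pdivlMr.
have rep_trunc : dim%:R * (16 * partial_cap eps G2 n2 ^+ 2 / (tau0 ^+ 2 * rep%:R) +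
    4 * eta / tau0) <= 256^-1.
  rewrite etaE mulrDr -delta2; apply: lerD; last first.
    by rewrite mulrCA ler_piMr ?(ltW delta0)// ler_pdivrMr// mul1r ler_nat.
  apply: (@le_trans _ _ (c1 / rep%:R)); first by rewrite /c1 invfM !mulrA.
  by rewrite ler_pdivrMr// mulrC -ler_pdivrMr.
move=> d1 d2 W X Pr a ma nu mnu /choice[Nu bnu] nu_eps LL hLL sim msim joint e me e_ge0 nu_lip.
have nu_gt0 x y : ~ K y -> 0 < nu x y by move=> nK; exact: lt_le_trans (nu_eps x y nK).
exact: (stage_contraction mK ms mbeta s_ge0 beta_gt0 PP_law sM0 bM0 s_le beta_le bm muE AE
  ma mnu bnu nu_gt0 nKD hLL msim joint rep0 eps0 bmin0 beta_ge hc0 b0 bB Lip0 me e_ge0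
  nu_lip nu_eps t0 tB tm G2_gt0 G2_ge mNE mN_close tau00 eta_le tau0_le rep_trunc
  G1_gt0 G1_ge G1_ge' rho1 C0 hC b_small b_small' rep_near).
Qed.

End contraction_constants.

(** * Almost sure convergence *)

(** The means decay like [8^-n], so the series of [4^n * f n] has mean at most [2 c] and is almost
    surely finite; its sum serves as the random constant. *)
Lemma ae_geometric_decay (R : realType) d (T : measurableType d) (Pr : probability T R)
  (f : nat -> T -> R) (c : R) :
  (forall n, measurable_fun setT (f n)) -> (forall n w, 0 <= f n w) ->
  (forall w, f 0%N w <= c) ->
  (forall n, (\int[Pr]_w (f n.+1 w)%:E <= (8^-1)%:E * \int[Pr]_w (f n w)%:E)%E) ->
  {ae Pr, forall w, exists C, forall n, f n w <= C * 4^-1 ^+ n}.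
Proof.
move=> mf f0 fc contr.
(* A probability space is nonempty, so [c] bounds some nonnegative value. *)
have c0 : 0 <= c.
  apply: contrapT => /negP; rewrite -ltNge => c0.
  have [w] : [set: T] !=set0.
    apply/set0P/eqP => T0; have := @probability_setT _ _ _ Pr.
    by rewrite T0 measure0 => /eqP; rewrite eqe eq_sym oner_eq0.
  by move=> _; have := le_lt_trans (fc w) c0; rewrite ltNge f0.
have bound n : (\int[Pr]_w (f n w)%:E <= (c * 8^-1 ^+ n)%:E)%E.
  elim: n => [|n ih].
    rewrite expr0 mulr1 -[leRHS]mule1 -[X in (_ * X)%E](@probability_setT _ _ _ Pr) -integral_cst//.
    by apply: le_integral_real => // w _; exact: fc.
  apply: le_trans (contr n) _; apply: le_trans (lee_wpmul2l _ ih) _; first by rewrite lee_fin invr_ge0.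
  by rewrite -EFinM exprS mulrCA.
pose g n w : \bar R := (4 ^+ n * f n w)%:E.
have g0 n w : (0 <= g n w)%E by rewrite lee_fin mulr_ge0// exprn_ge0.
have mg n : measurable_fun setT (g n) by apply/measurable_EFinP; exact: measurable_funM.
pose G w := (\sum_(0 <= n <oo) g n w)%E.
have mG : measurable_fun setT G by exact: ge0_emeasurable_sum.
have : (\int[Pr]_w G w <= (c * 2)%:E)%E.
  rewrite integral_nneseries//; apply: lime_le; first by apply: is_cvg_nneseries => n _ _; exact: integral_ge0.
  apply: nearW => k; rewrite big_mkord.
  apply: (@le_trans _ _ (\sum_(n < k) (c * 2^-1 ^+ n)%:E)%E).
    apply: lee_sum => n _; rewrite /g (integralZ_real Pr measurableT (exprn_ge0 _ (ler0n _ _)) (mf n) (f0 n)).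
    apply: le_trans (lee_wpmul2l _ (bound n)) _; first by rewrite lee_fin exprn_ge0.
    rewrite -EFinM lee_fin mulrCA -exprMn.
    by have -> : 4 / 8 = 2^-1 :> R by field.
  rewrite sumEFin lee_fin -mulr_sumr ler_wpM2l//.
  have -> : \sum_(i < k) 2^-1 ^+ i = 2 - 2 * 2^-1 ^+ k :> R.
    elim: k => [|k ih]; first by rewrite big_ord0 expr0 mulr1 subrr.
    by rewrite big_ord_recr /= ih exprS mulrA mulfV// mul1r; ring.
  have : 0 <= 2^-1 ^+ k :> R by rewrite exprn_ge0// invr_ge0.
  by lra.
move=> iG; have : Pr.-integrable setT G.
  apply/integrableP; split => //.
  under eq_integral do rewrite (gee0_abs (nneseries_ge0 (fun n _ _ => g0 n _))).
  exact: le_lt_trans iG (ltry _).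
move=> /(integrable_ae measurableT).
have FF : Filter (almost_everywhere Pr) := ae_filter_ringOfSetsType Pr.
apply: filterS => w /(_ I) Gw; exists (fine (G w)) => n.
have : (g n w <= (fine (G w))%:E)%E.
  rewrite fineK//; apply: le_trans (nneseries_lim_ge n.+1 _); last by move=> k _ _; exact: g0.
  by rewrite big_nat_recr//= leeDr// sume_ge0.
by rewrite lee_fin exprVn ler_pdivlMr ?exprn_gt0// mulrC.
Qed.

(** * The iterates of the algorithm *)

Section algorithm.
Context (R : realType) d (S : measurableType d) (P : R.-pker S ~> S)
  (K : set S) (mK : measurable K) (s beta : S -> S -> R).
Hypotheses (ms : measurable_fun setT (fun z : S * S => s z.1 z.2))
  (mbeta : measurable_fun setT (fun z : S * S => beta z.1 z.2))
  (s_ge0 : forall x y, 0 <= s x y) (beta_gt0 : forall x y, 0 < beta x y).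
Variables (PP : S -> probability (trajectory S) R)
  (PP_law : forall x, markov_law (fun x B => P x B) x (PP x)).
Variables (sM bM : R) (sM0 : 0 <= sM) (bM0 : 0 <= bM).
Hypotheses (s_le : forall x y, ~ K x -> s x y <= sM)
  (beta_le : forall x y, ~ K x -> beta x y <= bM).
Variables (m : S -> R) (M : R) (bm : bounded_weight K m M)
  (muE : forall x, mu K s beta PP x = (m x)%:E)
  (AE : A K s beta PP = ~` K).

Notation cost := (cost P K s beta).
Notation cost0 := (cost0 P K s beta).
Notation gR := (gR P K s beta).
Notation isw := (isw P K s beta).
Notation dens := (dens P K s beta).

Variables (dim p : nat) (D : 'I_dim -> S).
Variables (model : 'rV[R]_p -> S -> R) (alpha : 'rV[R]_dim -> 'rV[R]_p).
Variables (eps Lip : R) (eps0 : 0 < eps) (Lip0 : 0 <= Lip).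
Let F v := model (alpha v).
Hypotheses (F_bounded : forall v, orthant v -> exists N, bounded_weight K (F v) N)
  (F_lip : forall v v', orthant v -> orthant v' ->
    forall x, `|F v x - F v' x| <= Lip * `|v - v'|)
  (F_eps : forall v x, orthant v -> ~ K x -> eps <= F v x)
  (F_true : forall x, F (\row_i m (D i)) x = m x).
Variables (QQ : (S -> R) -> S -> probability (trajectory S) R).
Hypothesis QQ_law : forall nu N, bounded_weight K nu N -> (forall x, ~ K x -> 0 < nu x) ->
  forall x, markov_law (Q P K s beta PP nu) x (QQ nu x).
Variables (rep : nat) (mu0 : S -> R) (N0 : R)
  (bmu0 : bounded_weight K mu0 N0) (mu0_gt0 : forall x, ~ K x -> 0 < mu0 x).
Context d' (Omega : measurableType d') (Pr : probability Omega R).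
Variable sim : nat -> 'I_dim -> 'I_rep -> Omega -> trajectory S.
Hypothesis simulation : adaptive_simulation P K s beta PP D model alpha mu0 QQ Pr sim.

(** Generators of the information available when stage [n] begins. [Omega] with the sigma-algebra
    they generate serves as the parameter space of that stage. *)
Definition past_events n : set (set Omega) := [set E | exists (m : nat) i k (C : set (trajectory S)),
  [/\ (m < n)%N, measurable C & E = sim m i k @^-1` C]].

Notation past_space n := (g_sigma_algebraType (past_events n)).

Let est n (w : Omega) : S -> R := estimate P K s beta PP model alpha mu0 sim n w.

Definition stage_mean n i (w : Omega) : R :=
  sample_mean P K s beta PP (est n w) (fun k => sim n i k w).

Definition squared_error n (w : Omega) : R := \sum_i (stage_mean n i w - m (D i)) ^+ 2.

Lemma estS n w : est n.+1 w = F (\row_i stage_mean n i w).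
Proof. by []. Qed.

Lemma measurable_past n n' : (n <= n')%N ->
  measurable_fun setT (id : past_space n' -> past_space n).
Proof.
move=> nn' _ E mE; rewrite setTI preimage_id.
move: E mE; apply: smallest_sub; first exact: smallest_sigma_algebra.
move=> E [k [i [j [C [kn mC ->]]]]]; apply: sub_sigma_algebra.
by exists k, i, j, C; split=> //; exact: leq_trans kn nn'.
Qed.

Lemma measurable_past_Omega n : measurable_fun setT (id : Omega -> past_space n).
Proof.
move=> _ E mE; rewrite setTI preimage_id.
move: E mE; apply: smallest_sub; first exact: sigma_algebra_measurable.
move=> E [k [i [j [C [kn mC ->]]]]]; rewrite -[X in measurable X]setTI.
exact: simulation.1.
Qed.

Lemma measurable_past_sim n i j :
  measurable_fun setT (sim n i j : past_space n.+1 -> trajectory S).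
Proof.
by move=> _ C mC; rewrite setTI; apply: sub_sigma_algebra; exists n, i, j, C.
Qed.

Let stage_mean_nneg n i w : (exists N, bounded_weight K (est n w) N) ->
  (forall x, ~ K x -> 0 < est n w x) -> 0 <= stage_mean n i w.
Proof.
move=> [N bN] pos; have nY := nneg_Ynu mK ms mbeta s_ge0 beta_gt0 PP_law sM0 bM0 s_le beta_le
  bm muE AE bN pos.
apply: fine_ge0; apply: mule_ge0; first by rewrite lee_fin invr_ge0.
by apply: sume_ge0 => j _; exact: nY.2.
Qed.

(** Boundedness and positivity go together: the sample means lie in the orthant, where the model is
    controlled, because the estimate used for sampling is itself admissible. *)
Let est_ok n w : (exists N, bounded_weight K (est n w) N) /\ (forall x, ~ K x -> 0 < est n w x).
Proof.
elim: n => [|n [ih1 ih2]]; first by split; [exists N0|].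
have o : orthant (\row_i stage_mean n i w) by move=> i; rewrite mxE; exact: (stage_mean_nneg i ih1 ih2).
rewrite estS; split; first exact: F_bounded.
by move=> x nK; apply: lt_le_trans eps0 (F_eps o nK).
Qed.

Let est_bounded n w := (est_ok n w).1.
Let est_gt0 n w := (est_ok n w).2.

Lemma stage_mean_ge0 n i w : 0 <= stage_mean n i w.
Proof. exact: (stage_mean_nneg i (est_bounded n w) (@est_gt0 n w)). Qed.

Lemma stage_orthant n w : orthant (\row_i stage_mean n i w).
Proof. by move=> i; rewrite mxE stage_mean_ge0. Qed.

(** The exact means are mapped to the target, so the Lipschitz bound applies between them and the
    sample means; the maximum norm is at most the Euclidean one. *)
Lemma est_close n w x :
  `|est n.+1 w x - m x| <= Lip * Num.sqrt (squared_error n w).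
Proof.
have o : orthant (\row_i m (D i)) by move=> i; rewrite mxE; case: bm => _ h _ _; exact: h.
rewrite -(F_true x) estS; apply: le_trans (F_lip (stage_orthant n w) o x) _.
apply: ler_wpM2l => //; rewrite /Num.Def.normr/= mx_normrE bigmax_le ?sqrtr_ge0//= => -[i j] _.
rewrite !mxE -sqrtr_sqr ler_wsqrtr//.
rewrite /squared_error (bigD1 j)//= lerDl; apply: sumr_ge0 => k _; exact: sqr_ge0.
Qed.

Lemma est_ge n w x : ~ K x -> eps <= est n.+1 w x.
Proof. by move=> nK; rewrite estS; exact: F_eps (stage_orthant n w) nK. Qed.

Let stage_meanE n i (w : past_space n.+1) : stage_mean n i w =
  score_mean (id : past_space n.+1 -> past_space n) (sim n : _ -> _ -> past_space n.+1 -> _)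
    (score P K s beta PP (est n : past_space n -> _) (dim := dim)) i w.
Proof. by rewrite /score_mean card_ord. Qed.

(** Induction over the stages: the sample means are measurable in the past and the model is
    Lipschitz in them, which gives joint measurability in the past and the state. *)
Lemma measurable_est n : measurable_fun setT (fun z : past_space n * S => est n z.1 z.2).
Proof.
elim: n => [|n ih].
  by case: bmu0 => mmu0 _ _ _; exact: (measurableT_comp mmu0 measurable_snd).
apply: (measurable_caratheodory (y := fun w : past_space n.+1 => \row_i stage_mean n i w)
  (F := F) _ _ _ F_lip).
- move=> i; rewrite (_ : (fun w => _) = stage_mean n i); last first.
    by apply/funext => w; rewrite mxE.
  rewrite (_ : stage_mean n i = score_mean (id : past_space n.+1 -> past_space n)
     (sim n : _ -> _ -> past_space n.+1 -> _)
     (score P K s beta PP (est n : past_space n -> _) (dim := dim)) i); last first.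
    by apply/funext => w; exact: stage_meanE.
  have /choice[Nu bNu] := est_bounded n.
  apply: measurable_score_mean.
  + exact: measurable_past.
  + by move=> *; exact: measurable_past_sim.
  + move=> k; exact: (nneg_score mK ms mbeta s_ge0 beta_gt0 PP_law sM0 bM0 s_le beta_le bm muE AE
      ih bNu (est_gt0 n)).
- by move=> w i; rewrite mxE stage_mean_ge0.
- by move=> v o; have [N []] := F_bounded o.
Qed.

Lemma measurable_squared_error n : measurable_fun setT (squared_error n : past_space n.+1 -> R).
Proof.
have /choice[Nu bNu] := est_bounded n.
rewrite (_ : squared_error n = err (id : past_space n.+1 -> past_space n)
     (sim n : _ -> _ -> past_space n.+1 -> _)
     (score P K s beta PP (est n : past_space n -> _) (dim := dim)) (fun i => m (D i))); last first.
  by apply/funext => w; apply: eq_bigr => i _; rewrite stage_meanE.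
apply: measurable_err.
- exact: measurable_past.
- by move=> *; exact: measurable_past_sim.
- move=> k; exact: (nneg_score mK ms mbeta s_ge0 beta_gt0 PP_law sM0 bM0 s_le beta_le bm muE AE
    (@measurable_est n) bNu (est_gt0 n)).
Qed.

Lemma squared_error_ge0 n w : 0 <= squared_error n w.
Proof. by apply: sumr_ge0 => i _; exact: sqr_ge0. Qed.

Variables (b B : R) (contract : contracts P K s beta PP m eps D Lip b B rep).

(** [contracts] at stage [n + 1], with the past as parameter and the error of stage [n] as [e].
    Stage 0 is left out, since [mu0] need not be bounded below by [eps]. *)
Lemma squared_error_contraction n :
  (\int[Pr]_w (lyapunov B b (squared_error n.+1 w))%:E <=
   (8^-1)%:E * \int[Pr]_w (lyapunov B b (squared_error n w))%:E)%E.
Proof.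
have joint (E : set (past_space n.+1)) (C : 'I_dim -> 'I_rep -> set (trajectory S)) :
    measurable E -> (forall i j, measurable (C i j)) ->
    Pr (id @^-1` E `&` [set w | forall i j, C i j (sim n.+1 i j w)]) =
    (\int[Pr]_(w in id @^-1` E) \prod_(i < dim) \prod_(j < rep)
      QQ (est n.+1 (id w)) (D i) (C i j))%E.
  by move=> mE mC; exact: simulation.2.
have law i (w : past_space n.+1) :
    markov_law (Q P K s beta PP (est n.+1 w)) (D i) (QQ (est n.+1 w) (D i)).
  by have [N bN] := est_bounded n.+1 w; exact: QQ_law bN (est_gt0 n.+1 w) _.
have := @contract _ _ _ _ Pr _ (@measurable_past_Omega n.+1) _ (@measurable_est n.+1) (est_bounded n.+1)
  (fun w x => @est_ge n w x) _ law _ (simulation.1 n.+1) joint _ (@measurable_squared_error n)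
  (squared_error_ge0 n) (est_close n).
congr (_ <= _)%E; apply: eq_integral => w _; congr (EFin (lyapunov _ _ _)).
by apply: eq_bigr => i _; rewrite /score_mean card_ord.
Qed.

Variables (b0 : 0 < b) (x0 : S).

Lemma ae_squared_error_decay :
  {ae Pr, forall w, exists C, 0 <= C /\
    \forall n \near \oo, squared_error n w <= C * 4^-1 ^+ n}.
Proof.
have mW n : measurable_fun setT (fun w => lyapunov B b (squared_error n w)).
  apply: measurable_lyapunov.
  exact: (measurableT_comp (@measurable_squared_error n) (@measurable_past_Omega n.+1)).
have W0 n w : 0 <= lyapunov B b (squared_error n w).
  by apply: lyapunov_ge0; [exact: ltW|exact: squared_error_ge0].
have := ae_geometric_decay mW W0 (fun w => lyapunov_le B (ltW b0) _) squared_error_contraction.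
have FF : Filter (almost_everywhere Pr) := ae_filter_ringOfSetsType Pr.
apply: filterS => w [C hC].
have C0 : 0 <= C by have := hC 0%N; rewrite expr0 mulr1; exact: le_trans.
exists C; split=> //.
have q1 : `|4^-1 : R| < 1 by rewrite ger0_norm ?invr_ge0// invf_lt1// ltr1n.
have := cvg_geometric C q1 => /cvgrPdist_lt/(_ _ b0); apply: filterS => n.
rewrite /= sub0r normrN ger0_norm ?mulr_ge0 ?exprn_ge0 ?invr_ge0// => Cb.
have := le_lt_trans (hC n) Cb => /(lyapunov_lt (ltW b0)) <-.
exact: hC.
Qed.

Lemma supnorm_est n w :
  (supnorm (fun x => (est n.+1 w x)%:E - mu K s beta PP x) <=
   (Lip * Num.sqrt (squared_error n w))%:E)%E.
Proof.
apply: ge_ereal_sup => _ [x _ <-].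
by rewrite muE -EFinB abse_EFin lee_fin est_close.
Qed.

(** The squared error decays like [4^-n], hence the distance like [2^-n], and [3/2 * 1/2 = 3/4 < 1];
    any rate below 2 would do. *)
Lemma algorithm_converges :
  {ae Pr, forall w, (fun n => ((3 / 2) ^+ n)%:E *
     supnorm (fun x => (est n w x)%:E - mu K s beta PP x))%E @ \oo --> 0%E}.
Proof.
have FF : Filter (almost_everywhere Pr) := ae_filter_ringOfSetsType Pr.
apply: filterS ae_squared_error_decay => w [C [C0 hC]].
(* The error of stage [n] controls the estimate of index [n + 1]. *)
rewrite -(cvg_shiftS (fun n => _)).
have q1 : `|3 / 4 : R| < 1 by rewrite ger0_norm ?divr_ge0// ltr_pdivrMr// mul1r ltr_nat.
pose u n : R := geometric (3 / 2 * (Lip * Num.sqrt C)) (3 / 4) n.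
have h : (EFin \o u) @ \oo --> 0%E.
  by apply: cvg_EFin; [exact: nearW|exact: cvg_geometric].
apply: (squeeze_cvge (f := fun=> 0%E) _ _ h); last exact: cvg_cst.
apply: filterS hC => n en; apply/andP; split.
  apply: mule_ge0; first by rewrite lee_fin exprn_ge0// divr_ge0.
  (* The supremum of an empty set would be [-oo]; the point [x0] makes it nonnegative. *)
  apply: ereal_sup_ge; exists `|(est n.+1 w x0)%:E - mu K s beta PP x0|%E; first by exists x0.
  exact: abse_ge0.
apply: le_trans (lee_wpmul2l _ (supnorm_est n w)) _; first by rewrite lee_fin exprn_ge0// divr_ge0.
rewrite -EFinM lee_fin /u /=.
have -> : (3 / 4 : R) = 3 / 2 * 2^-1 by field.
have se : Num.sqrt (squared_error n w) <= Num.sqrt C * 2^-1 ^+ n.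
  apply: (@le_trans _ _ (Num.sqrt (C * 4^-1 ^+ n))); first exact: ler_wsqrtr.
  rewrite sqrtrM//; have -> : (4^-1 : R) = 2^-1 ^+ 2 by field.
  by rewrite -exprM mulnC exprM sqrtr_sqr ger0_norm// exprn_ge0// invr_ge0.
have t0 : 0 <= (3 / 2) ^+ n.+1 * Lip :> R by rewrite mulr_ge0// exprn_ge0// divr_ge0.
rewrite mulrA; apply: le_trans (ler_wpM2l t0 se) _.
rewrite [(3 / 2 * 2^-1) ^+ n]exprMn exprS.
set u1 := (3 / 2) ^+ n; set u2 := 2^-1 ^+ n.
by rewrite le_eqVlt; apply/orP; left; apply/eqP; ring.
Qed.

End algorithm.

(** The maximum with 0 covers the empty set, whose supremum is [-oo]: [K] may be the whole space. *)
Lemma ereal_sup_bound (R : realType) (E : set \bar R) : (ereal_sup E < +oo)%E ->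
  exists2 r, 0 <= r & forall z, E z -> (z <= r%:E)%E.
Proof.
move=> E_oo; exists (fine (Order.max (ereal_sup E) 0%E)).
  by apply: fine_ge0; rewrite le_max lexx orbT.
move=> z Ez; rewrite fineK ?le_max ?ereal_sup_ubound//.
by rewrite ge0_fin_numE ?gt_max ?E_oo ?ltry// le_max lexx orbT.
Qed.

(** The minimum with 1 keeps the bound real when the infimum is [+oo]. *)
Lemma ereal_inf_bound (R : realType) (E : set \bar R) : (0 < ereal_inf E)%E ->
  exists2 r, 0 < r <= 1 & forall z, E z -> (r%:E <= z)%E.
Proof.
move=> E0; have f : Order.min (ereal_inf E) 1%E \is a fin_num.
  rewrite ge0_fin_numE ?le_min ?(ltW E0) ?lee01//.
  by rewrite gt_min ltry orbT.
exists (fine (Order.min (ereal_inf E) 1%E)).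
  by rewrite -lte_fin -lee_fin fineK// lt_min E0 lte01 ge_min lexx orbT.
by move=> z Ez; rewrite fineK// ge_min ereal_inf_lbound.
Qed.

Section assumptions.
Context (R : realType) d (S : measurableType d) (K : set S).

Lemma bounded_nonneg_weight (nu : S -> R) : bounded_nonneg K nu ->
  exists N, bounded_weight K nu N.
Proof.
move=> [mnu /ereal_sup_bound[N N0 hN] nu0 nu_ge0]; exists N; split=> // x.
apply: le_trans (ler_norm _) _; rewrite -lee_fin -abse_EFin; apply: hN.
by exists x.
Qed.

Lemma weight_bounded_nonneg (nu : S -> R) N : bounded_weight K nu N -> bounded_nonneg K nu.
Proof.
move=> [mnu nu_ge0 nu0 nuN]; split=> //; apply: le_lt_trans (ltry N).
by apply: ge_ereal_sup => _ [x _ <-]; rewrite /= lee_fin ger0_norm.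
Qed.

End assumptions.

Theorem theorem1 (R : realType) (S : ptopologicalType)
  (S_polish : polish_space R S)
  (P : R.-pker (borel S) ~> (borel S))
  (K : set (borel S)) (K_measurable : measurable K)
  (s beta : borel S -> borel S -> R)
  (s_measurable :
    measurable_fun setT (fun z : borel S * borel S => s z.1 z.2))
  (beta_measurable :
    measurable_fun setT (fun z : borel S * borel S => beta z.1 z.2))
  (s_ge0 : forall x y, 0 <= s x y)
  (beta_gt0 : forall x y, 0 < beta x y)
  (s_stop : forall x y, K x -> s x y = 0)
  (* the laws P_x of the chain with kernel P *)
  (PP : borel S -> probability (trajectory (borel S)) R)
  (PP_law : forall x, markov_law (fun x B => P x B) x (PP x))
  (* every x with P_x(Y > 0) = 0 belongs to K *)
  (Y_nontrivial : forall x,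
    PP x [set w | (0 < Y K s beta w)%E] = 0%E -> K x)
  (* the laws Q_{nu,x} of the importance sampling chains *)
  (QQ : (borel S -> R) -> borel S -> probability (trajectory (borel S)) R)
  (QQ_law : forall nu, admissible K s beta PP nu ->
    forall x, markov_law (Q P K s beta PP nu) x (QQ nu x))
  (dim p : nat) (D : 'I_dim -> borel S)
  (D_subset : forall i, A K s beta PP (D i))
  (model : 'rV[R]_p -> borel S -> R) (alpha : 'rV[R]_dim -> 'rV[R]_p)
  (alpha_true : 'rV[R]_p)
  (model_true : forall x, (model alpha_true x)%:E = mu K s beta PP x)
  (assum1 : assumption1 K s beta PP)
  (assum2 : assumption2 K s beta PP)
  (assum4 : assumption4 K s beta PP D model alpha) :
  exists (R0 : nat) (theta : R), 1 < theta /\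
    forall rep : nat, (R0 <= rep)%N ->
    forall mu0 : borel S -> R, admissible K s beta PP mu0 ->
    forall (d : measure_display) (Omega : measurableType d)
      (Pr : probability Omega R)
      (sim : nat -> 'I_dim -> 'I_rep -> Omega -> trajectory (borel S)),
    adaptive_simulation P K s beta PP D model alpha mu0 QQ Pr sim ->
    \forall omega \ae Pr,
      (fun n : nat =>
         (theta ^+ n)%:E *
         supnorm (fun x =>
           (estimate P K s beta PP model alpha mu0 sim n omega x)%:E
           - mu K s beta PP x))%E @ \oo --> 0%E.

Proof.
have AK := A_alive K_measurable s_measurable beta_measurable s_ge0 beta_gt0 PP_law Y_nontrivial.
have inA x : ~ K x -> A K s beta PP x by move=> nK; rewrite AK.
case: assum1 => /ereal_sup_bound[sM sM0 hsM] /ereal_sup_bound[bM bM0 hbM]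
  /ereal_inf_bound[bmin /andP[bmin0 _] hbmin] /ereal_sup_bound[M M0 hM].
have s_le x y : ~ K x -> s x y <= sM.
  by move=> nK; rewrite -lee_fin; apply: hsM; exists x, y; split=> //; exact: inA.
have beta_le x y : ~ K x -> beta x y <= bM.
  by move=> nK; rewrite -lee_fin; apply: hbM; exists x, y; split=> //; exact: inA.
have beta_ge x y : ~ K x -> bmin <= beta x y.
  by move=> nK; rewrite -lee_fin; apply: hbmin; exists x, y; split=> //; exact: inA.
have nneg := nneg_mu K_measurable s_measurable beta_measurable s_ge0 beta_gt0 PP_law.
have mu0K x : K x -> mu K s beta PP x = 0%E.
  exact: (mu_dead K_measurable s_measurable beta_measurable s_ge0 beta_gt0 PP_law).
have mu_le x : (mu K s beta PP x <= M%:E)%E.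
  have [Kx|nK] := pselect (K x); first by rewrite mu0K.
  by apply: hM; exists x => //; exact: inA.
pose m x := fine (mu K s beta PP x).
have muE x : mu K s beta PP x = (m x)%:E.
  rewrite /m fineK// ge0_fin_numE; last exact: nneg.2.
  exact: le_lt_trans (mu_le x) (ltry _).
have bm : bounded_weight K m M.
  split.
  - by apply: measurableT_comp => //; exact: nneg.1.
  - by move=> x; apply: fine_ge0; exact: nneg.2.
  - by move=> x Kx; rewrite /m mu0K.
  - by move=> x; rewrite -lee_fin -muE.
have [n0 /ereal_inf_bound[c0 /andP[c0_gt0 c0_le1] hc]] := assum2.
(* One step more than in Assumption 2, so that the block length is positive. *)
have hc0 y : ~ K y -> (c0%:E <= \sum_(t < n0.+1)
    iter t (kop P (stay R K)) (kop P (last_gain K s) (fun=> 1)) y)%E.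
  move=> nK; have wstay := weight_stay R K_measurable.
  have wgain := weight_last_gain K_measurable s_measurable s_ge0.
  have := nneg_iter_kop P n0 wstay (nneg_kop P wgain (nneg_cst _ ler01)).
  rewrite big_ord_recr /= => -[_ last0]; apply: (@le_trans _ _ _ _ _ _ (leeDl _ (last0 y))).
  rewrite -(last_score_expectation K_measurable s_measurable s_ge0 s_stop PP_law).
  by apply: hc; exists y => //; exact: inA.
case: assum4 => [[F_bnd [C F_lipC]] F_true [eps eps0 F_epsA]].
(* The constant of Assumption 4 carries no sign. *)
pose Lip := Num.max C 0.
have Lip0 : 0 <= Lip by rewrite le_max lexx orbT.
pose F v := model (alpha v).
have F_bounded v : orthant v -> exists N, bounded_weight K (F v) N.
  by move=> o; apply: bounded_nonneg_weight; exact: F_bnd.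
have F_lip v v' : orthant v -> orthant v' ->
    forall x, `|F v x - F v' x| <= Lip * `|v - v'|.
  move=> o o' x; apply: (@le_trans _ _ (C * `|v - v'|)); last first.
    by rewrite ler_wpM2r// le_max lexx.
  rewrite -lee_fin -abse_EFin; apply: le_trans (F_lipC v v' o o').
  by apply: ereal_sup_ubound; exists x.
have F_eps v x : orthant v -> ~ K x -> eps <= F v x.
  by move=> o nK; apply: F_epsA => //; exact: inA.
have F_true' x : F (\row_i m (D i)) x = m x.
  by apply: EFin_inj; rewrite -muE -F_true.
have nKD i : ~ K (D i) by have := D_subset i; rewrite AK.
have QQ_law' nu N : bounded_weight K nu N -> (forall x, ~ K x -> 0 < nu x) ->
    forall x, markov_law (Q P K s beta PP nu) x (QQ nu x).
  move=> bnu pos; apply: QQ_law; split; first exact: weight_bounded_nonneg bnu.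
  by move=> x; rewrite AK; exact: pos.
have [b [B [R0 [b0 bB contr]]]] := contraction_constants K_measurable s_measurable beta_measurable
  s_ge0 beta_gt0 PP_law sM0 bM0 s_le beta_le bm muE AK M0 eps0 bmin0 beta_ge (ltn0Sn n0)
  c0_gt0 c0_le1 hc0 nKD Lip0.
exists (maxn R0 1), (3 / 2); split; first by rewrite ltr_pdivlMr// mul1r ltr_nat.
move=> rep; rewrite geq_max => /andP[repR0 rep0] mu0 [/bounded_nonneg_weight[N0 bmu0] mu0_pos]
  d Omega Pr sim simulation.
have mu0_gt0 x : ~ K x -> 0 < mu0 x by move=> nK; apply: mu0_pos; exact: inA.
have := algorithm_converges K_measurable s_measurable beta_measurable
  s_ge0 beta_gt0 PP_law sM0 bM0 s_le beta_le bm muE AK eps0 Lip0 F_bounded F_lip F_eps F_true'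
  QQ_law' bmu0 mu0_gt0 simulation (contr rep repR0) b0 (point : S).
by [].
Qed.
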